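(* The following decision problem (SNNI verification problem) is PSPACE-complete: given a timed automaton $A$ over an alphabet $\Sigma=\Sigma_l\uplus\Sigma_h$ such that $A\backslash\Sigma_h$ is deterministic, decide whether $A$ is SNNI, i.e. whether $\mathcal{L}(A\backslash\Sigma_h)=\mathcal{L}(A/\Sigma_h)$.
   Context: A timed automaton (TA) is a tuple $A=(Q,q_0,X,\Sigma^\varepsilon,E,Inv)$ with $Q$ a finite set of locations, $q_0\in Q$ initial, $X$ a finite set of real-valued clocks, $\Sigma$ a finite alphabet, $\Sigma^\varepsilon=\Sigma\cup\{\varepsilon\}$, $E\subseteq Q\times\mathcal{C}(X)\times\Sigma^\varepsilon\times 2^X\times Q$ a finite set of edges (guard, action, reset set), where $\mathcal{C}(X)$ is the set of conjunctions of atomic constraints $x\bowtie c$ ($x\in X$, $c\in\mathbb{N}$, $\bowtie\in\{<,\le,=,\ge,>\}$), and $Inv:Q\to\mathcal{C}(X)$ assigns invariants built only with $<,\le$. Its semantics is the timed transition system with states $(q,v)$, $v\in\mathbb{R}_{\ge0}^X$, initial state $(q_0,\vec 0)$, discrete transitions $(q,v)\xrightarrow{a}(q',v')$ iff there is an edge $(q,\gamma,a,R,q')$ with $\gamma(v)$ true, $v'=v[R\mapsto0]$ and $Inv(q')(v')$ true, and delay transitions $(q,v)\xrightarrow{\delta}(q,v+\delta)$ iff $Inv(q)(v+\delta')$ holds for all $0\le\delta'\le\delta$. A timed word is a finite sequence $(\delta_0,a_0)\cdots(\delta_n,a_n)$ with $\delta_i\in\mathbb{R}_{\ge0}$, $a_i\in\Sigma$,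 where a pair $(\delta,\varepsilon)$ is absorbed by adding $\delta$ to the delay of the next action. The trace of a run written in normal form $s_0\xrightarrow{\delta_0}\xrightarrow{e_0}\cdots\xrightarrow{\delta_n}\xrightarrow{e_n}s\xrightarrow{\delta}s'$ is $(\delta_0,e_0)\cdots(\delta_n,e_n)$, and $\mathcal{L}(A)$ is the set of traces of runs from the initial state. $A$ is deterministic if for any two edges $(q,\gamma,a,R,q')$, $(q,\gamma',a,R',q'')$ with $\gamma\wedge\gamma'$ satisfiable we have $q'=q''$ and $R=R'$. For $L\subseteq\Sigma$, $A/L$ is obtained from $A$ by relabelling every edge whose action lies in $L$ by $\varepsilon$, and $A\backslash L$ is obtained by deleting every edge whose action lies in $L$. The alphabet is partitioned into low-level actions $\Sigma_l$ and high-level actions $\Sigma_h$.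
   Formalization: The given automaton A is required to have no ε-labelled edges (ε arises only in A/Σ_h); with ε-edges allowed, the stated determinism does not exclude ε-nondeterminism and the problem would be undecidable. *)

(* Defs.v *)
From HB Require Import structures.
From mathcomp Require Import all_boot all_order all_algebra.
From mathcomp Require Import classical_sets reals.

Set Implicit Arguments.
Unset Strict Implicit.
Unset Printing Implicit Defensive.

Import Order.TTheory GRing.Theory Num.Theory.

(** * Deterministic multi-tape Turing machines *)

Inductive move := MoveLeft | MoveStay | MoveRight.

(* There is at least one tape; the tapes are infinite to the right only.
   [tm_verdict q = None] means that the machine keeps running in state [q];
   [tm_verdict q = Some b] means that it has halted, accepting iff [b]. *)
Record turing_machine := TuringMachine {
  tm_tapes : nat;
  tm_state : finType;
  tm_symbol : finType;
  tm_blank : tm_symbol;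
  tm_input : bool -> tm_symbol;
  tm_input_inj : injective tm_input;
  tm_input_blank : forall b, tm_input b != tm_blank;
  tm_start : tm_state;
  tm_verdict : tm_state -> option bool;
  tm_delta : tm_state -> {ffun 'I_tm_tapes.+1 -> tm_symbol} ->
             tm_state * ('I_tm_tapes.+1 -> tm_symbol * move)
}.

Section Execution.
Variable M : turing_machine.

Record config := Config {
  cfg_state : tm_state M;
  cfg_head : 'I_(tm_tapes M).+1 -> nat;
  cfg_tape : 'I_(tm_tapes M).+1 -> nat -> tm_symbol M
}.

(* Moving left on the leftmost cell leaves the head in place. *)
Definition move_head (m : move) (h : nat) : nat :=
  match m with MoveLeft => h.-1 | MoveStay => h | MoveRight => h.+1 end.

Definition tm_step (c : config) : config :=
  if tm_verdict (cfg_state c) is Some _ then c else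
  let: (q, act) :=
    tm_delta (cfg_state c) [ffun i => cfg_tape c i (cfg_head c i)] in
  Config q
    (fun i => move_head (act i).2 (cfg_head c i))
    (fun i j => if j == cfg_head c i then (act i).1 else cfg_tape c i j).

Definition written (w : seq bool) : nat -> tm_symbol M :=
  nth (tm_blank M) [seq tm_input M b | b <- w].

Definition tm_init (w : seq bool) : config :=
  Config (tm_start M) (fun _ => 0)
    (fun i => if i == ord0 then written w else written [::]).

Definition tm_run (w : seq bool) (t : nat) : config := iter t tm_step (tm_init w).

Definition halts_with (w : seq bool) (t : nat) (b : bool) : Prop :=
  tm_verdict (cfg_state (tm_run w t)) = Some b.

Definition runs_in_space (w : seq bool) (s : nat) : Prop :=
  forall t i, cfg_head (tm_run w t) i < s.

(* The output is read on the last tape. *)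
Definition outputs_in_time (w w' : seq bool) (s : nat) : Prop :=
  exists t b, [/\ t <= s, halts_with w t b &
                  cfg_tape (tm_run w t) ord_max =1 written w'].

End Execution.

(** * Decision problems and PSPACE-completeness *)

Record decision_problem := DecisionProblem {
  instance : Type;
  encode : instance -> seq bool;
  answer : instance -> Prop
}.

Definition language_problem (L : seq bool -> Prop) : decision_problem :=
  @DecisionProblem (seq bool) id L.

Definition in_PSPACE (P : decision_problem) : Prop :=
  exists (M : turing_machine) (p : {poly nat}), forall x : instance P,
    runs_in_space M (encode x) p.[size (encode x)]%R /\
    exists t b, halts_with M (encode x) t b /\ (b <-> answer x).

Definition poly_reduces (P P' : decision_problem) : Prop :=
  exists (M : turing_machine) (p : {poly nat}) (f : instance P -> instance P'),
  forall x : instance P,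
    outputs_in_time M (encode x) (encode (f x)) p.[size (encode x)]%R /\
    (answer x <-> answer (f x)).

Definition PSPACE_hard (P : decision_problem) : Prop :=
  forall L : seq bool -> Prop,
    in_PSPACE (language_problem L) -> poly_reduces (language_problem L) P.

Definition PSPACE_complete (P : decision_problem) : Prop :=
  in_PSPACE P /\ PSPACE_hard P.

(** * Timed automata *)

Inductive cmp := CmpLt | CmpLe | CmpEq | CmpGe | CmpGt.

Definition nat_of_cmp (o : cmp) : nat :=
  match o with CmpLt => 0 | CmpLe => 1 | CmpEq => 2 | CmpGe => 3 | CmpGt => 4 end.

Definition cmp_of_nat (n : nat) : cmp :=
  match n with 0 => CmpLt | 1 => CmpLe | 2 => CmpEq | 3 => CmpGe | _ => CmpGt end.

Lemma nat_of_cmpK : cancel nat_of_cmp cmp_of_nat.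
Proof. by case. Qed.

HB.instance Definition _ := Countable.copy cmp (can_type nat_of_cmpK).

(* A conjunction of atomic constraints [x op c]. *)
Definition constraint (X : finType) : Type := seq (X * cmp * nat).

Definition upper_bounded (X : finType) (g : constraint X) : bool :=
  all (fun a => a.1.2 \in [:: CmpLt; CmpLe]) g.

(* Source, guard, action ([None] is epsilon), reset set, target. *)
Definition edge (Q X S : finType) : Type :=
  (Q * constraint X * option S * {set X} * Q)%type.

Record timed_automaton (Q X S : finType) := TimedAutomaton {
  ta_init : Q;
  ta_edges : seq (edge Q X S);
  ta_inv : Q -> constraint X;
  ta_inv_upper : forall q, upper_bounded (ta_inv q)
}.

Section Operations.
Variables (Q X S : finType).

Definition hide_label (L : {set S}) (a : option S) : option S :=
  if a is Some b then if b \in L then None else Some b else None.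

(* A/L *)
Definition hide_actions (A : timed_automaton Q X S) (L : {set S}) :
    timed_automaton Q X S :=
  TimedAutomaton (ta_init A)
    [seq let: (q, g, a, r, q') := e in (q, g, hide_label L a, r, q')
       | e <- ta_edges A]
    (ta_inv_upper A).

(* A\L *)
Definition delete_actions (A : timed_automaton Q X S) (L : {set S}) :
    timed_automaton Q X S :=
  TimedAutomaton (ta_init A)
    [seq e <- ta_edges A
       | let: (q, g, a, r, q') := e in
         if a is Some b then b \notin L else true]
    (ta_inv_upper A).

Definition epsilon_free (A : timed_automaton Q X S) : Prop :=
  forall q g a r q', (q, g, a, r, q') \in ta_edges A -> a != None.

End Operations.

Section Semantics.
Local Open Scope ring_scope.
Variables (R : realType) (Q X S : finType).

Definition eval_cmp (o : cmp) (x y : R) : bool :=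
  match o with
  | CmpLt => x < y | CmpLe => x <= y | CmpEq => x == y
  | CmpGe => x >= y | CmpGt => x > y
  end.

Definition sat (v : X -> R) (g : constraint X) : bool :=
  all (fun a => let: (x, o, c) := a in eval_cmp o (v x) c%:R) g.

Definition deterministic (A : timed_automaton Q X S) : Prop :=
  forall q g g' a r r' q' q'',
    (q, g, a, r, q') \in ta_edges A -> (q, g', a, r', q'') \in ta_edges A ->
    (exists v : X -> R, [/\ forall x, 0 <= v x, sat v g & sat v g']) ->
    q' = q'' /\ r = r'.

(* All states reachable from [(q0, 0)] have nonnegative clock values. *)
Definition ta_state : Type := (Q * (X -> R))%type.

Definition discrete_step (A : timed_automaton Q X S)
    (s : ta_state) (a : option S) (s' : ta_state) : Prop :=
  exists g r,
    [/\ (s.1, g, a, r, s'.1) \in ta_edges A, sat s.2 g,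
        s'.2 = (fun x => if x \in r then 0 else s.2 x) &
        sat s'.2 (ta_inv A s'.1)].

Definition delay_step (A : timed_automaton Q X S)
    (s : ta_state) (d : R) (s' : ta_state) : Prop :=
  [/\ 0 <= d, s' = (s.1, fun x => s.2 x + d) &
      forall d', 0 <= d' <= d -> sat (fun x => s.2 x + d') (ta_inv A s.1)].

(* Runs in normal form, indexed by their sequence of delays and labels. *)
Inductive run (A : timed_automaton Q X S) :
    ta_state -> seq (R * option S) -> ta_state -> Prop :=
| run_last s d s' : delay_step A s d s' -> run A s [::] s'
| run_cons s d s1 a s2 u s' :
    delay_step A s d s1 -> discrete_step A s1 a s2 -> run A s2 u s' ->
    run A s ((d, a) :: u) s'.

(* [absorb 0 u] adds the delay of each epsilon to that of the next action;
   [d0] is the delay accumulated so far. *)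
Fixpoint absorb (d0 : R) (u : seq (R * option S)) : seq (R * S) :=
  match u with
  | [::] => [::]
  | (d, None) :: u' => absorb (d0 + d) u'
  | (d, Some a) :: u' => (d0 + d, a) :: absorb 0 u'
  end.

Definition ta_language (A : timed_automaton Q X S) : set (seq (R * S)) :=
  fun w => exists u s, run A (ta_init A, fun _ => 0) u s /\ w = absorb 0 u.

Definition SNNI (A : timed_automaton Q X S) (high : {set S}) : Prop :=
  ta_language (delete_actions A high) = ta_language (hide_actions A high).

End Semantics.

(** * Encoding of timed automata as bit strings *)

Section Encoding.

(* A self-delimiting code for lists of (self-delimiting) items. *)
Definition code_seq (T : Type) (f : T -> seq bool) (s : seq T) : seq bool :=
  flatten [seq true :: f x | x <- s] ++ [:: false].

(* Binary digits, least significant first. *)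
Definition code_nat (n : nat) : seq bool :=
  code_seq (fun b => [:: b])
    (mkseq (fun i => odd (n %/ 2 ^ i)) (trunc_log 2 n).+1).

Definition code_elt (T : finType) (x : T) : seq bool := code_nat (enum_rank x).

Definition code_constraint (X : finType) (g : constraint X) : seq bool :=
  code_seq (fun a => let: (x, o, c) := a in
                     code_elt x ++ code_nat (nat_of_cmp o) ++ code_nat c) g.

Variables (Q X S : finType).

Definition code_label (a : option S) : seq bool :=
  if a is Some b then true :: code_elt b else [:: false].

Definition code_edge (e : edge Q X S) : seq bool :=
  let: (q, g, a, r, q') := e in
  code_elt q ++ code_constraint g ++ code_label a ++
  code_seq (@code_elt X) (enum r) ++ code_elt q'.

(* Clocks (in unary), letters (each flagged low or high), locations (each
   given by its invariant), initial location, edges. *)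
Definition code_ta (A : timed_automaton Q X S) (high : {set S}) : seq bool :=
  code_seq (fun _ : X => [::]) (enum X) ++
  code_seq (fun a : S => [:: a \in high]) (enum S) ++
  code_seq (fun q : Q => code_constraint (ta_inv A q)) (enum Q) ++
  code_elt (ta_init A) ++
  code_seq code_edge (ta_edges A).

End Encoding.

(** * The SNNI verification problem *)

(* The low-level actions are those outside [si_high].  Epsilon labels arise
   only from hiding: with epsilon edges allowed in [si_ta], the notion
   [deterministic] would not exclude epsilon-nondeterminism, and the problem
   would be undecidable. *)
Record SNNI_instance (R : realType) := SNNIInstance {
  si_loc : finType;
  si_clock : finType;
  si_act : finType;
  si_high : {set si_act};
  si_ta : timed_automaton si_loc si_clock si_act;
  si_eps_free : epsilon_free si_ta;
  si_det : deterministic R (delete_actions si_ta si_high)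
}.

Definition SNNI_problem (R : realType) : decision_problem :=
  @DecisionProblem (SNNI_instance R)
    (fun I => code_ta (si_ta I) (si_high I))
    (fun I => SNNI R (si_ta I) (si_high I)).

(* Main.v *)
Require Import Defs.
From mathcomp Require Import all_boot all_order all_algebra zify lra.
From mathcomp Require Import boolp classical_sets reals.

(* Membership.  Since A\H is deterministic, A fails to be SNNI exactly when some
   run of A/H, accompanied by the unique run of A\H on its low-level actions,
   reaches a low-level action that A\H cannot match.  The future of such a pair
   of runs depends only on the capped integral parts of the clocks and on the
   order of their fractional parts, so the clock values may be taken in the
   multiples of 1/W, up to W, where W is the number whose binary digits are the
   encoding of A.  A state of the resulting graph is a number with polynomially
   many digits, and Savitch's algorithm decides reachability in polynomial space.
   Turing machines are obtained from bounded recursions on numbers, through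
   structured counter programs and counter machines with binary counters.

   Hardness.  A machine running in space s is simulated with high-level actions
   only.  There is one clock for each cell j and each possible contents d of it;
   a step takes one time unit and one pass over the tape, which resets the clock
   of the new contents of each cell, so that d is the contents of j at the next
   pass iff the clock of (j, d) does not exceed 1.  A rejecting state enables the
   only low-level action, which A\H can never perform. *)

Set Implicit Arguments.
Unset Strict Implicit.
Unset Printing Implicit Defensive.

(** The counter programs only know increment and decrement-and-test, so even an addition takes time
    exponential in the number of digits. This is harmless twice: membership only limits the number
    of digits, and in the reduction every number handled, unlike the strings, is polynomial in the
    length of the input. One calculus of bounded recursion, parametrised by the growth of its
    bounds, therefore serves both halves.

    The obstacle in the region graph is a real delay: a fixed choice of multiples of 1/W for the
    clocks may leave no room for a delay ending strictly between two of them. Each delay is thus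
    preceded by the passage to another, equivalent tuple of multiples. It exists because W is at
    least the number of coordinates involved: the clocks of both components, the constant zero and
    the delay itself.

    In the simulation, the symbols under the heads must be known before the first cell is rewritten.
    They are guessed at the start of a pass, and so is the column of each next cell; a wrong guess
    blocks the run. *)

Section FunctionUpdate.
Variables (I : eqType) (T : Type).

Definition upd (f : I -> T) (k : I) (x : T) : I -> T :=
  fun i => if i == k then x else f i.

Lemma upd_eq f k x : upd f k x k = x.
Proof. by rewrite /upd eqxx. Qed.

Lemma upd_neq f k x i : i != k -> upd f k x i = f i.
Proof. by rewrite /upd => /negbTE ->. Qed.

Lemma upd_upd f k x y : upd (upd f k x) k y = upd f k y.
Proof. by apply/funext => i; rewrite /upd; case: eqP. Qed.

Lemma upd_id f k : upd f k (f k) = f.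
Proof. by apply/funext => i; rewrite /upd; case: eqP => [->|]. Qed.

End FunctionUpdate.

(** * Binary counters *)

Definition bval (l : seq bool) : nat := foldr (fun (b : bool) a => b + a.*2) 0 l.

Fixpoint binc (l : seq bool) : seq bool :=
  match l with
  | [::] => [:: true]
  | true :: l' => false :: binc l'
  | false :: l' => true :: l'
  end.

Fixpoint bdec (l : seq bool) : seq bool :=
  match l with
  | [::] => [::]
  | false :: l' => true :: bdec l'
  | true :: l' => false :: l'
  end.

Lemma bval_binc l : bval (binc l) = (bval l).+1.
Proof. by elim: l => [//|[] l IH] //=; rewrite IH; lia. Qed.

Lemma size_binc l B : size l <= B -> (bval l).+1 < 2 ^ B -> size (binc l) <= B.
Proof.
elim: l B => [|[] l IH] [|B] //=; rewrite ?ltnS => sl; rewrite expnS => h.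
by apply: IH => //; lia.
Qed.

Lemma bval_bdec l : 0 < bval l -> bval (bdec l) = (bval l).-1.
Proof. by elim: l => [//|[] l IH] //= h; rewrite IH; lia. Qed.

Lemma size_bdec l : size (bdec l) = size l.
Proof. by elim: l => [//|[] l IH] //=; rewrite IH. Qed.

Lemma bval_eq0 l : bval l = 0 -> l = nseq (size l) false.
Proof. by elim: l => [//|[] l IH] //= h; rewrite -IH //; lia. Qed.

(** * Counter machines and their simulation by Turing machines *)

Inductive instr :=
| IInc of nat
| IDjz of nat & nat
| IJmp of nat
| IOut of bool
| IRead of nat & nat
| ILeft
| IHalt of bool.

Section Simulation.
Variables (code : seq instr) (nr : nat).

(* Tape 0 is the input, tape [r.+1] holds counter [r] with its least
   significant bit in cell 1 (cell 0 stays blank and marks the left end), and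
   the last tape is the output. *)
Definition tape_of (ins : instr) : 'I_nr.+2 :=
  match ins with
  | IInc r | IDjz r _ => inord r.+1
  | IOut _ => ord_max
  | _ => ord0
  end.

(** Phase 0 leaves the marker cell, phase 1 propagates the carry or the borrow to the right, phase 2
    returns to the marker. A borrow that runs into the blank reveals that the counter was zero; by
    then all its digits have become ones, and phase 3 clears them on the way back before jumping. *)
Definition micro (pc : nat) (ins : instr) (ph : nat) (s : option bool) :
    (nat * nat) * (option bool * move) :=
  match ins, ph with
  | IInc _, 0 | IDjz _ _, 0 => ((pc, 1), (s, MoveRight))
  | IInc _, 1 => if s is Some true then ((pc, 1), (Some false, MoveRight))
                 else ((pc, 2), (Some true, MoveLeft))
  | IDjz _ _, 1 =>
      match s with
      | Some false => ((pc, 1), (Some true, MoveRight))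
      | Some true => ((pc, 2), (Some false, MoveLeft))
      | None => ((pc, 3), (None, MoveLeft))
      end
  | IInc _, _ | IDjz _ _, 2 =>
      if s is None then ((pc.+1, 0), (None, MoveStay)) else ((pc, 2), (s, MoveLeft))
  | IDjz _ l, _ =>
      if s is None then ((l, 0), (None, MoveStay))
      else ((pc, 3), (Some false, MoveLeft))
  | IJmp l, _ => ((l, 0), (s, MoveStay))
  | IOut b, _ => ((pc.+1, 0), (Some b, MoveRight))
  | IRead l0 l1, _ =>
      if s is Some b then ((if b then l1 else l0, 0), (s, MoveRight))
      else ((pc.+1, 0), (None, MoveStay))
  | ILeft, _ => ((pc.+1, 0), (s, MoveLeft))
  | IHalt _, _ => ((pc, 0), (s, MoveStay))
  end.

(** An address past the end of the code reads as a rejecting halt, so [pc = size code] is a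
    legitimate state. *)
Definition fetch pc := nth (IHalt false) code pc.

Definition cm_state : finType := ('I_(size code).+1 * 'I_4)%type.

Definition cm_verdict (q : cm_state) : option bool :=
  if fetch q.1 is IHalt b then Some b else None.

Definition cm_delta (q : cm_state) (f : {ffun 'I_nr.+2 -> option bool}) :
    cm_state * ('I_nr.+2 -> option bool * move) :=
  let k := tape_of (fetch q.1) in
  let m := micro q.1 (fetch q.1) q.2 (f k) in
  ((inord m.1.1, inord m.1.2),
   fun i => if i == k then m.2 else (f i, MoveStay)).

Lemma Some_bool_inj : injective (@Some bool). Proof. by move=> ? ? []. Qed.

Lemma Some_neq_None (b : bool) : Some b != None. Proof. by []. Qed.

Definition cm_machine : turing_machine :=
  @TuringMachine nr.+1 cm_state (option bool) None Some
    Some_bool_inj Some_neq_None (ord0, ord0) cm_verdict cm_delta.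

Notation M := cm_machine.

Definition conf (pc ph : nat) H T : config M :=
  @Config M ((inord pc, inord ph) : cm_state) H T.

Lemma inordP (n k : nat) : k <= n -> (inord k : 'I_n.+1) = k :> nat.
Proof. by move=> h; rewrite inordK. Qed.

Lemma conf_step pc ph H T :
  pc <= size code -> ph <= 3 -> cm_verdict (inord pc, inord ph) = None ->
  let k := tape_of (fetch pc) in
  let m := micro pc (fetch pc) ph (T k (H k)) in
  tm_step (conf pc ph H T) =
  conf m.1.1 m.1.2 (upd H k (move_head m.2.2 (H k)))
    (upd T k (upd (T k) (H k) m.2.1)).
Proof.
move=> hpc hph hv k m; rewrite /tm_step /= hv /cm_delta /=.
rewrite !inordP // ffunE -/k -/m /conf; congr Config; apply/funext => i.
  by rewrite /upd; case: eqP => [->|].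
apply/funext => j; rewrite /upd; case: (i =P k) => [->|_]; first by [].
by rewrite ffunE; case: eqP => [->|].
Qed.

Definition runs (S t : nat) (c c' : config M) :=
  iter t (@tm_step M) c = c' /\
  forall t' k, t' <= t -> cfg_head (iter t' (@tm_step M) c) k < S.

Lemma runs0 S c : (forall k, cfg_head c k < S) -> runs S 0 c c.
Proof. by move=> h; split=> // -[|]. Qed.

Lemma runs_trans S t1 t2 c1 c2 c3 :
  runs S t1 c1 c2 -> runs S t2 c2 c3 -> runs S (t1 + t2) c1 c3.
Proof.
move=> [e1 h1] [e2 h2]; split; first by rewrite addnC iterD e1.
move=> t' k; case: (leqP t' t1) => [/h1 //|lt ht].
by rewrite -(subnK (ltnW lt)) iterD e1; apply: h2; lia.
Qed.

Lemma runs_head S t c c' k : runs S t c c' -> cfg_head c' k < S.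
Proof. by case=> <- h; apply: h. Qed.

Lemma runs_step S c c' : tm_step c = c' ->
  (forall k, cfg_head c k < S) -> (forall k, cfg_head c' k < S) -> runs S 1 c c'.
Proof. by move=> <- h h'; split=> // -[|[|]]. Qed.

Definition rtape (l : seq bool) (j : nat) : option bool :=
  if j is j'.+1 then nth None (map Some l) j' else None.

Lemma rtape_upd pre b b' l :
  upd (rtape (pre ++ b :: l)) (size pre).+1 (Some b') = rtape (pre ++ b' :: l).
Proof.
apply/funext => -[|j] /=; rewrite /upd //= eqSS !map_cat !nth_cat size_map.
case: ltngtP => //= [lt|->]; last by rewrite subnn.
by rewrite -(subnKC lt) addSn -addnS addKn.
Qed.

Lemma rtape_upd_end l b : upd (rtape l) (size l).+1 (Some b) = rtape (rcons l b).
Proof.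
apply/funext => -[|j] /=; rewrite /upd //= eqSS map_rcons nth_rcons size_map.
by case: ltngtP => // ?; rewrite nth_default // size_map ltnW.
Qed.

Lemma rtape_at pre b l : rtape (pre ++ b :: l) (size pre).+1 = Some b.
Proof. by rewrite /= map_cat nth_cat size_map ltnn subnn. Qed.

Lemma rtape_in l j : 0 < j <= size l -> rtape l j = Some (nth false l j.-1).
Proof.
by case: j => // j /= h; rewrite (nth_map false).
Qed.

Section OneTape.
Variables (S : nat) (k : 'I_nr.+2) (H : 'I_nr.+2 -> nat)
  (T : 'I_nr.+2 -> nat -> option bool) (pc : nat).
Hypothesis HS : forall i, H i < S.
Hypothesis pc_le : pc <= size code.
Hypothesis kE : tape_of (fetch pc) = k.

Definition foc pc' ph h tp := conf pc' ph (upd H k h) (upd T k tp).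

Lemma foc_head pc' ph h tp i : h < S -> cfg_head (foc pc' ph h tp) i < S.
Proof. by rewrite /= /upd; case: ifP. Qed.

Lemma foc_step ph h tp pc' ph' s' mv :
  (if fetch pc is IHalt _ then false else true) -> ph <= 3 ->
  micro pc (fetch pc) ph (tp h) = ((pc', ph'), (s', mv)) ->
  h < S -> move_head mv h < S ->
  runs S 1 (foc pc ph h tp) (foc pc' ph' (move_head mv h) (upd tp h s')).
Proof.
move=> hf hph hm h1 h2; apply: runs_step => [|i|i]; try exact: foc_head.
rewrite /foc conf_step //; last by rewrite /cm_verdict inordP //; case: fetch hf.
by rewrite kE !upd_eq hm /= !upd_upd.
Qed.

Lemma foc_return ph h l :
  (if fetch pc is IInc _ then ph = 2 else if fetch pc is IDjz _ _ then ph = 2 else False) ->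
  h <= size l -> h < S ->
  runs S h.+1 (foc pc ph h (rtape l)) (foc pc.+1 0 0 (rtape l)).
Proof.
move=> hf; elim: h => [_ S0|h IH hl hS].
  rewrite (_ : rtape l = upd (rtape l) 0 None) //; last first.
    by apply/funext => -[].
  rewrite {1}(_ : upd (rtape l) 0 None = rtape l); last by apply/funext => -[].
  by apply: (@foc_step ph 0 _ _ _ None MoveStay) => //; case: fetch hf => //= [?|? ?] ->.
rewrite -[h.+2]add1n; apply: runs_trans (IH (ltnW hl) (ltnW hS)).
have e : upd (rtape l) h.+1 (rtape l h.+1) = rtape l by exact: upd_id.
rewrite -{2}e; apply: (@foc_step ph h.+1 _ _ _ _ MoveLeft) => //.
- by case: fetch hf.
- by case: fetch hf => //= [?|? ?] ->.
- by rewrite rtape_in // ; case: fetch hf => //= [?|? ?] ->.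
by apply: ltnW.
Qed.

Lemma foc_inc r l pre : fetch pc = IInc r -> (size (pre ++ l)).+1 < S ->
  exists t, t <= (size (pre ++ l)).*2 + 4 /\
  runs S t (foc pc 1 (size pre).+1 (rtape (pre ++ l)))
           (foc pc.+1 0 0 (rtape (pre ++ binc l))).
Proof.
move=> hf hS.
(* The bound is split so that the induction goes through: the carry can only travel over [l], while
   the way back is charged to the whole tape. *)
suff [t [ht hr]] : exists t, t <= size l + 1 + (size (pre ++ l)).+1 /\
  runs S t (foc pc 1 (size pre).+1 (rtape (pre ++ l)))
           (foc pc.+1 0 0 (rtape (pre ++ binc l))).
  by exists t; split=> //; rewrite size_cat in ht *; lia.
elim: l pre hS => [|[] l IH] pre hS; rewrite size_cat /= in hS.
- exists (1 + (size pre).+1); split; first by rewrite size_cat /=; lia.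
  apply: (@runs_trans _ _ _ _ (foc pc 2 (size pre) (rtape (pre ++ [:: true])))).
    rewrite cats0 cats1 -rtape_upd_end.
    apply: (@foc_step 1 _ _ _ _ _ MoveLeft) => //=; rewrite ?hf //=; try lia.
    by rewrite nth_default // size_map.
  by apply: foc_return; rewrite ?hf ?size_cat //=; lia.
- have [|t [ht hr]] := IH (rcons pre false); first by rewrite size_cat size_rcons; lia.
  exists (1 + t); split; first by rewrite !size_cat size_rcons /= in ht *; lia.
  apply: runs_trans; last by move: hr; rewrite !cat_rcons size_rcons; exact.
  rewrite -(rtape_upd pre true false l).
  apply: (@foc_step 1 _ _ _ _ _ MoveRight); rewrite ?hf ?rtape_at //=; lia.
exists (1 + (size pre).+1); split; first by rewrite size_cat /=; lia.
apply: (@runs_trans _ _ _ _ (foc pc 2 (size pre) (rtape (pre ++ true :: l)))).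
  rewrite -(rtape_upd pre false true l).
  apply: (@foc_step 1 _ _ _ _ _ MoveLeft) => //; rewrite ?hf ?rtape_at //=; lia.
by apply: foc_return; rewrite ?hf ?size_cat //=; lia.
Qed.

Lemma foc_dec r lab l pre : fetch pc = IDjz r lab -> 0 < bval l ->
  (size (pre ++ l)).+1 < S ->
  exists t, t <= (size (pre ++ l)).*2 + 4 /\
  runs S t (foc pc 1 (size pre).+1 (rtape (pre ++ l)))
           (foc pc.+1 0 0 (rtape (pre ++ bdec l))).
Proof.
move=> hf hv hS.
suff [t [ht hr]] : exists t, t <= size l + 1 + (size (pre ++ l)).+1 /\
  runs S t (foc pc 1 (size pre).+1 (rtape (pre ++ l)))
           (foc pc.+1 0 0 (rtape (pre ++ bdec l))).
  by exists t; split=> //; rewrite size_cat in ht *; lia.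
elim: l pre hS hv => [|[] l IH] pre hS // hv; rewrite size_cat /= in hS.
  exists (1 + (size pre).+1); split; first by rewrite size_cat /=; lia.
  apply: (@runs_trans _ _ _ _ (foc pc 2 (size pre) (rtape (pre ++ false :: l)))).
    rewrite -(rtape_upd pre true false l).
    apply: (@foc_step 1 _ _ _ _ _ MoveLeft) => //; rewrite ?hf ?rtape_at //=; lia.
  by apply: foc_return; rewrite ?hf ?size_cat //=; lia.
have [||t [ht hr]] := IH (rcons pre true).
- by rewrite size_cat size_rcons; lia.
- by move: hv => /=; lia.
exists (1 + t); split; first by rewrite !size_cat size_rcons /= in ht *; lia.
apply: runs_trans; last by move: hr; rewrite !cat_rcons size_rcons; exact.
rewrite -(rtape_upd pre false true l).
apply: (@foc_step 1 _ _ _ _ _ MoveRight); rewrite ?hf ?rtape_at //=; lia.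
Qed.

(** The borrow on a zero counter: [a] digits are already flipped to ones and [b] zeros remain, up to
    the blank that triggers phase 3. *)
Lemma foc_fill r lab a b : fetch pc = IDjz r lab -> (a + b).+1 < S ->
  runs S b.+1 (foc pc 1 a.+1 (rtape (nseq a true ++ nseq b false)))
       (foc pc 3 (a + b) (rtape (nseq (a + b) true))).
Proof.
move=> hf; elim: b a => [|b IH] a hS.
  rewrite addn0 cats0.
  have e : upd (rtape (nseq a true)) a.+1 None = rtape (nseq a true).
    apply/funext => j; rewrite /upd; case: eqP => [->|//].
    by rewrite /= nth_default // size_map size_nseq.
  rewrite -[in X in runs _ _ _ X]e.
  apply: (@foc_step 1 _ _ _ _ _ MoveLeft); rewrite ?hf //=; try lia.
  by rewrite nth_default // size_map size_nseq.
have:= IH a.+1; rewrite addSnnS => /(_ ltac:(lia)) hr; rewrite -[b.+2]add1n.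
apply: runs_trans hr.
have -> : nseq a.+1 true ++ nseq b false = nseq a true ++ true :: nseq b false.
  by rewrite -cat_rcons; congr cat; elim: (a) => //= n <-.
rewrite -(rtape_upd _ false true) size_nseq.
apply: (@foc_step 1 _ _ _ _ _ MoveRight); rewrite ?hf //=; try lia.
have:= rtape_at (nseq a true) false (nseq b false); rewrite size_nseq /= => ->.
by [].
Qed.

Lemma foc_clear r lab a b : fetch pc = IDjz r lab -> (a + b).+1 < S ->
  runs S a.+1 (foc pc 3 a (rtape (nseq a true ++ nseq b false)))
       (foc lab 0 0 (rtape (nseq (a + b) false))).
Proof.
move=> hf; elim: a b => [|a IH] b hS.
  have e : upd (rtape (nseq b false)) 0 None = rtape (nseq b false).
    by apply/funext => -[].
  rewrite -[in X in runs _ _ _ X]e.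
  by apply: (@foc_step 3 _ _ _ _ _ MoveStay); rewrite ?hf //=; lia.
have:= IH b.+1; rewrite addnS => /(_ hS) hr; rewrite -[a.+2]add1n.
apply: runs_trans hr.
have -> : nseq a.+1 true ++ nseq b false = nseq a true ++ true :: nseq b false.
  by rewrite -cat_rcons; congr cat; elim: (a) => //= n <-.
rewrite -[nseq b.+1 false]/(false :: nseq b false) -(rtape_upd _ true false) size_nseq.
apply: (@foc_step 3 _ _ _ _ _ MoveLeft); rewrite ?hf //=; try lia.
have:= rtape_at (nseq a true) true (nseq b false); rewrite size_nseq /= => ->.
by [].
Qed.

End OneTape.

(** * Counters, input and output as tapes; the effect of one instruction *)

Section Representation.
Variables (w : seq bool) (B S : nat).
Hypothesis BS : B.+1 < S.
Hypothesis wS : size w < S.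

(** The digit list is existential because decrementing never shortens it, so leading zeros
    accumulate. *)
Definition holds_counters (sg : nat -> nat) (H : 'I_nr.+2 -> nat)
    (T : 'I_nr.+2 -> nat -> option bool) :=
  forall r, r < nr -> H (inord r.+1) = 0 /\
    exists l, [/\ size l <= B, bval l = sg r & T (inord r.+1) = rtape l].

Definition rep (pc : nat) (sg : nat -> nat) (i : nat) (out : seq bool) (c : config M) :=
  exists H T, [/\ c = conf pc 0 H T,
    H ord0 = i /\ T ord0 = @written M w, i <= size w,
    holds_counters sg H T &
    H ord_max = size out /\ T ord_max = @written M out].

Lemma tape_cases (k : 'I_nr.+2) :
  [\/ k = ord0, k = ord_max | exists2 r, r < nr & k = inord r.+1].
Proof.
case: k => -[|k] hk; first by constructor 1; apply: val_inj.
case: (ltnP k nr) => h; last by constructor 2; apply: val_inj => /=; lia.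
by constructor 3; exists k => //; apply: val_inj; rewrite /= inordK.
Qed.

Lemma inord_neq0 r : r < nr -> (inord r.+1 : 'I_nr.+2) != ord0.
Proof. by move=> h; rewrite -val_eqE /= inordK //; lia. Qed.

Lemma inord_neq_max r : r < nr -> (inord r.+1 : 'I_nr.+2) != ord_max.
Proof. by move=> h; rewrite -val_eqE /= inordK; lia. Qed.

Lemma inord_eq r r' : r < nr -> r' < nr ->
  ((inord r.+1 : 'I_nr.+2) == inord r'.+1) = (r == r').
Proof. by move=> h h'; rewrite -val_eqE /= !inordK //; lia. Qed.

Lemma rep_heads pc sg i out c k : rep pc sg i out c -> size out < S ->
  cfg_head c k < S.
Proof.
move=> [H [T [-> [h0 _] hi hr [hm _]]]] ho /=.
have [->|->|[r rn ->]] := tape_cases k; first by rewrite h0; lia.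
  by rewrite hm.
by rewrite (hr r rn).1; lia.
Qed.

Lemma fetch_lt pc : (if fetch pc is IHalt _ then false else true) -> pc < size code.
Proof. by rewrite /fetch; case: ltnP => // h; rewrite nth_default. Qed.

Lemma conf_foc pc ph H T k : conf pc ph H T = foc k H T pc ph (H k) (T k).
Proof. by rewrite /foc !upd_id. Qed.

Lemma rep_foc_counter pc' sg i out H T r l :
  H ord0 = i /\ T ord0 = @written M w -> i <= size w ->
  holds_counters sg H T -> H ord_max = size out /\ T ord_max = @written M out ->
  r < nr -> size l <= B ->
  rep pc' (upd sg r (bval l)) i out (foc (inord r.+1) H T pc' 0 0 (rtape l)).
Proof.
move=> [h0 t0] hi hr [hm tm] rn sl; eexists _, _; split; first by [].
- by rewrite !upd_neq // eq_sym inord_neq0.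
- by [].
- move=> r' r'n; rewrite /upd inord_eq //; case: eqP => [_|_]; last exact: hr.
  by split=> //; exists l.
by rewrite !upd_neq // eq_sym inord_neq_max.
Qed.

Definition reaches (n pc : nat) sg i out (c : config M) :=
  exists t c', [/\ t <= n, runs S t c c' & rep pc sg i out c'].

(** The bound [B.*2 + 6] is common to all instructions: at worst the head crosses the [B] digits and
    comes back, with a constant overhead. *)
Lemma rep_inc pc sg i out c r :
  rep pc sg i out c -> size out < S -> fetch pc = IInc r -> r < nr ->
  (sg r).+1 < 2 ^ B ->
  reaches (B.*2 + 6) pc.+1 (upd sg r (sg r).+1) i out c.
Proof.
move=> rc ho hf rn hv; have HS k := rep_heads k rc ho.
have hpc : pc < size code by apply: fetch_lt; rewrite hf.
case: rc HS => H [T [-> h0 hi hr hm]] HS.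
have [Hr [l [sl vl Tl]]] := hr r rn.
have kE : tape_of (fetch pc) = inord r.+1 by rewrite hf.
have [|t [ht hrun]] := @foc_inc S _ H T pc HS (ltnW hpc) kE r l [::] hf.
  by rewrite /=; lia.
exists (1 + t), (foc (inord r.+1) H T pc.+1 0 0 (rtape (binc l))); split.
- by rewrite /= in ht; lia.
- apply: runs_trans hrun; rewrite (conf_foc _ _ _ _ (inord r.+1)) Hr Tl.
  rewrite -[in X in runs _ _ _ X](upd_id (rtape l) 0).
  by apply: (@foc_step S _ H T pc HS (ltnW hpc) kE 0 0 _ _ _ _ MoveRight);
    rewrite ?hf //=; lia.
rewrite -vl -bval_binc; apply: rep_foc_counter => //.
by apply: size_binc; rewrite ?vl.
Qed.

Lemma rep_djz pc sg i out c r lab :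
  rep pc sg i out c -> size out < S -> fetch pc = IDjz r lab -> r < nr ->
  reaches (B.*2 + 6) (if sg r == 0 then lab else pc.+1) (upd sg r (sg r).-1) i out c.
Proof.
move=> rc ho hf rn; have HS k := rep_heads k rc ho.
have hpc : pc < size code by apply: fetch_lt; rewrite hf.
case: rc HS => H [T [-> h0 hi hr hm]] HS.
have [Hr [l [sl vl Tl]]] := hr r rn.
have kE : tape_of (fetch pc) = inord r.+1 by rewrite hf.
have start : runs S 1 (conf pc 0 H T) (foc (inord r.+1) H T pc 1 1 (rtape l)).
  rewrite (conf_foc _ _ _ _ (inord r.+1)) Hr Tl.
  rewrite -[in X in runs _ _ _ X](upd_id (rtape l) 0).
  by apply: (@foc_step S _ H T pc HS (ltnW hpc) kE 0 0 _ _ _ _ MoveRight);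
    rewrite ?hf //=; lia.
case: eqP => [z|/eqP nz].
  have lE : l = nseq (size l) false by apply: bval_eq0; rewrite vl.
  have lS : (0 + size l).+1 < S by lia.
  have r1 := @foc_fill S _ H T pc HS (ltnW hpc) kE r lab 0 (size l) hf lS.
  have r2 := @foc_clear S _ H T pc HS (ltnW hpc) kE r lab (size l) 0 hf.
  rewrite addn0 cats0 in r2.
  exists (1 + ((size l).+1 + (size l).+1)),
    (foc (inord r.+1) H T lab 0 0 (rtape l)); split; first lia.
    apply: runs_trans start _; rewrite lE size_nseq.
    by apply: runs_trans r1 _; apply: r2; lia.
  have -> : (sg r).-1 = bval l by rewrite vl z.
  exact: rep_foc_counter.
have [||t [ht hrun]] := @foc_dec S _ H T pc HS (ltnW hpc) kE r lab l [::] hf.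
- by rewrite vl lt0n.
- by rewrite /=; lia.
exists (1 + t), (foc (inord r.+1) H T pc.+1 0 0 (rtape (bdec l))); split.
- by rewrite /= in ht; lia.
- exact: runs_trans start hrun.
rewrite -vl -bval_bdec ?vl ?lt0n //; apply: rep_foc_counter => //.
by rewrite size_bdec.
Qed.

Lemma rep_jmp pc sg i out c lab :
  rep pc sg i out c -> size out < S -> fetch pc = IJmp lab ->
  reaches (B.*2 + 6) lab sg i out c.
Proof.
move=> rc ho hf; have HS k := rep_heads k rc ho.
have hpc : pc < size code by apply: fetch_lt; rewrite hf.
case: rc HS => H [T [-> h0 hi hr hm]] HS; exists 1, (conf lab 0 H T).
split; [lia | | by eexists _, _; split].
have kE : tape_of (fetch pc) = ord0 by rewrite hf.
rewrite [conf pc _ _ _](conf_foc _ _ _ _ ord0) (conf_foc lab _ _ _ ord0).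
rewrite -[in X in runs _ _ _ X](upd_id (T ord0) (H ord0)).
by apply: (@foc_step S _ H T pc HS (ltnW hpc) kE 0 _ _ _ _ _ MoveStay); rewrite ?hf //; exact: HS.
Qed.

Lemma written_rcons (out : seq bool) b :
  upd (@written M out) (size out) (Some b) = @written M (rcons out b).
Proof.
apply/funext => j; rewrite /upd /written map_rcons nth_rcons size_map.
by case: ltngtP => // ?; rewrite nth_default // size_map ltnW.
Qed.

Lemma rep_out pc sg i out c b :
  rep pc sg i out c -> (size out).+1 < S -> fetch pc = IOut b ->
  reaches (B.*2 + 6) pc.+1 sg i (rcons out b) c.
Proof.
move=> rc ho hf; have HS k := rep_heads k rc (ltnW ho).
have hpc : pc < size code by apply: fetch_lt; rewrite hf.
case: rc HS => H [T [-> h0 hi hr [hm tm]]] HS.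
have kE : tape_of (fetch pc) = ord_max by rewrite hf.
exists 1, (foc ord_max H T pc.+1 0 (size out).+1 (@written M (rcons out b))).
split; first lia.
  rewrite [conf pc _ _ _](conf_foc _ _ _ _ ord_max) -written_rcons hm tm.
  by apply: (@foc_step S _ H T pc HS (ltnW hpc) kE 0 _ _ _ _ _ MoveRight); rewrite ?hf //=; lia.
eexists _, _; split; first by [].
- by rewrite !upd_neq.
- by [].
- by move=> r rn; rewrite !upd_neq ?inord_neq_max //; apply: hr.
by rewrite !upd_eq size_rcons.
Qed.

Lemma rep_left pc sg i out c :
  rep pc sg i out c -> size out < S -> fetch pc = ILeft ->
  reaches (B.*2 + 6) pc.+1 sg i.-1 out c.
Proof.
move=> rc ho hf; have HS k := rep_heads k rc ho.
have hpc : pc < size code by apply: fetch_lt; rewrite hf.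
case: rc HS => H [T [-> [h0 t0] hi hr hm]] HS.
have kE : tape_of (fetch pc) = ord0 by rewrite hf.
exists 1, (foc ord0 H T pc.+1 0 i.-1 (T ord0)); split; first lia.
  rewrite [conf pc _ _ _](conf_foc _ _ _ _ ord0) -{2}(upd_id (T ord0) i) h0.
  by apply: (@foc_step S _ H T pc HS (ltnW hpc) kE 0 _ _ _ _ _ MoveLeft); rewrite ?hf //=; lia.
eexists _, _; split; first by [].
- by rewrite !upd_eq.
- lia.
- by move=> r rn; rewrite !upd_neq ?inord_neq0 //; apply: hr.
by rewrite !upd_neq.
Qed.

Lemma rep_read pc sg i out c l0 l1 :
  rep pc sg i out c -> size out < S -> fetch pc = IRead l0 l1 ->
  if i < size w then
    reaches (B.*2 + 6) (if nth false w i then l1 else l0) sg i.+1 out c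
  else reaches (B.*2 + 6) pc.+1 sg i out c.
Proof.
move=> rc ho hf; have HS k := rep_heads k rc ho.
have hpc : pc < size code by apply: fetch_lt; rewrite hf.
case: rc HS => H [T [-> [h0 t0] hi hr hm]] HS.
have kE : tape_of (fetch pc) = ord0 by rewrite hf.
case: ifP => iw.
  exists 1, (foc ord0 H T (if nth false w i then l1 else l0) 0 i.+1 (T ord0)).
  have tE : T ord0 i = Some (nth false w i) by rewrite t0 /written (nth_map false).
  split; first lia.
    rewrite [conf pc _ _ _](conf_foc _ _ _ _ ord0) -{2}(upd_id (T ord0) i) h0.
    by apply: (@foc_step S _ H T pc HS (ltnW hpc) kE 0 _ _ _ _ _ MoveRight);
      rewrite ?hf ?tE //=; lia.
  eexists _, _; split; first by [].
  - by rewrite !upd_eq.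
  - lia.
  - by move=> r rn; rewrite !upd_neq ?inord_neq0 //; apply: hr.
  by rewrite !upd_neq.
exists 1, (conf pc.+1 0 H T); split; [lia | | by eexists _, _; split].
have tE : T ord0 i = None.
  by rewrite t0 /written nth_default // size_map leqNgt iw.
rewrite [conf pc _ _ _](conf_foc _ _ _ _ ord0) (conf_foc pc.+1 _ _ _ ord0).
rewrite -[in X in runs _ _ _ X](upd_id (T ord0) (H ord0)) h0 tE.
by apply: (@foc_step S _ H T pc HS (ltnW hpc) kE 0 _ _ _ _ _ MoveStay);
  rewrite ?hf ?tE //=; lia.
Qed.

Lemma rep_init : rep 0 (fun _ => 0) 0 [::] (tm_init M w).
Proof.
exists (fun _ => 0), (fun i => if i == ord0 then @written M w else @written M [::]).
split=> //.
- by rewrite /tm_init /conf; congr Config; congr pair; apply: val_inj; rewrite /= inordK.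
move=> r rn; split=> //; exists [::]; split=> //.
by rewrite (negbTE (inord_neq0 rn)); apply/funext => -[|j] //=; rewrite /written /= !nth_nil.
Qed.

End Representation.
End Simulation.

(** * Structured counter programs *)

(* [CLoop r c] is "while r <> 0 do (r := r - 1; c)"; [CReadAll c0 c1] runs
   [c0] or [c1] for each bit that remains to be read on the input tape. *)
Inductive cmd :=
| CSkip
| CInc of nat
| CLoop of nat & cmd
| CSeq of cmd & cmd
| COut of bool
| CLeft
| CReadAll of cmd & cmd.

Section Execution.
Variables (V : nat) (w : seq bool).

(* Every counter value produced is below [V]; the last two arguments are the
   bits output and the number of instructions executed. *)
Inductive exec : cmd -> (nat -> nat) -> nat -> (nat -> nat) -> nat ->
    seq bool -> nat -> Prop :=
| ESkip sg i : exec CSkip sg i sg i [::] 0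
| EInc sg i r : (sg r).+1 < V ->
    exec (CInc r) sg i (upd sg r (sg r).+1) i [::] 1
| ELoop0 sg i r c : sg r = 0 -> exec (CLoop r c) sg i sg i [::] 1
| ELoopS sg i r c n sg1 i1 o1 t1 sg2 i2 o2 t2 : sg r = n.+1 ->
    exec c (upd sg r n) i sg1 i1 o1 t1 ->
    exec (CLoop r c) sg1 i1 sg2 i2 o2 t2 ->
    exec (CLoop r c) sg i sg2 i2 (o1 ++ o2) (t1 + t2 + 2)
| ESeq c1 c2 sg i sg1 i1 o1 t1 sg2 i2 o2 t2 :
    exec c1 sg i sg1 i1 o1 t1 -> exec c2 sg1 i1 sg2 i2 o2 t2 ->
    exec (CSeq c1 c2) sg i sg2 i2 (o1 ++ o2) (t1 + t2)
| EOut b sg i : exec (COut b) sg i sg i [:: b] 1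
| ELeft sg i : exec CLeft sg i sg i.-1 [::] 1
| EReadEnd c0 c1 sg i : size w <= i -> exec (CReadAll c0 c1) sg i sg i [::] 2
| ERead c0 c1 sg i sg1 i1 o1 t1 sg2 i2 o2 t2 : i < size w ->
    exec (if nth false w i then c1 else c0) sg i.+1 sg1 i1 o1 t1 ->
    exec (CReadAll c0 c1) sg1 i1 sg2 i2 o2 t2 ->
    exec (CReadAll c0 c1) sg i sg2 i2 (o1 ++ o2) (t1 + t2 + 2).

End Execution.

Fixpoint clen (c : cmd) : nat :=
  match c with
  | CSkip => 0
  | CInc _ | COut _ | CLeft => 1
  | CLoop _ c => (clen c).+2
  | CSeq c1 c2 => clen c1 + clen c2
  | CReadAll c0 c1 => clen c0 + clen c1 + 4
  end.

(** Jumps are absolute, so the code depends on its address [a]. In a reading loop, [IRead] branches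
    on the bit read and falls through, at the end of the input, to the jump out of the loop. *)
Fixpoint comp (a : nat) (c : cmd) : seq instr :=
  match c with
  | CSkip => [::]
  | CInc r => [:: IInc r]
  | COut b => [:: IOut b]
  | CLeft => [:: ILeft]
  | CLoop r c => IDjz r (a + (clen c).+2) :: rcons (comp a.+1 c) (IJmp a)
  | CSeq c1 c2 => comp a c1 ++ comp (a + clen c1) c2
  | CReadAll c0 c1 =>
      [:: IRead a.+2 (a.+2 + (clen c0).+1), IJmp (a + (clen c0 + clen c1 + 4)) &
          rcons (comp a.+2 c0) (IJmp a) ++
          rcons (comp (a.+2 + (clen c0).+1) c1) (IJmp a)]
  end.

Lemma size_comp a c : size (comp a c) = clen c.
Proof.
elim: c a => //= [r c IH|c1 IH1 c2 IH2|c0 IH0 c1 IH1] a.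
- by rewrite size_rcons IH.
- by rewrite size_cat IH1 IH2.
by rewrite size_cat !size_rcons IH0 IH1; lia.
Qed.

Fixpoint cregs (c : cmd) : nat :=
  match c with
  | CInc r => r.+1
  | CLoop r c => maxn r.+1 (cregs c)
  | CSeq c1 c2 | CReadAll c1 c2 => maxn (cregs c1) (cregs c2)
  | _ => 0
  end.

Section Compilation.
Variables (code : seq instr) (nr : nat) (w : seq bool) (B S : nat).
Hypothesis BS : B.+1 < S.
Hypothesis wS : size w < S.

Definition embed (a : nat) (l : seq instr) :=
  forall k, k < size l -> fetch code (a + k) = nth (IHalt false) l k.

Lemma embed_cons a x l : embed a (x :: l) -> fetch code a = x /\ embed a.+1 l.
Proof.
move=> h; split; first by rewrite -[a]addn0 h.
by move=> k hk; rewrite addSnnS h.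
Qed.

Lemma embed_cat a l1 l2 : embed a (l1 ++ l2) -> embed a l1 /\ embed (a + size l1) l2.
Proof.
move=> h; split=> k hk.
  by rewrite h ?size_cat ?nth_cat ?hk //; lia.
by rewrite -addnA h ?size_cat ?ltn_add2l // nth_cat ltnNge leq_addr /= addKn.
Qed.

Lemma embed_rcons a l x : embed a (rcons l x) -> embed a l /\ fetch code (a + size l) = x.
Proof. by rewrite -cats1 => /embed_cat[h /embed_cons[]]. Qed.

Notation reaches := (@reaches code nr w B S).
Notation rep := (@rep code nr w B).

Lemma reaches_trans n1 n2 pc1 sg1 i1 o1 pc2 sg2 i2 o2 c :
  reaches n1 pc1 sg1 i1 o1 c ->
  (forall c', rep pc1 sg1 i1 o1 c' -> reaches n2 pc2 sg2 i2 o2 c') ->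
  reaches (n1 + n2) pc2 sg2 i2 o2 c.
Proof.
move=> [t1 [c1 [h1 r1 p1]]] /(_ _ p1) [t2 [c2 [h2 r2 p2]]].
by exists (t1 + t2), c2; split; [exact: leq_add | exact: runs_trans r1 r2 | ].
Qed.

Lemma comp_sound c sg i sg' i' o t :
  exec (2 ^ B) w c sg i sg' i' o t -> cregs c <= nr ->
  forall a out cf, embed a (comp a c) -> size (out ++ o) < S ->
  rep a sg i out cf ->
  reaches (t * (B.*2 + 6)) (a + clen c) sg' i' (out ++ o) cf.
Proof.
elim=> {c sg i sg' i' o t} /=.
- move=> sg i _ a out cf _ ho rc; rewrite addn0 cats0 in ho *.
  by exists 0, cf; split=> //; apply: runs0 => k; apply: rep_heads rc ho.
- move=> sg i r hv hr a out cf /embed_cons[hf _]; rewrite cats0 => ho rc.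
  by rewrite mul1n addn1; apply: rep_inc.
- move=> sg i r c hz hr a out cf /embed_cons[hf _]; rewrite cats0 => ho rc.
  have rn : r < nr by lia.
  by have:= rep_djz BS wS rc ho hf rn; rewrite hz eqxx mul1n (_ : upd sg r 0 = sg) //= -hz upd_id.
- move=> sg i r c n sg1 i1 o1 t1 sg2 i2 o2 t2 hz _ IH1 _ IH2 hr a out cf em ho rc.
  have rn : r < nr by lia.
  have rn' : cregs c <= nr by lia.
  have [hf /embed_rcons[emc hj]] := embed_cons em.
  rewrite size_comp in hj; rewrite !size_cat in ho.
  have:= rep_djz BS wS rc _ hf rn; rewrite hz /= => /(_ ltac:(lia)) st.
  rewrite (_ : (t1 + t2 + 2) * (B.*2 + 6) =
    B.*2 + 6 + (t1 * (B.*2 + 6) + (B.*2 + 6 + t2 * (B.*2 + 6)))); last lia.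
  apply: reaches_trans st _ => c1 rc1.
  apply: reaches_trans (IH1 rn' _ _ _ emc _ rc1) _; first by rewrite size_cat; lia.
  move=> c2 rc2; apply: reaches_trans (rep_jmp BS wS rc2 _ hj) _.
    by rewrite size_cat; lia.
  by move=> c3 rc3; rewrite catA; apply: IH2 => //; rewrite !size_cat; lia.
- move=> c1 c2 sg i sg1 i1 o1 t1 sg2 i2 o2 t2 _ IH1 _ IH2 hr a out cf em ho rc.
  have [em1 em2] := embed_cat em; rewrite size_comp in em2.
  rewrite !size_cat in ho; rewrite mulnDl.
  apply: reaches_trans (IH1 _ _ _ _ em1 _ rc) _; rewrite ?size_cat; try lia.
  move=> c' rc'; rewrite catA addnA; apply: IH2 => //; rewrite ?size_cat; lia.
- move=> b sg i _ a out cf /embed_cons[hf _] ho rc; rewrite mul1n addn1 cats1.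
  by apply: rep_out => //; rewrite size_cat /= addn1 in ho.
- move=> sg i _ a out cf /embed_cons[hf _]; rewrite cats0 => ho rc.
  by rewrite mul1n addn1; apply: rep_left.
- move=> c0 c1 sg i hi hr a out cf em; rewrite cats0 => ho rc.
  have [hf /embed_cons[hj _]] := embed_cons em.
  have:= rep_read BS wS rc ho hf; rewrite ltnNge hi /= => st.
  rewrite (_ : 2 * (B.*2 + 6) = B.*2 + 6 + (B.*2 + 6)); last lia.
  by apply: reaches_trans st _ => c' rc'; exact: rep_jmp rc' ho hj.
move=> c0 c1 sg i sg1 i1 o1 t1 sg2 i2 o2 t2 hi _ IH1 _ IH2 hr a out cf em ho rc.
have [hf /embed_cons[_ /embed_cat[/embed_rcons[em0 j0]]]] := embed_cons em.
rewrite size_rcons !size_comp in j0 * => /embed_rcons[em1]; rewrite size_comp => j1.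
rewrite !size_cat in ho.
have:= rep_read BS wS rc _ hf; rewrite hi => /(_ ltac:(lia)) st.
rewrite (_ : (t1 + t2 + 2) * (B.*2 + 6) =
    B.*2 + 6 + (t1 * (B.*2 + 6) + (B.*2 + 6 + t2 * (B.*2 + 6)))); last lia.
apply: reaches_trans st _ => c' rc'.
case: nth IH1 rc' => IH1 rc'.
  apply: reaches_trans (IH1 _ _ _ _ em1 _ rc') _; rewrite ?size_cat; try lia.
  move=> c'' rc''; apply: reaches_trans (rep_jmp BS wS rc'' _ j1) _.
    by rewrite size_cat; lia.
  by move=> c3 rc3; rewrite catA; apply: IH2 => //; rewrite !size_cat; lia.
apply: reaches_trans (IH1 _ _ _ _ em0 _ rc') _; rewrite ?size_cat; try lia.
move=> c'' rc''; apply: reaches_trans (rep_jmp BS wS rc'' _ j0) _.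
  by rewrite size_cat; lia.
by move=> c3 rc3; rewrite catA; apply: IH2 => //; rewrite !size_cat; lia.
Qed.

End Compilation.

Lemma embed_prefix l post : embed (l ++ post) 0 l.
Proof. by move=> k hk; rewrite /fetch nth_cat hk. Qed.

Lemma halted_iter (M : turing_machine) (c : config M) t :
  tm_verdict (cfg_state c) <> None -> iter t (@tm_step M) c = c.
Proof.
move=> h; elim: t => //= t ->; rewrite /tm_step.
by case: tm_verdict h.
Qed.

Lemma rep_state code nr w B pc sg i out c : @rep code nr w B pc sg i out c ->
  pc <= size code -> tm_verdict (cfg_state c) = if fetch code pc is IHalt b then Some b else None.
Proof.
by move=> [H [T [-> _ _ _ _]]] h; rewrite /= /cm_verdict /= inordP.
Qed.

Definition decider_code c r : seq instr :=
  comp 0 c ++ [:: IDjz r (clen c + 2); IHalt true; IHalt false].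

Definition decider c r := cm_machine (decider_code c r) (maxn (cregs c) r.+1).

(** The time [t] leaves no trace in the bound: counters below [2 ^ B] occupy [B] cells whatever the
    number of steps, and after halting the heads no longer move. *)
Lemma decider_correct c r w B sg' i' t :
  exec (2 ^ B) w c (fun _ => 0) 0 sg' i' [::] t ->
  runs_in_space (decider c r) w (B + size w + 3) /\
  exists t', halts_with (decider c r) w t' (sg' r != 0).
Proof.
move=> ex; set S := B + size w + 3.
have BS : B.+1 < S by rewrite /S; lia.
have wS : size w < S by rewrite /S; lia.
have S0 : @size bool ([::] ++ [::]) < S by rewrite /S /=; lia.
set nr := maxn (cregs c) r.+1; set code := decider_code c r.
have sc : size code = (clen c).+3 by rewrite size_cat size_comp /= addn3.
have em := @embed_prefix (comp 0 c) [:: IDjz r (clen c + 2); IHalt true; IHalt false].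
have [t1 [c1 [_ r1 p1]]] := comp_sound BS wS ex (leq_maxl _ _ : _ <= nr) em S0
  (rep_init code nr BS wS).
rewrite cats0 add0n in p1.
have hf k : k < 3 -> fetch code (clen c + k) =
    nth (IHalt false) [:: IDjz r (clen c + 2); IHalt true; IHalt false] k.
  by move=> _; rewrite /fetch nth_cat size_comp ltnNge leq_addr /= addKn.
have f0 := hf 0 isT; rewrite addn0 in f0.
have [t2 [c2 [_ r2 p2]]] := rep_djz BS wS p1 S0 f0 (leq_maxr _ _ : r < nr).
have run : runs S (t1 + t2) (tm_init (decider c r) w) c2 by exact: runs_trans r1 r2.
have verd : tm_verdict (cfg_state c2) = Some (sg' r != 0).
  rewrite (rep_state p2); last by rewrite sc; case: eqP => _; lia.
  by case: eqP => _; [rewrite (hf 2 isT) | rewrite -[(clen c).+1]addn1 (hf 1 isT)].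
split; last first.
  by exists (t1 + t2); rewrite /halts_with /tm_run run.1.
move=> t' k; rewrite /tm_run.
case: (leqP t' (t1 + t2)) => [h|lt]; first exact: run.2.
rewrite -(subnK (ltnW lt)) iterD run.1 halted_iter ?verd //.
exact: runs_head run.
Qed.

Definition transducer_code c : seq instr := rcons (comp 0 c) (IHalt true).

Definition transducer c := cm_machine (transducer_code c) (cregs c).

Lemma transducer_correct c w B sg' i' o t :
  exec (2 ^ B) w c (fun _ => 0) 0 sg' i' o t ->
  outputs_in_time (transducer c) w o (t * (B.*2 + 6)).
Proof.
move=> ex; set S := B + size w + size o + 3.
have BS : B.+1 < S by rewrite /S; lia.
have wS : size w < S by rewrite /S; lia.
have oS : size ([::] ++ o) < S by rewrite /S /=; lia.
set code := transducer_code c.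
have em := @embed_prefix (comp 0 c) [:: IHalt true].
rewrite cats1 -/code in em.
have [t1 [c1 [ht r1 p1]]] := comp_sound BS wS ex (leqnn _) em oS
  (rep_init code (cregs c) BS wS).
exists t1, true; split=> //; rewrite /halts_with /tm_run r1.1.
  rewrite (rep_state p1) ?size_rcons ?size_comp //.
  by rewrite /fetch nth_rcons size_comp ltnn eqxx.
by case: p1 => H [T [-> _ _ _ [_ /= ->]]].
Qed.

(** * Functions computed by counter programs *)

Section ExecLemmas.
Variables (V : nat) (w : seq bool).

Definition execs c sg i sg' i' o T := exists2 t, t <= T & exec V w c sg i sg' i' o t.

Lemma execs_le c sg i sg' i' o T T' :
  T <= T' -> execs c sg i sg' i' o T -> execs c sg i sg' i' o T'.
Proof. by move=> h [t ht ex]; exists t => //; apply: leq_trans ht h. Qed.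

Lemma execs_seq c1 c2 sg i sg1 i1 o1 T1 sg2 i2 o2 T2 :
  execs c1 sg i sg1 i1 o1 T1 -> execs c2 sg1 i1 sg2 i2 o2 T2 ->
  execs (CSeq c1 c2) sg i sg2 i2 (o1 ++ o2) (T1 + T2).
Proof.
move=> [t1 h1 e1] [t2 h2 e2]; exists (t1 + t2); first exact: leq_add.
exact: ESeq e1 e2.
Qed.

Lemma execs_seq0 c1 c2 sg i sg1 i1 T1 sg2 i2 o2 T2 :
  execs c1 sg i sg1 i1 [::] T1 -> execs c2 sg1 i1 sg2 i2 o2 T2 ->
  execs (CSeq c1 c2) sg i sg2 i2 o2 (T1 + T2).
Proof. exact: execs_seq. Qed.

Lemma execs_inc sg i r : (sg r).+1 < V ->
  execs (CInc r) sg i (upd sg r (sg r).+1) i [::] 1.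
Proof. by exists 1 => //; apply: EInc. Qed.

(** [st k] is the state at the test before round [k]; the body starts from it with the counter
    already decremented. *)
Lemma execs_loop a c N (st : nat -> nat -> nat) (tt : nat -> nat) oo i :
  (forall k, k <= N -> st k a = N - k) ->
  (forall k, k < N ->
     execs c (upd (st k) a (N - k.+1)) i (st k.+1) i (oo k) (tt k)) ->
  execs (CLoop a c) (st 0) i (st N) i (flatten (mkseq oo N))
    (\sum_(k < N) (tt k + 2) + 1).
Proof.
elim: N st tt oo => [|N IH] st tt oo sa hb.
  by exists 1; [rewrite big_ord0 | rewrite /mkseq /=; apply: ELoop0; rewrite sa].
have [||t1 h1 e1] := IH (fun k => st k.+1) (fun k => tt k.+1) (fun k => oo k.+1).
- by move=> k hk; rewrite sa.
- by move=> k hk; have:= hb k.+1 hk.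
have [//|t0 h0 e0] := hb 0.
exists (t0 + t1 + 2).
  rewrite big_ord_recl (_ : \sum_(k < N) (tt (lift ord0 k) + 2) = \sum_(k < N) (tt k.+1 + 2)) //=.
  by move: h1 h0; set X := (\sum_(k < N) _); set y := tt 0; lia.
rewrite /mkseq -[N.+1]add1n iotaD /= (iotaDl 1 0) -map_comp.
by apply: (ELoopS _ e0 e1); rewrite sa //; lia.
Qed.

End ExecLemmas.

Ltac updsolve :=
  apply/funext => ?; rewrite /upd; repeat (case: eqP => ?); try lia; try congruence.

Ltac updv := rewrite /upd; repeat (case: eqP => ?); try lia; try by [].

Lemma upd0 (sg : nat -> nat) d : sg d = 0 -> upd sg d 0 = sg.
Proof. by move=> <-; rewrite upd_id. Qed.

Lemma flatten_nil (N : nat) : flatten (mkseq (fun _ => [::] : seq bool) N) = [::].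
Proof. by rewrite /mkseq; elim: N 0 => //= N IH k. Qed.

Section Moves.
Variables (V : nat) (w : seq bool).

Lemma execs_move a b sg i : a != b -> sg b + sg a < V ->
  execs V w (CLoop a (CInc b)) sg i (upd (upd sg a 0) b (sg b + sg a)) i [::]
    (3 * sg a + 1).
Proof.
move=> ab h; set n := sg a in h *.
have := @execs_loop V w a (CInc b) n (fun k => upd (upd sg a (n - k)) b (sg b + k))
  (fun _ => 1) (fun _ => [::]) i.
rewrite flatten_nil subn0 subnn addn0 [X in execs _ _ _ X](_ : _ = sg); last first.
  by rewrite upd_id /n; updsolve.
move=> H; apply: execs_le (H _ _).
- by rewrite sum_nat_const card_ord; lia.
- by move=> k hk; rewrite upd_neq // upd_eq.
move=> k hk.
set s := (X in execs _ _ _ X); have sb : s b = sg b + k.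
  by rewrite /s; updv.
rewrite (_ : upd _ _ _ = upd s b (s b).+1); first by apply: execs_inc; rewrite sb; lia.
rewrite sb /s; updsolve.
Qed.

Lemma execs_clear a sg i :
  execs V w (CLoop a CSkip) sg i (upd sg a 0) i [::] (2 * sg a + 1).
Proof.
set n := sg a.
have := @execs_loop V w a CSkip n (fun k => upd sg a (n - k))
  (fun _ => 0) (fun _ => [::]) i.
rewrite flatten_nil subn0 subnn upd_id => H; apply: execs_le (H _ _).
- by rewrite sum_nat_const card_ord; lia.
- by move=> k hk; rewrite upd_eq.
by move=> k hk; exists 0 => //; rewrite upd_upd; apply: ESkip.
Qed.

(** Reading a register destroys it, so a second copy in [d.+1] is made to restore the source. *)
Definition ccopy r d := CSeq (CLoop r (CSeq (CInc d) (CInc d.+1))) (CLoop d.+1 (CInc r)).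

Lemma execs_copy r d sg i : r < d -> sg d = 0 -> sg d.+1 = 0 -> sg r < V ->
  execs V w (ccopy r d) sg i (upd sg d (sg r)) i [::] (7 * sg r + 2).
Proof.
move=> rd d0 d1 h; set n := sg r in h *.
have := @execs_loop V w r (CSeq (CInc d) (CInc d.+1)) n
  (fun k => upd (upd (upd sg r (n - k)) d k) d.+1 k) (fun _ => 2) (fun _ => [::]) i.
rewrite flatten_nil subn0 subnn [X in execs _ _ _ X](_ : _ = sg); last first.
  by rewrite upd_id -{1}d0 upd_id -d1 upd_id.
move=> H; rewrite (_ : 7 * n + 2 = (4 * n + 1) + (3 * n + 1)); last lia.
apply: execs_seq0; first apply: execs_le (H _ _).
- by rewrite sum_nat_const card_ord; lia.
- by move=> k hk; updv.
- move=> k hk; set s := (X in execs _ _ _ X).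
  have sd : s d = k by rewrite /s; updv.
  have sd1 : s d.+1 = k by rewrite /s ; updv.
  apply: (@execs_seq0 _ _ _ _ _ _ _ _ 1 _ _ _ 1).
    by apply: execs_inc; rewrite sd; lia.
  set s' := upd s _ _; have sd1' : s' d.+1 = k by rewrite /s' upd_neq ?sd1 //; lia.
  rewrite [X in execs _ _ _ _ _ X](_ : _ = upd s' d.+1 (s' d.+1).+1).
    by apply: execs_inc; rewrite sd1'; lia.
  by rewrite sd1' /s' sd /s; updsolve.
set s := upd (upd _ _ _) _ _.
have sr : s r = 0 by rewrite /s ; updv.
have sd1 : s d.+1 = n by rewrite /s upd_eq.
have:= @execs_move d.+1 r s i; rewrite sr sd1 => /(_ ltac:(lia) h).
by congr execs; rewrite /s /n ?add0n; updsolve.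
Qed.

End Moves.

Definition env := nat -> nat.
Definition scons (a : nat) (e : env) : env := fun n => if n is n'.+1 then e n' else a.

(* [mx] bounds the counters, [ct] the number of steps. The variables are in
   the registers [rho], the result goes to register [d], and the registers
   from [d] on serve as work space. *)
Definition computes (f mx ct : env -> nat) :=
  exists c : (nat -> nat) -> nat -> cmd, forall rho d sg i V w,
    (forall j, rho j < d) -> (forall j, d <= j -> sg j = 0) ->
    let e := fun j => sg (rho j) in mx e < V ->
    execs V w (c rho d) sg i (upd sg d (f e)) i [::] (ct e).

Lemma computes_var j : computes (fun e => e j) (fun e => e j) (fun e => 7 * e j + 2).
Proof.
exists (fun rho d => ccopy (rho j) d) => rho d sg i V w hr hz e he.
by apply: execs_copy => //; apply: hz.
Qed.

Lemma computes_zero : computes (fun _ => 0) (fun _ => 0) (fun _ => 0).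
Proof.
exists (fun _ _ => CSkip) => rho d sg i V w hr hz e he; exists 0 => //.
by rewrite upd0 ?hz //; apply: ESkip.
Qed.

Lemma computes_succ f mx ct : computes f mx ct ->
  computes (fun e => (f e).+1) (fun e => maxn (mx e) (f e).+1) (fun e => ct e + 1).
Proof.
move=> [c hc]; exists (fun rho d => CSeq (c rho d) (CInc d)).
move=> rho d sg i V w hr hz e he; apply: execs_seq0.
  by apply: hc => //; apply: leq_ltn_trans he; apply: leq_maxl.
set s := upd sg d (f e); have sd : s d = f e by rewrite /s upd_eq.
have -> : upd sg d (f e).+1 = upd s d (s d).+1 by rewrite sd /s upd_upd.
by apply: execs_inc; rewrite sd; apply: leq_ltn_trans he; apply: leq_maxr.
Qed.

Lemma computes_ren xi f mx ct : computes f mx ct ->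
  computes (fun e => f (fun j => e (xi j))) (fun e => mx (fun j => e (xi j)))
    (fun e => ct (fun j => e (xi j))).
Proof.
move=> [c hc]; exists (fun rho d => c (fun j => rho (xi j)) d).
move=> rho d sg i V w hr hz e he.
by apply: hc.
Qed.

Definition prec (g h : env -> nat) (e : env) (k : nat) : nat :=
  nat_rect (fun _ => nat) (g e) (fun i r => h (scons i (scons r e))) k.

Section Recursion.
Variables (n g h mxn mxg mxh ctn ctg cth : env -> nat).
Hypothesis cn : computes n mxn ctn.
Hypothesis cg : computes g mxg ctg.
Hypothesis ch : computes h mxh cth.
Let henv e k := scons k (scons (prec g h e k) e).

(** Register [d] holds the current value, [d.+1] the rounds left, [d.+2] the index and [d.+3] the
    value returned by the body, which sees [d.+2] and [d] as its variables 0 and 1. The bound on the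
    counters is a sum rather than a maximum: it dominates each term and is covered by the same
    closure property as the time. *)
Lemma computes_rec : computes (fun e => prec g h e (n e))
  (fun e => mxn e + mxg e + n e +
            (\sum_(k < n e) (mxh (henv e k) + prec g h e k.+1)))
  (fun e => ctn e + ctg e + 2 * n e + 5 +
     \sum_(k < n e) (cth (henv e k) + 2 * prec g h e k + 3 * prec g h e k.+1 + 5)).
Proof.
have [cdn hn] := cn; have [cdg hg] := cg; have [cdh hh] := ch.
exists (fun rho d => CSeq (cdg rho d) (CSeq (cdn rho d.+1) (CSeq
  (CLoop d.+1 (CSeq (cdh (scons d.+2 (scons d rho)) d.+3) (CSeq (CLoop d CSkip)
     (CSeq (CLoop d.+3 (CInc d)) (CInc d.+2)))))
  (CLoop d.+2 CSkip)))).
move=> rho d sg i V w hr hz e he.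
set N := n e in he *; set R := prec g h e.
set U := (\sum_(k < N) _) in he.
have hU k : k < N -> mxh (henv e k) + R k.+1 <= U.
  by move=> hk; rewrite /U (bigD1 (Ordinal hk)) //= leq_addr.
pose st k := upd (upd (upd sg d (R k)) d.+1 (N - k)) d.+2 k.
have e1 x : (fun j => upd sg d x (rho j)) = e.
  by apply/funext => j; rewrite upd_neq // ltn_eqF.
apply: (@execs_le _ _ _ _ _ _ _ _ (ctg e + (ctn e +
  (\sum_(k < N) (cth (henv e k) + (2 * R k + 1) + (3 * R k.+1 + 1) + 1 + 2) + 1 + (2 * N + 1))))).
  set X := (X in ctg e + (ctn e + (X + 1 + _))); set Y := (Y in _ <= _ + Y).
  have -> : X = Y by apply: eq_bigr => k _; lia.
  by lia.
apply: execs_seq0; first by apply: hg => //; rewrite -/e; lia.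
apply: execs_seq0.
  have:= hn rho d.+1 (upd sg d (g e)) i V w; rewrite /= e1; apply.
  - by move=> j; apply: leq_trans (hr j) _.
  - by move=> j hj; rewrite upd_neq ?hz //; lia.
  by move: he; rewrite -/N; lia.
have st0 : upd (upd sg d (g e)) d.+1 N = st 0.
  rewrite /st subn0 [RHS]upd0 //.
  by rewrite !upd_neq ?hz //; lia.
rewrite -/N st0.
apply: execs_seq0; last first.
  have -> : upd sg d (R N) = upd (st N) d.+2 0.
    rewrite /st subnn upd_upd [upd _ d.+1 0]upd0 ?upd0 //; rewrite upd_neq ?hz //; lia.
  have sN : st N d.+2 = N by rewrite /st upd_eq.
  by have := @execs_clear V w d.+2 (st N) i; rewrite sN; apply.
rewrite -(flatten_nil N).
apply: (execs_loop (tt := fun k => cth (henv e k) + (2 * R k + 1) + (3 * R k.+1 + 1) + 1)).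
  by move=> k hk; rewrite /st; updv.
move=> k hk; set s1 := upd _ _ _; have hk' := hU _ hk.
have s1d : s1 d = R k by rewrite /s1 /st ; updv.
have s1d2 : s1 d.+2 = k by rewrite /s1 /st ; updv.
have s1z j : d.+3 <= j -> s1 j = 0.
  by move=> hj; rewrite /s1 /st !upd_neq ?hz //; lia.
have e3 : (fun j => s1 (scons d.+2 (scons d rho) j)) = henv e k.
  apply/funext => -[|[|j]] //=.
  by rewrite /s1 /st !upd_neq //; have := hr j; lia.
apply: (@execs_le _ _ _ _ _ _ _ _
  (cth (henv e k) + ((2 * R k + 1) + ((3 * R k.+1 + 1) + 1)))); first lia.
apply: execs_seq0.
  have:= hh (scons d.+2 (scons d rho)) d.+3 s1 i V w; rewrite /= e3; apply=> //; last lia.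
  by move=> [|[|j]] //=; [lia | have := hr j; lia].
rewrite -[h (henv e k)]/(R k.+1); set s2 := upd s1 d.+3 _.
have s2d : s2 d = R k by rewrite /s2 upd_neq //; lia.
apply: execs_seq0; first by rewrite -s2d; apply: execs_clear.
set s3 := upd s2 d 0.
have s3d : s3 d = 0 by rewrite /s3 upd_eq.
have s33 : s3 d.+3 = R k.+1 by rewrite /s3 /s2; updv.
have nd : d.+3 != d by lia.
apply: execs_seq0.
  have:= @execs_move V w d.+3 d s3 i nd; rewrite s33 s3d; apply; lia.
rewrite add0n; set s4 := upd _ d _.
have s42 : s4 d.+2 = k.
  by rewrite /s4 /s3 /s2 !upd_neq //; lia.
have -> : st k.+1 = upd s4 d.+2 (s4 d.+2).+1.
  rewrite s42 /s4 /s3 /s2 /s1 /st; updsolve.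
  by rewrite hz //; lia.
by apply: execs_inc; rewrite s42; lia.
Qed.

End Recursion.

(** * Polynomial bounds *)

Definition pb (c m : nat) : nat := c * m.+1 ^ c.

Definition polyb (p : nat -> nat) := exists c, forall n, p n <= pb c n.

Lemma pb_mono c m m' : m <= m' -> pb c m <= pb c m'.
Proof. by move=> h; rewrite /pb leq_mul2l; case: c => //= c; rewrite leq_exp2r. Qed.

Lemma polyb_le p q : (forall n, p n <= q n) -> polyb q -> polyb p.
Proof. by move=> h [c hc]; exists c => n; apply: leq_trans (h n) (hc n). Qed.

Lemma polyb_const a : polyb (fun _ => a).
Proof. by exists a => n; rewrite /pb leq_pmulr // expn_gt0. Qed.

Lemma polyb_id : polyb id.
Proof. by exists 1 => n; rewrite /pb expn1 mul1n. Qed.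

Lemma polyb_pb c : polyb (pb c).
Proof. by exists c. Qed.

Lemma polyb_add p q : polyb p -> polyb q -> polyb (fun n => p n + q n).
Proof.
move=> [c hc] [d hd]; exists (c + d) => n; rewrite /pb mulnDl leq_add //.
  apply: leq_trans (hc n) _; rewrite leq_mul2l leq_pexp2l ?orbT //; lia.
apply: leq_trans (hd n) _; rewrite leq_mul2l leq_pexp2l ?orbT //; lia.
Qed.

Lemma polyb_mul p q : polyb p -> polyb q -> polyb (fun n => p n * q n).
Proof.
move=> [c hc] [d hd]; exists (c * d + (c + d)) => n.
apply: leq_trans (leq_mul (hc n) (hd n)) _.
rewrite /pb mulnACA -expnD leq_mul ?leq_addr // leq_pexp2l // leq_addl //.
Qed.

Lemma polyb_comp p q : polyb p -> polyb q -> {homo p : m n / m <= n} ->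
  polyb (fun n => p (q n)).
Proof.
move=> [c hc] [d hd] pm; exists (c * d.+1 ^ c + d * c) => n.
apply: leq_trans (pm _ _ (hd n)) _; apply: leq_trans (hc _) _.
have h : (pb d n).+1 <= d.+1 * n.+1 ^ d.
  by rewrite /pb mulSn addnC -addn1 leq_add2l expn_gt0.
apply: (@leq_trans (c * (d.+1 * n.+1 ^ d) ^ c)).
  by rewrite leq_mul2l; case: c {hc} => //= c; rewrite leq_exp2r.
rewrite expnMn -expnM mulnA /pb leq_mul ?leq_addr // leq_pexp2l // leq_addl //.
Qed.

Lemma polyb_horner p : polyb p ->
  exists P : {poly nat}, forall n, p n <= P.[n]%R.
Proof.
move=> [c hc]; exists (c%:P * ('X + 1%:P) ^+ c)%R => n.
by have := hc n; rewrite !hornerE /= /pb -[n.+1]addn1.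
Qed.

Ltac polyt := repeat first [exact: polyb_pb | exact: polyb_const | exact: polyb_id
  | apply: polyb_add | apply: polyb_mul].

(* The two uses are [L = succn], which yields functions computable in time
   polynomial in the values of their arguments, and [L = expn 2], which yields
   functions computable in space polynomial in their size. *)
Class limit (L : nat -> nat) : Prop := Limit {
  lim_mono : {homo L : m n / m <= n};
  lim_self : forall a, a < L a;
  lim_add : forall a b x y, a < L x -> b < L y -> a + b < L (x + y + 1);
  lim_mul : forall a b x y, a < L x -> b < L y -> a * b < L (x * y + (x + y) + 1)
}.

#[export] Instance limit_succn : limit succn.
Proof.
split=> [m n|a|a b x y|a b x y]; rewrite ?ltnS //; first lia.
by move=> h h'; have := leq_mul h h'; lia.
Qed.

#[export] Instance limit_exp2 : limit (expn 2).
Proof.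
split=> [m n h|a|a b x y h h'|a b x y h h']; first by rewrite leq_exp2l.
- exact: ltn_expl.
- have : 2 ^ x <= 2 ^ (x + y) by rewrite leq_exp2l // leq_addr.
  have : 2 ^ y <= 2 ^ (x + y) by rewrite leq_exp2l // leq_addl.
  by rewrite addn1 expnS; lia.
apply: (@leq_trans (2 ^ (x + y))); last by rewrite leq_exp2l //; lia.
rewrite expnD; case: (posnP b) => [->|b0]; first by rewrite muln0 muln_gt0 !expn_gt0.
by apply: (@leq_trans (2 ^ x * b)); rewrite ?ltn_mul2r ?b0 // leq_mul2l ltnW // orbT.
Qed.

Section Classes.
Variables (L : nat -> nat).
Context {hL : limit L}.

Definition small_env (k m : nat) (e : env) := forall j, j < k -> e j < L m.

(** An environment has infinitely many variables; [k] says how many of them have to be small. With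
    [L = succn] the bound is polynomial in the values, with [L = expn 2] it is polynomial in the
    numbers of digits. *)
Definition bnd (g : env -> nat) :=
  exists k c, forall e m, small_env k m e -> g e < L (pb c m).

Lemma small_le k k' m m' e : k' <= k -> m <= m' -> small_env k m e -> small_env k' m' e.
Proof.
move=> hk hm h j hj; apply: leq_trans (lim_mono hm); apply: h; exact: leq_trans hj hk.
Qed.

Lemma bndI g k q : polyb q ->
  (forall e m, small_env k m e -> g e < L (q m)) -> bnd g.
Proof.
move=> [c hc] h; exists k, c => e m sm; apply: leq_trans (h _ _ sm) _.
exact: lim_mono.
Qed.

Lemma bnd_var j : bnd (fun e => e j).
Proof. by apply: (@bndI _ j.+1 id polyb_id) => e m; apply. Qed.

Lemma bnd_const a : bnd (fun _ => a).
Proof. by apply: (@bndI _ 0 _ (polyb_const a)) => e m _; apply: lim_self. Qed.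

Lemma bnd_le f g : (forall e, f e <= g e) -> bnd g -> bnd f.
Proof. by move=> h [k [c hc]]; exists k, c => e m /hc; apply: leq_ltn_trans. Qed.

Lemma bnd_add f g : bnd f -> bnd g -> bnd (fun e => f e + g e).
Proof.
move=> [k [c hc]] [k' [c' hc']].
apply: (@bndI _ (k + k') (fun m => pb c m + pb c' m + 1)).
  polyt.
move=> e m sm; apply: lim_add; [apply: hc | apply: hc']; apply: small_le sm; lia.
Qed.

Lemma bnd_mul f g : bnd f -> bnd g -> bnd (fun e => f e * g e).
Proof.
move=> [k [c hc]] [k' [c' hc']].
apply: (@bndI _ (k + k') (fun m => pb c m * pb c' m + (pb c m + pb c' m) + 1)).
  polyt.
move=> e m sm; apply: lim_mul; [apply: hc | apply: hc']; apply: small_le sm; lia.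
Qed.

Lemma bnd_max f g : bnd f -> bnd g -> bnd (fun e => maxn (f e) (g e)).
Proof.
move=> hf hg; apply: bnd_le (bnd_add hf hg) => e.
by rewrite geq_max leq_addr leq_addl.
Qed.

Lemma bnd_ren xi f : bnd f -> bnd (fun e => f (fun j => e (xi j))).
Proof.
move=> [k [c hc]]; exists (\sum_(j < k) (xi j).+1), c => e m sm.
apply: hc => j hj; apply: sm; rewrite (bigD1 (Ordinal hj)) //=; lia.
Qed.

(** The bound must be uniform over the rounds: a separate polynomial for each [i] would not bound a
    sum or a recursion. *)
Definition ubnd (n : env -> nat) (F : env -> nat -> nat) :=
  exists k c, forall e m, small_env k m e -> forall i, i <= n e -> F e i < L (pb c m).

Lemma ubnd_const n f : bnd f -> ubnd n (fun e _ => f e).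
Proof. by move=> [k [c hc]]; exists k, c => e m /hc h i _. Qed.

Lemma ubnd_add n F G : ubnd n F -> ubnd n G -> ubnd n (fun e i => F e i + G e i).
Proof.
move=> [k [c hc]] [k' [c' hc']].
have [c2 h2] : polyb (fun m => pb c m + pb c' m + 1).
  polyt.
exists (k + k'), c2 => e m sm i hi; apply: leq_trans (lim_mono (h2 m)).
by apply: lim_add; [apply: hc hi | apply: hc' hi]; apply: small_le sm; lia.
Qed.

Lemma ubnd_mulc n a F : ubnd n F -> ubnd n (fun e i => a * F e i).
Proof.
elim: a => [|a IH] h; first exact: (ubnd_const _ (bnd_const 0)).
have := ubnd_add h (IH h); congr ubnd.
Qed.

Lemma ubnd_le n F G : (forall e i, i <= n e -> F e i <= G e i) -> ubnd n G -> ubnd n F.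
Proof.
move=> h [k [c hc]]; exists k, c => e m sm i hi.
exact: leq_ltn_trans (h _ _ hi) (hc _ _ sm _ hi).
Qed.

Lemma bnd_sum n F : bnd n -> ubnd n F -> bnd (fun e => \sum_(i < n e) F e i).
Proof.
move=> [k [c hc]] [k' [c' hc']].
apply: (@bndI _ (k + k') (fun m => pb c m * pb c' m + (pb c m + pb c' m) + 1)).
  polyt.
move=> e m sm; have smn : small_env k m e by apply: small_le sm; lia.
have smF : small_env k' m e by apply: small_le sm; lia.
set l := L (pb c' m); have l0 : 0 < l.
  by rewrite /l; apply: leq_ltn_trans (hc' _ _ smF 0 _).
apply: (@leq_ltn_trans (n e * l.-1)).
  apply: (@leq_trans (\sum_(i < n e) l.-1)); last by rewrite sum_nat_const card_ord.
  apply: leq_sum => i _.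
  by have := hc' _ _ smF i (ltnW (ltn_ord i)); rewrite -/l; lia.
by apply: lim_mul; [apply: hc | rewrite -/l; lia].
Qed.

Lemma ubnd_env n h (F : env -> nat -> nat) : bnd n -> bnd h -> ubnd n F ->
  ubnd n (fun e i => h (scons i (scons (F e i) e))).
Proof.
move=> [k [c hc]] [kh [ch hh]] [k' [c' hc']].
have [c2 h2] : polyb (fun m => pb ch (m + pb c m + pb c' m)).
  apply: (@polyb_comp (pb ch) (fun m => m + pb c m + pb c' m)).
  - exact: polyb_pb.
  - polyt.
  by move=> x y; apply: pb_mono.
exists (k + k' + kh), c2 => e m sm i hi.
apply: leq_trans (lim_mono (h2 m)); apply: hh => -[|[|j]] hj /=.
- have smn : small_env k m e by apply: small_le sm; lia.
  apply: leq_ltn_trans hi _; apply: leq_trans (hc _ _ smn) _; apply: lim_mono; lia.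
- have smF : small_env k' m e by apply: small_le sm; lia.
  apply: leq_trans (hc' _ _ smF _ hi) _; apply: lim_mono; lia.
apply: leq_trans (sm j _) _; first lia.
by apply: lim_mono; lia.
Qed.

(** The running time is bounded in the same class as the values: polynomial for [succn], and for
    [expn 2] exponential in a polynomial, of which only the bound on the counters is used in the
    end. *)
Definition feasible (f : env -> nat) :=
  exists mx ct, [/\ computes f mx ct, bnd f, bnd mx & bnd ct].

Lemma f_ext f g : f =1 g -> feasible f -> feasible g.
Proof. by move=> h; have -> // : g = f by apply/funext. Qed.

Lemma f_var j : feasible (fun e => e j).
Proof.
eexists _, _; split; first exact: computes_var.
- exact: bnd_var.
- exact: bnd_var.
by apply: bnd_add (bnd_const _); apply: bnd_mul (bnd_const _) (bnd_var _).
Qed.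

Lemma f_succ f : feasible f -> feasible (fun e => (f e).+1).
Proof.
move=> [mx [ct [c b1 b2 b3]]].
have b1' : bnd (fun e => (f e).+1).
  by apply: bnd_le (bnd_add b1 (bnd_const 1)) => e; rewrite addn1.
eexists _, _; split; first exact: computes_succ c.
- by [].
- exact: bnd_max.
exact: bnd_add b3 (bnd_const _).
Qed.

Lemma f_const a : feasible (fun _ => a).
Proof.
elim: a => [|a IH]; last exact: f_succ IH.
by eexists _, _; split; [exact: computes_zero | exact: bnd_const ..].
Qed.

Lemma f_ren xi f : feasible f -> feasible (fun e => f (fun j => e (xi j))).
Proof.
move=> [mx [ct [c b1 b2 b3]]]; eexists _, _; split; first exact: computes_ren c.
- exact: bnd_ren b1.
- exact: bnd_ren b2.
exact: bnd_ren b3.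
Qed.

Lemma f_rec_ubnd n g h : feasible n -> feasible g -> feasible h ->
  ubnd n (prec g h) -> feasible (fun e => prec g h e (n e)).
Proof.
move=> [mxn [ctn [cn n1 n2 n3]]] [mxg [ctg [cg g1 g2 g3]]] [mxh [cth [ch h1 h2 h3]]] bR.
(* The costs mention the value after round [i]. The hypothesis says nothing about [i = n e], one
   round too far, so the function is cut off there. *)
have bR' : ubnd n (fun e i => if i < n e then prec g h e i.+1 else 0).
  case: bR => k [c hc]; exists k, c => e m sm i _; case: ifP => hi; first exact: hc hi.
  by apply: leq_ltn_trans (hc _ _ sm 0 _).
eexists _, _; split; first exact: computes_rec cn cg ch.
- by case: bR => k [c hc]; exists k, c => e m sm; apply: hc.
- do !apply: bnd_add => //.
  apply: (@bnd_le _ (fun e => \sum_(k < n e) (mxh (scons k (scons (prec g h e k) e)) +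
     if k < n e then prec g h e k.+1 else 0))).
    by move=> e; apply: leq_sum => i _; rewrite ltn_ord.
  apply: (bnd_sum (F := fun e k => mxh (scons k (scons (prec g h e k) e)) +
     if k < n e then prec g h e k.+1 else 0)) => //.
  by apply: ubnd_add => //; exact: (ubnd_env n1 h2 bR).
apply: bnd_add; first apply: bnd_add (bnd_const 5).
  apply: bnd_add; first exact: bnd_add.
  by apply: bnd_mul => //; exact: bnd_const.
apply: (@bnd_le _ (fun e => \sum_(k < n e) (cth (scons k (scons (prec g h e k) e)) +
     2 * prec g h e k + 3 * (if k < n e then prec g h e k.+1 else 0) + 5))).
  by move=> e; apply: leq_sum => i _; rewrite ltn_ord.
apply: (bnd_sum (F := fun e k => cth (scons k (scons (prec g h e k) e)) +
     2 * prec g h e k + 3 * (if k < n e then prec g h e k.+1 else 0) + 5)) => //.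
apply: ubnd_add (ubnd_const _ (bnd_const 5)).
apply: ubnd_add (ubnd_mulc 3 bR').
apply: ubnd_add (ubnd_mulc 2 bR).
exact: (ubnd_env n1 h3 bR).
Qed.

Lemma f_rec n g h b : feasible n -> feasible g -> feasible h -> feasible b ->
  (forall e k, k <= n e -> prec g h e k <= b e) ->
  feasible (fun e => prec g h e (n e)).
Proof.
move=> fn fg fh [mx [ct [_ bb _ _]]] hb; apply: f_rec_ubnd => //.
by apply: ubnd_le (ubnd_const _ bb).
Qed.

Lemma feasible_bnd f : feasible f -> bnd f.
Proof. by move=> [mx [ct []]]. Qed.

Lemma f_add f g : feasible f -> feasible g -> feasible (fun e => f e + g e).
Proof.
move=> ff fg; have E e k : prec f (fun e => (e 1).+1) e k = f e + k.
  by elim: k => [|k IH]; rewrite ?addn0 // addnS -IH.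
apply: (@f_ext (fun e => prec f (fun e => (e 1).+1) e (g e))); first by move=> e; apply: E.
apply: f_rec_ubnd => //; first exact/f_succ/f_var.
apply: (@ubnd_le _ _ (fun e _ => f e + g e)); first by move=> e i hi; rewrite E leq_add2l.
by apply: ubnd_const; apply: bnd_add; apply: feasible_bnd.
Qed.

Lemma f_mul f g : feasible f -> feasible g -> feasible (fun e => f e * g e).
Proof.
move=> ff fg; pose h e := e 1 + f (fun j => e j.+2).
have E e k : prec (fun _ => 0) h e k = f e * k.
  by elim: k => [|k IH]; rewrite ?muln0 // mulnS -IH /= /h /= addnC.
apply: (@f_ext (fun e => prec (fun _ => 0) h e (g e))); first by move=> e; apply: E.
apply: f_rec_ubnd => //; first exact: f_const.
  by apply: f_add; [exact: f_var | exact: (@f_ren (fun j => j.+2))].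
apply: (@ubnd_le _ _ (fun e _ => f e * g e)); first by move=> e i hi; rewrite E leq_mul2l hi orbT.
by apply: ubnd_const; apply: bnd_mul; apply: feasible_bnd.
Qed.

(* The body of a bounded operator is a function [F : env -> nat -> nat]; its
   feasibility is expressed with the bound variable as variable 0. *)
Definition feasible1 (F : env -> nat -> nat) :=
  feasible (fun e => F (fun j => e j.+1) (e 0)).

Lemma f_rec_body n g (H : env -> nat -> nat -> nat) b :
  feasible n -> feasible g ->
  feasible (fun e => H (fun j => e j.+2) (e 0) (e 1)) -> feasible b ->
  (forall e k, k <= n e -> nat_rect (fun _ => nat) (g e) (H e) k <= b e) ->
  feasible (fun e => nat_rect (fun _ => nat) (g e) (H e) (n e)).
Proof. by move=> fn fg fh fb hb; apply: (f_rec fn fg fh fb). Qed.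

Lemma f_body2 F : feasible1 F -> feasible (fun e => F (fun j => e j.+2) (e 0)).
Proof. exact: (@f_ren (fun j => if j is j'.+1 then j'.+2 else 0)). Qed.

Lemma f_body2' F : feasible1 F -> feasible (fun e => F (fun j => e j.+2) (e 1)).
Proof. exact: (@f_ren (fun j => j.+1)). Qed.

Lemma f_pred f : feasible f -> feasible (fun e => (f e).-1).
Proof.
move=> ff; have E k : nat_rect (fun _ => nat) 0 (fun i _ => i) k = k.-1 by case: k.
apply: (@f_ext (fun e => nat_rect (fun _ => nat) 0 (fun i _ => i) (f e))); first by move=> e; apply: E.
apply: (f_rec_body (b := f)) => //; [exact: f_const | exact: f_var |].
by move=> e k; rewrite E //; lia.
Qed.

Lemma f_sub f g : feasible f -> feasible g -> feasible (fun e => f e - g e).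
Proof.
move=> ff fg; have E e k : nat_rect (fun _ => nat) (f e) (fun _ r => r.-1) k = f e - k.
  by elim: k => [|k IH] /=; rewrite ?subn0 // IH subnS.
apply: (@f_ext (fun e => nat_rect (fun _ => nat) (f e) (fun _ r => r.-1) (g e))).
  by move=> e; apply: E.
apply: (f_rec_body (b := f)) => //; first by apply/f_pred/f_var.
by move=> e k _; rewrite E leq_subr.
Qed.

Lemma f_eq0 f : feasible f -> feasible (fun e => f e == 0).
Proof.
move=> ff; apply: (@f_ext (fun e => 1 - f e)); first by move=> e; case: (f e).
by apply: f_sub => //; apply: f_const.
Qed.

Lemma f_leq f g : feasible f -> feasible g -> feasible (fun e => f e <= g e).
Proof.
move=> ff fg; apply: (@f_ext (fun e => f e - g e == 0)); first by move=> e; rewrite subn_eq0.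
by apply/f_eq0/f_sub.
Qed.

Lemma f_neg (p : env -> bool) : feasible p -> feasible (fun e => ~~ p e).
Proof.
move=> fp; apply: (@f_ext (fun e => p e == 0 :> nat)); first by move=> e; case: (p e).
exact: f_eq0.
Qed.

Lemma f_and (p q : env -> bool) : feasible p -> feasible q -> feasible (fun e => p e && q e).
Proof.
move=> fp fq; apply: (@f_ext (fun e => p e * q e)); first by move=> e; rewrite mulnb.
exact: f_mul.
Qed.

Lemma f_or (p q : env -> bool) : feasible p -> feasible q -> feasible (fun e => p e || q e).
Proof.
move=> fp fq; apply: (@f_ext (fun e => ~~ (~~ p e && ~~ q e))).
  by move=> e; rewrite -negb_or negbK.
by apply/f_neg/f_and; apply: f_neg.
Qed.

Lemma f_imply (p q : env -> bool) : feasible p -> feasible q -> feasible (fun e => p e ==> q e).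
Proof.
move=> fp fq; apply: (@f_ext (fun e => ~~ p e || q e)); first by move=> e; rewrite implybE.
by apply/f_or => //; apply: f_neg.
Qed.

Lemma f_if (p : env -> bool) f g : feasible p -> feasible f -> feasible g ->
  feasible (fun e => if p e then f e else g e).
Proof.
move=> fp ff fg; apply: (@f_ext (fun e => p e * f e + (1 - p e) * g e)).
  by move=> e; case: (p e); rewrite ?mul1n ?mul0n ?addn0.
by apply: f_add; apply: f_mul => //; apply: f_sub => //; apply: f_const.
Qed.

Lemma f_ifb (p q r : env -> bool) : feasible p -> feasible q -> feasible r ->
  feasible (fun e => (if p e then q e else r e) : bool).
Proof.
move=> fp fq fr; apply: (@f_ext (fun e => if p e then q e : nat else r e)).
  by move=> e; case: (p e).
exact: f_if.
Qed.

Lemma f_eq f g : feasible f -> feasible g -> feasible (fun e => f e == g e).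
Proof.
move=> ff fg; apply: (@f_ext (fun e => (f e <= g e) && (g e <= f e))).
  by move=> e; rewrite eqn_leq.
by apply: f_and; apply: f_leq.
Qed.

Lemma f_eqb (p q : env -> bool) : feasible p -> feasible q ->
  feasible (fun e => p e == q e).
Proof.
move=> fp fq; apply: (@f_ext (fun e => (p e : nat) == (q e : nat))).
  by move=> e; case: (p e); case: (q e).
exact: f_eq.
Qed.

Lemma f_minn f g : feasible f -> feasible g -> feasible (fun e => minn (f e) (g e)).
Proof. by move=> ff fg; apply: f_if => //; apply: f_leq => //; apply: f_succ. Qed.

Lemma f_has n (P : env -> nat -> bool) : feasible n -> feasible1 P ->
  feasible (fun e => has (P e) (iota 0 (n e))).
Proof.
move=> fn fP; pose H e i r := nat_of_bool ((0 < r) || P e i).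
have E e k : nat_rect (fun _ => nat) 0 (H e) k = has (P e) (iota 0 k).
  by elim: k => // k IH; rewrite -[k.+1]addn1 iotaD addnC /= IH has_cat /= orbF /H lt0b.
apply: (@f_ext (fun e => nat_rect (fun _ => nat) 0 (H e) (n e))).
  by move=> e; apply: E.
apply: (f_rec_body (b := fun _ => 1)) => //; try exact: f_const.
- apply: f_or; first by apply: f_leq; [exact: f_const | exact: f_var].
  exact: (f_body2 fP).
by move=> e k _; rewrite E leq_b1.
Qed.

Lemma f_all n (P : env -> nat -> bool) : feasible n -> feasible1 P ->
  feasible (fun e => all (P e) (iota 0 (n e))).
Proof.
move=> fn fP; apply: (@f_ext (fun e => ~~ has (fun i => ~~ P e i) (iota 0 (n e)))).
  by move=> e; rewrite -all_predC; congr nat_of_bool; apply: eq_all => i /=; rewrite negbK.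
by apply/f_neg/f_has => //; apply: f_neg.
Qed.

Lemma find_iota_rec (P : nat -> bool) k :
  find P (iota 0 k.+1) = if find P (iota 0 k) < k then find P (iota 0 k) else k + ~~ P k.
Proof.
rewrite -addn1 iotaD find_cat add0n size_iota /=.
have -> : (find P (iota 0 k) < k) = has P (iota 0 k) by rewrite has_find size_iota.
by case: ifP => // _; case: (P k).
Qed.

Lemma f_find n (P : env -> nat -> bool) : feasible n -> feasible1 P ->
  feasible (fun e => find (P e) (iota 0 (n e))).
Proof.
move=> fn fP; pose H e i r := if r < i then r else i + ~~ P e i.
have E e k : nat_rect (fun _ => nat) 0 (H e) k = find (P e) (iota 0 k).
  by elim: k => // k IH; rewrite find_iota_rec /= IH.
apply: (@f_ext (fun e => nat_rect (fun _ => nat) 0 (H e) (n e))).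
  by move=> e; apply: E.
apply: (f_rec_body (b := n)) => //; first exact: f_const.
- apply: f_if; [apply: f_leq; [apply: f_succ|] | |]; try exact: f_var.
  by apply: f_add; [exact: f_var | apply: f_neg; exact: (f_body2 fP)].
by move=> e k hk; rewrite E; have := find_size (P e) (iota 0 k); rewrite size_iota; lia.
Qed.

Lemma f_iter n x (F : env -> nat -> nat) b :
  feasible n -> feasible x -> feasible1 F -> feasible b ->
  (forall e k, k <= n e -> iter k (F e) (x e) <= b e) ->
  feasible (fun e => iter (n e) (F e) (x e)).
Proof.
move=> fn fx fF fb hb.
have E e k : nat_rect (fun _ => nat) (x e) (fun _ => F e) k = iter k (F e) (x e).
  by elim: k => //= k ->.
apply: (@f_ext (fun e => nat_rect (fun _ => nat) (x e) (fun _ => F e) (n e))).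
  by move=> e; apply: E.
apply: (f_rec_body (b := b)) => //; exact: (f_body2' fF).
Qed.

(** The quotient is the least [q] with [m < q.+1 * d]. If it equals [m], the search over [iota 0 m]
    fails and returns the length [m], which is still the right value. *)
Lemma divn_find m d : m %/ d =
  if d == 0 then 0 else find (fun q => m < q.+1 * d) (iota 0 m).
Proof.
case: d => [|d]; first by rewrite divn0.
rewrite /=; set P := fun q => _.
have q1 : P (m %/ d.+1) by rewrite /P -ltn_divLR // leqnn.
have qmin q : q < m %/ d.+1 -> ~~ P q.
  by move=> h; rewrite /P -leqNgt -leq_divRL.
case: (ltnP (m %/ d.+1) m) => h.
  have hs : has P (iota 0 m) by apply/hasP; exists (m %/ d.+1); rewrite ?mem_iota.
  apply/eqP; rewrite eqn_leq; apply/andP; split.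
    rewrite leqNgt; apply/negP => lt; have := nth_find 0 hs.
    rewrite nth_iota ?add0n; last by rewrite has_find size_iota in hs.
    by apply/negP; apply: qmin.
  rewrite leqNgt; apply/negP => lt; have := before_find 0 lt.
  by rewrite nth_iota // q1.
have -> : m %/ d.+1 = m by apply/eqP; rewrite eqn_leq h leq_div.
have : ~~ has P (iota 0 m).
  apply/hasPn => q; rewrite mem_iota => /andP[_ hq]; apply: qmin; lia.
by move=> /hasNfind ->; rewrite size_iota.
Qed.

Lemma f_div f g : feasible f -> feasible g -> feasible (fun e => f e %/ g e).
Proof.
move=> ff fg; apply: f_ext (fun e => esym (divn_find (f e) (g e))) _.
apply: f_if; [exact: f_eq0 | exact: f_const | apply: f_find => //].
apply: f_leq; first by apply: f_succ; apply: (@f_ren succn).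
by apply: f_mul; [apply/f_succ/f_var | apply: (@f_ren succn)].
Qed.

Lemma f_mod f g : feasible f -> feasible g -> feasible (fun e => f e %% g e).
Proof.
move=> ff fg; apply: (@f_ext (fun e => f e - f e %/ g e * g e)).
  by move=> e; rewrite {1}(divn_eq (f e) (g e)) addKn.
by apply: f_sub => //; apply: f_mul => //; apply: f_div.
Qed.

Lemma f_odd f : feasible f -> feasible (fun e => odd (f e)).
Proof.
move=> ff; apply: (@f_ext (fun e => f e %% 2)); first by move=> e; rewrite modn2.
by apply: f_mod => //; apply: f_const.
Qed.

(** Dividing [n] times by [g] never leaves the range of [f], whereas the power itself may exceed
    every admissible bound. *)
Lemma f_div_iter f n g : feasible f -> feasible n -> feasible g ->
  feasible (fun e => f e %/ g e ^ n e).
Proof.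
move=> ff fn fg.
have E e k : iter k (fun x => x %/ g e) (f e) = f e %/ g e ^ k.
  by elim: k => [|k IH]; rewrite ?divn1 //= IH expnSr divnMA.
apply: (@f_ext (fun e => iter (n e) (fun x => x %/ g e) (f e))) => [e|]; first exact: E.
apply: (f_iter (b := f)) => //.
  by apply: f_div; [exact: f_var | exact: (@f_ren succn)].
by move=> e k _; rewrite E leq_div.
Qed.

Lemma trunc_log_find n : trunc_log 2 n = find (fun i => n %/ 2 ^ i.+1 == 0) (iota 0 n).
Proof.
case: (posnP n) => [->//|n0].
set P := fun i => _.
have PE i : P i = (n < 2 ^ i.+1) by rewrite /P -leqn0 leqNgt divn_gt0 ?expn_gt0 // -ltnNge.
have lt : trunc_log 2 n < n.
  by apply: leq_trans (trunc_logP (isT : 1 < 2) n0); apply: ltn_expl.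
have q1 : P (trunc_log 2 n) by rewrite PE trunc_log_ltn.
have hs : has P (iota 0 n) by apply/hasP; exists (trunc_log 2 n); rewrite ?mem_iota.
apply/eqP; rewrite eqn_leq; apply/andP; split.
  rewrite leqNgt; apply/negP => l; have := nth_find 0 hs.
  rewrite nth_iota ?add0n; last by rewrite has_find size_iota in hs.
  rewrite PE ltnNge => /negP; apply; apply: leq_trans (trunc_logP (isT : 1 < 2) n0).
  by rewrite leq_exp2l.
rewrite leqNgt; apply/negP => l; have := before_find 0 l.
by rewrite nth_iota // q1.
Qed.

Lemma f_trunc_log f : feasible f -> feasible (fun e => trunc_log 2 (f e)).
Proof.
move=> ff; apply: f_ext (fun e => esym (trunc_log_find (f e))) _.
apply: f_find => //; apply/f_eq0/f_div_iter.
- exact: (@f_ren succn).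
- exact/f_succ/f_var.
exact: f_const.
Qed.

End Classes.

Notation PS := (feasible (expn 2)).
Notation PV := (feasible succn).

Ltac feas_hook := fail.

(** A pattern [@?a e] captures a subterm together with its dependence on the environment, so that
    the closure lemmas receive explicit functions. A hypothesis on a function of the outer variables
    is used below binders through [f_ren]. Functions defined later are added by redefining
    [feas_hook]. *)
Ltac feas := cbv beta; lazymatch goal with
  | |- feasible1 _ _ => unfold feasible1; feas
  | |- feasible _ (fun e => e _) => apply: f_var
  | |- feasible _ (fun e => addn (@?a e) (@?b e)) => apply (@f_add _ _ a b); feas
  | |- feasible _ (fun e => muln (@?a e) (@?b e)) => apply (@f_mul _ _ a b); feas
  | |- feasible _ (fun e => subn (@?a e) (@?b e)) => apply (@f_sub _ _ a b); feas
  | |- feasible _ (fun e => divn (@?a e) (expn (@?b e) (@?n e))) => apply (@f_div_iter _ _ a n b); feas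
  | |- feasible _ (fun e => divn (@?a e) (@?b e)) => apply (@f_div _ _ a b); feas
  | |- feasible _ (fun e => modn (@?a e) (@?b e)) => apply (@f_mod _ _ a b); feas
  | |- feasible _ (fun e => minn (@?a e) (@?b e)) => apply (@f_minn _ _ a b); feas
  | |- feasible _ (fun e => trunc_log 2 (@?a e)) => apply (@f_trunc_log _ _ a); feas
  | |- feasible _ (fun e => predn (@?a e)) => apply (@f_pred _ _ a); feas
  | |- feasible _ (fun e => S (@?a e)) =>
      first [apply: f_const | apply (@f_succ _ _ a); feas]
  | |- feasible _ (fun e => find (@?P e) (iota 0 (@?n e))) => apply (@f_find _ _ n P); feas
  | |- feasible _ (fun e => nat_of_bool (leq (@?a e) (@?b e))) => apply (@f_leq _ _ a b); feas
  | |- feasible _ (fun e => nat_of_bool (@eq_op nat (@?a e) (@?b e))) => apply (@f_eq _ _ a b); feas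
  | |- feasible _ (fun e => nat_of_bool (@eq_op _ (@?a e) (@?b e))) =>
      first [apply (@f_eq _ _ a b) | apply (@f_eqb _ _ a b)]; feas
  | |- feasible _ (fun e => nat_of_bool (odd (@?a e))) => apply (@f_odd _ _ a); feas
  | |- feasible _ (fun e => nat_of_bool (~~ (@?a e))) => apply (@f_neg _ _ a); feas
  | |- feasible _ (fun e => nat_of_bool (andb (@?a e) (@?b e))) => apply (@f_and _ _ a b); feas
  | |- feasible _ (fun e => nat_of_bool (orb (@?a e) (@?b e))) => apply (@f_or _ _ a b); feas
  | |- feasible _ (fun e => nat_of_bool (implb (@?a e) (@?b e))) => apply (@f_imply _ _ a b); feas
  | |- feasible _ (fun e => nat_of_bool (has (@?P e) (iota 0 (@?n e)))) => apply (@f_has _ _ n P); feas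
  | |- feasible _ (fun e => nat_of_bool (all (@?P e) (iota 0 (@?n e)))) => apply (@f_all _ _ n P); feas
  | |- feasible _ ?f =>
      first [ assumption
            | apply: f_const
            | lazymatch f with
              | (fun e => ?a (fun j => e (@?x j))) => apply (@f_ren _ x a); assumption
              | (fun e => nat_of_bool (?a (fun j => e (@?x j)))) =>
                  apply (@f_ren _ x (fun e => nat_of_bool (a e))); assumption
              end
            | feas_hook; feas
            | apply: f_ifb; feas | apply: f_if; feas ]
  end.

Section Let.
Variables (L : nat -> nat).
Context {hL : limit L}.
Notation feasible := (feasible L).

Lemma bnd_let f a : bnd L f -> bnd L a -> bnd L (fun e => f (scons (a e) e)).
Proof.
move=> [k [c hc]] [k' [c' hc']].
apply: (@bndI _ _ _ (k + k') (fun m => pb c (m + pb c' m))).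
  apply: (@polyb_comp (pb c) (fun m => m + pb c' m)); polyt.
  by move=> x y; apply: pb_mono.
move=> e m sm; apply: hc => -[|j] hj /=.
  have smF : small_env L k' m e by apply: small_le sm; lia.
  by apply: leq_trans (hc' _ _ smF) _; apply: lim_mono; lia.
by apply: leq_trans (sm j _) _; [lia | apply: lim_mono; lia].
Qed.

(** Composition is a recursion of length 1: the initial value puts [a] into a register, and the
    single round applies [f] to it, ignoring the index. *)
Lemma f_let f a : feasible f -> feasible a -> feasible (fun e => f (scons (a e) e)).
Proof.
move=> ff fa; pose h := fun e : env => f (fun j => e j.+1).
have hE k r e : h (scons k (scons r e)) = f (scons r e) by [].
apply: (@f_ext _ (fun e => prec a h e 1)) => //.
apply: (@f_rec_ubnd _ _ (fun _ => 1)) => //; [exact: f_const | exact: f_ren |].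
have [k [c hc]] := bnd_add (feasible_bnd fa) (bnd_let (feasible_bnd ff) (feasible_bnd fa)).
exists k, c => e m /hc h1 i h2; apply: leq_ltn_trans h1.
by case: i h2 => [|[|]] //= _; rewrite ?leq_addr // hE leq_addl.
Qed.

Lemma f_app1 (F : env -> nat -> nat) a : feasible1 L F -> feasible a ->
  feasible (fun e => F e (a e)).
Proof. exact: f_let. Qed.

Lemma f_app2 (F : env -> nat -> nat -> nat) a b :
  feasible (fun e => F (fun j => e j.+2) (e 0) (e 1)) -> feasible a -> feasible b ->
  feasible (fun e => F e (a e) (b e)).
Proof.
move=> fF fa fb.
apply: (@f_app1 (fun e y => F e (a e) y)) => //.
apply: (@f_app1 (fun e x => F (fun j => e j.+1) x (e 0))); last exact: (@f_ren _ succn).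
exact: fF.
Qed.

End Let.

(** The value itself, not its number of digits, is polynomial in the number of digits of the
    arguments. This is what an exponent or the depth of a Savitch recursion must satisfy. *)
Definition small_fun (b : env -> nat) :=
  exists k c, forall e m, small_env (expn 2) k m e -> b e <= pb c m.

Lemma small_fun_const a : small_fun (fun _ => a).
Proof. by have [c h] := polyb_const a; exists 0, c => e m _. Qed.

Lemma small_fun_add f g : small_fun f -> small_fun g -> small_fun (fun e => f e + g e).
Proof.
move=> [k [c hc]] [k' [c' hc']].
have [d hd] := polyb_add (polyb_pb c) (polyb_pb c').
exists (k + k'), d => e m sm; apply: leq_trans (hd m).
by apply: leq_add; [apply: hc | apply: hc']; apply: small_le sm; lia.
Qed.

Lemma small_fun_mul f g : small_fun f -> small_fun g -> small_fun (fun e => f e * g e).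
Proof.
move=> [k [c hc]] [k' [c' hc']].
have [d hd] := polyb_mul (polyb_pb c) (polyb_pb c').
exists (k + k'), d => e m sm; apply: leq_trans (hd m).
by apply: leq_mul; [apply: hc | apply: hc']; apply: small_le sm; lia.
Qed.

Lemma small_fun_log f : PS f -> small_fun (fun e => trunc_log 2 (f e)).
Proof.
move=> /feasible_bnd[k [c hc]]; exists k, c => e m /hc.
case: (posnP (f e)) => [->//|h1 h2].
rewrite -(leq_exp2l (m := 2)) //; apply: leq_trans (ltnW h2).
exact: trunc_logP.
Qed.

Lemma f_pow a b : PS a -> PS b -> small_fun b -> PS (fun e => a e ^ b e).
Proof.
move=> fa fb [k [c hc]]; pose h := fun e : env => e 1 * a (fun j => e j.+2).
have E e i : prec (fun _ => 1) h e i = a e ^ i.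
  by elim: i => //= i IH; rewrite /h /= IH expnSr.
apply: (@f_ext _ (fun e => prec (fun _ => 1) h e (b e))); first by move=> e; apply: E.
apply: f_rec_ubnd => //; [exact: f_const | by rewrite /h; feas |].
have [k' [c' hc']] := feasible_bnd fa.
have [d hd] : polyb (fun m => pb c' m * pb c m + 1) by polyt.
exists (k + k'), d => e m sm i hi; rewrite E; apply: leq_trans (lim_mono (hd m)).
have h1 : a e < 2 ^ pb c' m by apply: hc'; apply: small_le sm; lia.
have h2 : b e <= pb c m by apply: hc; apply: small_le sm; lia.
apply: (@leq_ltn_trans ((2 ^ pb c' m) ^ i)).
  by case: i {hi} => // i; rewrite leq_exp2r // ltnW.
rewrite -expnM ltn_exp2l // addn1 ltnS leq_mul2l; apply/orP; right; lia.
Qed.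

(** * Savitch's algorithm *)

Section Savitch.
Variables (E : nat -> nat -> bool) (N D : nat).

Fixpoint rch (d x y : nat) : bool :=
  if d is d'.+1 then has (fun z => rch d' x z && rch d' z y) (iota 0 N)
  else (x == y) || E x y.

Definition base := N + D + 4.
Definition cn (a s : nat) := s * base + a.
Definition hd (s : nat) := s %% base.
Definition tl (s : nat) := s %/ base.

(* Mode 0 is a call of [rch l x y]; modes 1 and 2 return its value, false or
   true. A frame of the stack holds the arguments of a pending call, the
   midpoint under examination, and which half of the path is being checked. *)
Definition mkst (m x y l s : nat) := cn m (cn x (cn y (cn l s))).

(** No marker for the empty stack is needed: a call at level [l] has [D - l] frames below it, so a
    return at level [D] is final and the state stays put. *)
Definition step (st : nat) : nat :=
  let m := hd st in let x := hd (tl st) in let y := hd (tl (tl st)) in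
  let l := hd (tl (tl (tl st))) in let s := tl (tl (tl (tl st))) in
  if m == 0 then
    if l == 0 then mkst (1 + ((x == y) || E x y)) x y l s
    else mkst 0 x 0 l.-1 (mkst x y 0 0 s)
  else if l == D then st else
  let x' := hd s in let y' := hd (tl s) in let z' := hd (tl (tl s)) in
  let ph := hd (tl (tl (tl s))) in let s' := tl (tl (tl (tl s))) in
  if m == 2 then
    if ph == 0 then mkst 0 z' y' l (mkst x' y' z' 1 s') else mkst 2 x' y' l.+1 s'
  else if z'.+1 < N then mkst 0 x' z'.+1 l (mkst x' y' z'.+1 0 s')
  else mkst 1 x' y' l.+1 s'.

(** The current call takes four digits and each of the at most [D] frames four more; the exponent
    leaves some slack. The truncation in [cstep] never happens on a genuine run, but it bounds the
    iterates for arbitrary arguments, as [f_iter] requires. *)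
Definition stlim := base ^ (4 * D + 8).
Definition cstep (st : nat) : nat := if step st < stlim then step st else 0.

Lemma base_gt0 : 0 < base. Proof. by rewrite /base; lia. Qed.

Lemma hd_cn a s : a < base -> hd (cn a s) = a.
Proof. by move=> h; rewrite /hd /cn modnMDl modn_small. Qed.

Lemma tl_cn a s : a < base -> tl (cn a s) = s.
Proof. by move=> h; rewrite /tl /cn divnMDl ?base_gt0 // divn_small // addn0. Qed.

Lemma cn_lt a s k : a < base -> s < base ^ k -> cn a s < base ^ k.+1.
Proof.
move=> ha hs; rewrite /cn expnSr; apply: (@leq_trans (s.+1 * base)).
  by rewrite mulSn addnC ltn_add2r.
by rewrite leq_mul2r hs orbT.
Qed.

Lemma mkst_lt m x y l s k : m < base -> x < base -> y < base -> l < base ->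
  s < base ^ k -> mkst m x y l s < base ^ (k + 4).
Proof. by move=> *; rewrite addn4; do !apply: cn_lt. Qed.

Lemma small_base a : a < N + D + 4 -> a < base. Proof. by []. Qed.

Ltac bs := apply: small_base; lia.

Lemma cstep_call0 x y s k : x < N -> y < N -> s < base ^ k -> k <= 4 * D ->
  cstep (mkst 0 x y 0 s) = mkst (1 + rch 0 x y) x y 0 s.
Proof.
move=> hx hy hs hk.
have -> : cstep (mkst 0 x y 0 s) = if step (mkst 0 x y 0 s) < stlim then
  step (mkst 0 x y 0 s) else 0 by [].
have -> : step (mkst 0 x y 0 s) = mkst (1 + rch 0 x y) x y 0 s.
  by rewrite /step {1 2 3 4 5 6 7 8 9 10}/mkst !(hd_cn, tl_cn) //=; bs.
rewrite (@leq_trans (base ^ (k + 4))) //.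
  by apply: mkst_lt => //; try bs; apply: small_base; case: rch; lia.
by rewrite leq_exp2l; rewrite /base; lia.
Qed.

Lemma cstep_eq st st' k : step st = st' -> st' < base ^ k -> k <= 4 * D + 8 ->
  cstep st = st'.
Proof.
move=> e h hk; rewrite /cstep e (leq_trans h) //.
by rewrite leq_exp2l; rewrite /base; lia.
Qed.

Definition calls T st st' := exists2 t, t <= T & iter t cstep st = st'.

Lemma calls_trans T1 T2 a b c : calls T1 a b -> calls T2 b c -> calls (T1 + T2) a c.
Proof.
move=> [t1 h1 e1] [t2 h2 e2]; exists (t1 + t2); first exact: leq_add.
by rewrite addnC iterD e1.
Qed.

Lemma calls1 a b : cstep a = b -> calls 1 a b.
Proof. by exists 1. Qed.

Lemma calls_le T T' a b : T <= T' -> calls T a b -> calls T' a b.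
Proof. by move=> h [t ht e]; exists t => //; apply: leq_trans ht h. Qed.

Lemma step_ret m x y l x' y' z' ph s :
  0 < m -> m <= 2 -> x < N -> y < N -> l < D -> x' < N -> y' < N -> z' < N -> ph <= 1 ->
  step (mkst m x y l (mkst x' y' z' ph s)) =
  if m == 2 then
    if ph == 0 then mkst 0 z' y' l (mkst x' y' z' 1 s) else mkst 2 x' y' l.+1 s
  else if z'.+1 < N then mkst 0 x' z'.+1 l (mkst x' y' z'.+1 0 s)
  else mkst 1 x' y' l.+1 s.
Proof.
move=> m0 m2 hx hy hl hx' hy' hz' hp.
set st := mkst m _ _ _ _.
have e1 : hd st = m by rewrite hd_cn //; bs.
have e2 : tl (tl (tl st)) = cn l (mkst x' y' z' ph s) by rewrite !tl_cn //; bs.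
have e3 : hd (cn l (mkst x' y' z' ph s)) = l by rewrite hd_cn //; bs.
have e4 : tl (cn l (mkst x' y' z' ph s)) = mkst x' y' z' ph s by rewrite tl_cn //; bs.
rewrite /step e1 e2 e3 e4 /=.
have -> : m == 0 = false by lia.
have -> : l == D = false by lia.
have -> : hd (mkst x' y' z' ph s) = x' by rewrite hd_cn //; bs.
have -> : tl (mkst x' y' z' ph s) = cn y' (cn z' (cn ph s)) by rewrite tl_cn //; bs.
have -> : hd (cn y' (cn z' (cn ph s))) = y' by rewrite hd_cn //; bs.
have -> : tl (cn y' (cn z' (cn ph s))) = cn z' (cn ph s) by rewrite tl_cn //; bs.
have -> : hd (cn z' (cn ph s)) = z' by rewrite hd_cn //; bs.
have -> : tl (cn z' (cn ph s)) = cn ph s by rewrite tl_cn //; bs.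
by rewrite hd_cn ?tl_cn //; bs.
Qed.

Lemma step_call x y l s : x < N -> y < N -> l < D ->
  step (mkst 0 x y l.+1 s) = mkst 0 x 0 l (mkst x y 0 0 s).
Proof.
move=> hx hy hl; set st := mkst _ _ _ _ _.
have e1 : hd st = 0 by rewrite hd_cn //; bs.
have e2 : tl st = cn x (cn y (cn l.+1 s)) by rewrite tl_cn //; bs.
have e3 : hd (cn x (cn y (cn l.+1 s))) = x by rewrite hd_cn //; bs.
have e4 : tl (cn x (cn y (cn l.+1 s))) = cn y (cn l.+1 s) by rewrite tl_cn //; bs.
have e5 : hd (cn y (cn l.+1 s)) = y by rewrite hd_cn //; bs.
have e6 : tl (cn y (cn l.+1 s)) = cn l.+1 s by rewrite tl_cn //; bs.
by rewrite /step e1 e2 e3 e4 e5 e6 hd_cn ?tl_cn //=; bs.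
Qed.

Fixpoint rtime (l : nat) : nat :=
  if l is l'.+1 then 1 + N * (2 * rtime l' + 2) else 1.

Lemma calls_rch l x y s : l <= D -> x < N -> y < N -> s < base ^ (4 * (D - l)) ->
  calls (rtime l) (mkst 0 x y l s) (mkst (1 + rch l x y) x y l s).
Proof.
elim: l x y s => [|l IH] x y s hl hx hy hs.
  by apply: calls1; apply: cstep_call0 hs _ => //; lia.
have eD : 4 * (D - l) = 4 * (D - l.+1) + 4 by lia.
have fr z ph : z < N -> ph <= 1 -> mkst x y z ph s < base ^ (4 * (D - l)).
  by move=> hz hp; rewrite eD; apply: mkst_lt => //; bs.
have lim m a b l' s' : m <= 2 -> a < N -> b < N -> l' <= D ->
    s' < base ^ (4 * (D - l)) -> mkst m a b l' s' < base ^ (4 * (D - l) + 4).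
  by move=> *; apply: mkst_lt => //; bs.
have hs' : s < base ^ (4 * (D - l)).
  apply: leq_trans hs _; rewrite leq_exp2l; first lia.
  by rewrite /base; lia.
have kD : 4 * (D - l) + 4 <= 4 * D + 8 by lia.
have N0 : 0 < N by lia.
apply: (@calls_trans 1 (N * (2 * rtime l + 2)) _ (mkst 0 x 0 l (mkst x y 0 0 s))).
  apply: calls1; apply: (cstep_eq (step_call _ _ _ _) _ kD) => //.
  by apply: lim => //; [lia | exact: fr].
suff H n z : z + n = N -> 0 < n ->
    calls (n * (2 * rtime l + 2)) (mkst 0 x z l (mkst x y z 0 s))
      (mkst (1 + has (fun z => rch l x z && rch l z y) (iota z n)) x y l.+1 s).
  by apply: (H N 0).
elim: n z => // n IHn z zN _; have hz : z < N by lia.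
(* A midpoint may fail at either half. The two returns find different frames on the stack, but both
   go on with midpoint [z.+1], or return false if there is none. *)
have next : calls (1 + n * (2 * rtime l + 2))
   (mkst 1 x z l (mkst x y z 0 s))
   (mkst (1 + has (fun z => rch l x z && rch l z y) (iota z.+1 n)) x y l.+1 s) /\
  calls (1 + n * (2 * rtime l + 2))
   (mkst 1 z y l (mkst x y z 1 s))
   (mkst (1 + has (fun z => rch l x z && rch l z y) (iota z.+1 n)) x y l.+1 s).
  case: (posnP n) => [n0|n0].
    rewrite n0 /= mul0n addn0.
    split; apply: calls1; apply: (@cstep_eq _ _ (4 * (D - l) + 4)) => //.
    - by rewrite step_ret //=; case: ltnP => //; lia.
    - exact: lim.
    - by rewrite step_ret //=; case: ltnP => //; lia.
    exact: lim.
  split; apply: calls_trans (IHn z.+1 _ n0); try lia;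
    apply: calls1; apply: (@cstep_eq _ _ (4 * (D - l) + 4)) => //.
  - by rewrite step_ret //=; case: ltnP => //; lia.
  - by apply: lim => //; [lia | lia | apply: fr; lia].
  - by rewrite step_ret //=; case: ltnP => //; lia.
  by apply: lim => //; [lia | lia | apply: fr; lia].
have c1 := IH x z (mkst x y z 0 s) (ltnW hl) hx hz (fr z 0 hz isT).
have c2 := IH z y (mkst x y z 1 s) (ltnW hl) hz hy (fr z 1 hz isT).
rewrite [iota z n.+1]/=; case E1: (rch l x z) c1 => c1 /=; last first.
  rewrite E1; apply: calls_le (calls_trans c1 next.1); lia.
rewrite E1 /=.
have c12 : calls 1 (mkst 2 x z l (mkst x y z 0 s)) (mkst 0 z y l (mkst x y z 1 s)).
  apply: calls1; apply: (@cstep_eq _ _ (4 * (D - l) + 4)) => //.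
    by rewrite step_ret.
  by apply: lim => //; [lia | exact: fr].
have c3 := calls_trans c1 (calls_trans c12 c2).
case: (rch l z y) c3 => c3 /=; last first.
  by apply: calls_le (calls_trans c3 next.2); lia.
apply: (calls_le _ (calls_trans c3 (calls1 (b := mkst 2 x y l.+1 s) _))); first lia.
apply: (@cstep_eq _ _ (4 * (D - l) + 4)) => //; first by rewrite step_ret.
exact: lim.
Qed.

Lemma rtime_le l : rtime l <= (4 * N + 1) ^ l.
Proof.
elim: l => //= l IH; rewrite expnS.
have : 0 < (4 * N + 1) ^ l by rewrite expn_gt0; lia.
by move: IH; set t := rtime l; set u := _ ^ l; nia.
Qed.

(** The final state is a fixed point of [cstep], so the exact running time may be replaced by a
    closed upper bound as the number of iterations. *)
Lemma rch_iter x y : x < N -> y < N ->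
  hd (iter ((4 * N + 1) ^ D) cstep (mkst 0 x y D 0)) = 1 + rch D x y.
Proof.
move=> hx hy.
have [|t ht e] := @calls_rch D x y 0 (leqnn _) hx hy.
  by rewrite expn_gt0 base_gt0.
set r := mkst (1 + _) x y D 0 in e.
have m2 : 1 + rch D x y <= 2 by case: rch.
have hr : hd r = 1 + rch D x y by rewrite hd_cn //; bs.
have fix_r : cstep r = r.
  apply: (@cstep_eq _ _ (0 + 4)); last lia.
    have e2 : tl (tl (tl r)) = cn D 0 by rewrite !tl_cn //; bs.
    by rewrite /step hr e2 hd_cn ?eqxx //=; bs.
  by apply: mkst_lt => //; bs.
have it k : iter k cstep r = r by elim: k => //= k ->.
have le : t <= (4 * N + 1) ^ D by apply: leq_trans ht (rtime_le D).
by rewrite -(subnK le) iterD e it hr.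
Qed.

Lemma rch_path d x p : x < N -> path (fun a b => (b < N) && E a b) x p ->
  size p <= 2 ^ d -> rch d x (last x p).
Proof.
elim: d x p => [|d IH] x p hx.
  case: p => [|y [|z p]] //=; first by rewrite eqxx.
  by rewrite andbT => /andP[_ ->]; rewrite orbT.
move=> hp hs /=; set m := last x (take (2 ^ d) p).
move: hp; rewrite -{1}(cat_take_drop (2 ^ d) p) cat_path -/m => /andP[p1 p2].
have mN : m < N.
  rewrite /m; elim: (take _ p) (x) hx p1 => //= a q IHq b _ /andP[/andP[ha _]].
  exact: IHq.
apply/hasP; exists m; first by rewrite mem_iota.
rewrite (IH x) //=; last first.
  by rewrite size_take; case: ltnP.
rewrite -(cat_take_drop (2 ^ d) p) last_cat -/m; apply: IH => //.
by rewrite size_drop; move: hs; rewrite expnS; lia.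
Qed.

(** Soundness is phrased through properties closed under edges; the application supplies an
    invariant, and no path has to be extracted. *)
Lemma rch_sound d x y (P : nat -> Prop) : (forall a b, b < N -> P a -> E a b -> P b) ->
  x < N -> y < N -> rch d x y -> P x -> P y.
Proof.
move=> hE; elim: d x y => [|d IH] x y hx hy /=.
  by case/orP=> [/eqP-> //|h] Px; apply: (hE x).
case/hasP=> z; rewrite mem_iota /= add0n => hz /andP[h1 h2] Px.
by apply: (IH z y) => //; apply: (IH x z).
Qed.

End Savitch.

Section SavitchFeasible.
Variables (E : env -> nat -> nat -> bool) (N D x y : env -> nat).
Hypothesis fE : PS (fun e => E (fun j => e j.+2) (e 0) (e 1)).
Hypothesis fN : PS N.
Hypothesis fD : PS D.
Hypothesis sD : small_fun D.
Hypothesis fx : PS x.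
Hypothesis fy : PS y.

Lemma f_base xi : PS (fun e => base (N (fun j => e (xi j))) (D (fun j => e (xi j)))).
Proof. by rewrite /base; feas. Qed.

Lemma f_stlim : PS (fun e => stlim (N e) (D e)).
Proof.
apply: f_pow; [exact: (f_base id) | feas |].
by do !apply: small_fun_add; rewrite //; exact: small_fun_const.
Qed.

Lemma f_cn xi a s : PS a -> PS s ->
  PS (fun e => cn (N (fun j => e (xi j))) (D (fun j => e (xi j))) (a e) (s e)).
Proof. by move=> fa fs; rewrite /cn; apply: f_add => //; apply: f_mul => //; apply: f_base. Qed.

Lemma f_hd xi s : PS s ->
  PS (fun e => hd (N (fun j => e (xi j))) (D (fun j => e (xi j))) (s e)).
Proof. by move=> fs; apply: f_mod => //; apply: f_base. Qed.

Lemma f_tl xi s : PS s ->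
  PS (fun e => tl (N (fun j => e (xi j))) (D (fun j => e (xi j))) (s e)).
Proof. by move=> fs; apply: f_div => //; apply: f_base. Qed.

Lemma f_mkst xi a b c d s : PS a -> PS b -> PS c -> PS d -> PS s ->
  PS (fun e => mkst (N (fun j => e (xi j))) (D (fun j => e (xi j))) (a e) (b e) (c e) (d e) (s e)).
Proof. by move=> *; do 4!apply: f_cn => //. Qed.

Ltac savitch_feas fE fN fD := lazymatch goal with
  | |- feasible _ (fun e => mkst _ _ (@?a e) (@?b e) (@?c e) (@?d e) (@?s e)) =>
      apply (@f_mkst succn a b c d s); savitch_feas fE fN fD
  | |- feasible _ (fun e => hd _ _ (@?a e)) => apply (@f_hd succn a); savitch_feas fE fN fD
  | |- feasible _ (fun e => tl _ _ (@?a e)) => apply (@f_tl succn a); savitch_feas fE fN fD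
  | |- feasible _ (fun e => nat_of_bool (eq_op (@?a e) (@?b e))) =>
      apply (@f_eq _ _ a b); savitch_feas fE fN fD
  | |- feasible _ (fun e => nat_of_bool (leq (@?a e) (@?b e))) =>
      apply (@f_leq _ _ a b); savitch_feas fE fN fD
  | |- feasible _ (fun e => nat_of_bool (orb (@?a e) (@?b e))) =>
      apply (@f_or _ _ a b); savitch_feas fE fN fD
  | |- feasible _ (fun e => nat_of_bool (E _ (@?a e) (@?b e))) =>
      apply (fE succn a b); savitch_feas fE fN fD
  | |- feasible _ (fun e => addn (@?a e) (@?b e)) => apply (@f_add _ _ a b); savitch_feas fE fN fD
  | |- feasible _ (fun e => predn (@?a e)) => apply (@f_pred _ _ a); savitch_feas fE fN fD
  | |- feasible _ (fun e => e _) => apply: f_var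
  | |- feasible _ (fun e => N _) => exact (fN succn)
  | |- feasible _ (fun e => D _) => exact (fD succn)
  | |- feasible _ (fun e => S (@?a e)) =>
      first [apply: f_const | apply (@f_succ _ _ a); savitch_feas fE fN fD]
  | _ => apply: f_const
  end.

Lemma f_step : feasible1 (expn 2) (fun e st => step (E e) (N e) (D e) st).
Proof.
have fE' (xi : nat -> nat) a b : PS a -> PS b ->
    PS (fun e => E (fun j => e (xi j)) (a e) (b e)).
  move=> fa fb; apply: (@f_app2 _ _ (fun e a b => E (fun j => e (xi j)) a b)) => //.
  exact: (@f_ren _ (fun j => match j with 0 => 0 | 1 => 1 | j'.+2 => (xi j').+2 end) _ fE).
have fN' (xi : nat -> nat) : PS (fun e => N (fun j => e (xi j))) by exact: f_ren.
have fD' (xi : nat -> nat) : PS (fun e => D (fun j => e (xi j))) by exact: f_ren.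
rewrite /feasible1 /step; cbv zeta beta.
refine (f_if _ (f_if _ _ _) (f_if _ _ (f_if _ (f_if _ _ _) (f_if _ _ _)))).
all: savitch_feas fE' fN' fD'.
Qed.

Lemma f_cstep : feasible1 (expn 2) (fun e st => cstep (E e) (N e) (D e) st).
Proof.
rewrite /feasible1 /cstep; apply: f_if; [apply: f_leq | | exact: f_const].
- exact/f_succ/f_step.
- exact: (@f_ren _ succn _ f_stlim).
exact: f_step.
Qed.

Lemma f_rch : (forall e, x e < N e) -> (forall e, y e < N e) ->
  PS (fun e => rch (E e) (N e) (D e) (x e) (y e)).
Proof.
move=> hx hy.
apply: (@f_ext _ (fun e => hd (N e) (D e)
  (iter ((4 * N e + 1) ^ D e) (cstep (E e) (N e) (D e)) (mkst (N e) (D e) 0 (x e) (y e) (D e) 0)) == 2)).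
  by move=> e; rewrite rch_iter //; case: rch.
apply: f_eq; last exact: f_const.
(* Every iterate but the initial one is truncated below [stlim], hence the second summand of the
   bound. *)
apply: (f_hd id); apply: (f_iter (b := fun e => stlim (N e) (D e) + mkst (N e) (D e) 0 (x e) (y e) (D e) 0)).
- by apply: f_pow => //; feas.
- by apply: (f_mkst id) => //; exact: f_const.
- exact: f_cstep.
- by apply: f_add; [exact: f_stlim | apply: (f_mkst id) => //; exact: f_const].
move=> e [|k] _; first exact: leq_addl.
rewrite iterS /cstep; case: ifP => // /ltnW h; exact: leq_trans h (leq_addr _ _).
Qed.

End SavitchFeasible.

(** * Reading the encoding of a timed automaton *)

Lemma find_iotaE (P : pred nat) n k : k < n -> P k -> (forall i, i < k -> ~~ P i) ->
  find P (iota 0 n) = k.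
Proof.
move=> kn Pk hk; have hs : has P (iota 0 n) by apply/hasP; exists k; rewrite ?mem_iota.
apply/eqP; rewrite eqn_leq; apply/andP; split.
  rewrite leqNgt; apply/negP => lt; have := before_find 0 lt.
  by rewrite nth_iota // Pk.
rewrite leqNgt; apply/negP => lt; have := nth_find 0 hs.
rewrite nth_iota ?add0n; last by rewrite has_find size_iota in hs.
by apply/negP; apply: hk.
Qed.

Definition bit (W i : nat) : bool := odd (W %/ 2 ^ i).

Section Parsers.
Variables (iend : nat -> nat) (W p : nat).

(* [iend] maps the position of an item to the position after it; the
   truncation by [W] only serves to bound the values for arbitrary inputs. *)
Definition nxt (q : nat) : nat := if bit W q then minn (iend q.+1) W else q.
Definition pos (i : nat) : nat := iter i nxt p.
Definition cnt : nat := find (fun i => ~~ bit W (pos i)) (iota 0 W).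
Definition send : nat := (pos cnt).+1.
Definition item (i : nat) : nat := (pos i).+1.

Lemma pos_le i : pos i <= p + W.
Proof.
elim: i => [|i IH]; first exact: leq_addr.
by rewrite /pos iterS -/(pos i) /nxt; case: ifP => // _; rewrite geq_min leq_addl orbT.
Qed.

End Parsers.

Definition nend (W p : nat) : nat := send succn W p.
(** Decoding is a search for the least number whose binary digits agree with the listed ones; any
    other solution differs only in higher digits. *)
Definition nval (W p : nat) : nat :=
  find (fun v => all (fun i => bit v i == bit W (item succn W p i)) (iota 0 (cnt succn W p)))
    (iota 0 W).
(** Positions follow the layout of [code_ta]. The prefixes a, c and e refer to atoms, constraints
    and edges; for an edge starting at [p], its label, resets and target start at [elab], [ereset]
    and [etgt]. The prefix p marks the starts of the sections of the whole code. *)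
Definition aend (W p : nat) : nat := nend W (nend W (nend W p)).
Definition cend (W p : nat) : nat := send (aend W) W p.
Definition elab (W p : nat) : nat := cend W (nend W p).
Definition ereset (W p : nat) : nat :=
  if bit W (elab W p) then nend W (elab W p).+1 else (elab W p).+1.
Definition etgt (W p : nat) : nat := send (nend W) W (ereset W p).
Definition eend (W p : nat) : nat := nend W (etgt W p).
Definition nclk (W : nat) : nat := cnt id W 0.
Definition pact (W : nat) : nat := send id W 0.
Definition ploc (W : nat) : nat := send succn W (pact W).
Definition pini (W : nat) : nat := send (cend W) W (ploc W).
Definition pedg (W : nat) : nat := nend W (pini W).
Definition pinv (W q : nat) : nat := item (cend W) W (ploc W) q.
Definition nedg (W : nat) : nat := cnt (eend W) W (pedg W).
Definition edgp (W j : nat) : nat := item (eend W) W (pedg W) j.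
Definition inreset (W p x : nat) : bool :=
  has (fun i => nval W (item (nend W) W (ereset W p) i) == x)
    (iota 0 (cnt (nend W) W (ereset W p))).

(** * Feasibility of the parser *)

Section Feasibility.
Variables (L : nat -> nat).
Context {hL : limit L}.
Notation feasible := (feasible L).

Lemma f_bit a b : feasible a -> feasible b -> feasible (fun e => bit (a e) (b e)).
Proof. by move=> fa fb; rewrite /bit; feas. Qed.

Section Items.
Variables (iend : env -> nat -> nat) (W p : env -> nat).
Hypothesis fi : feasible1 L iend.
Hypothesis fW : feasible W.
Hypothesis fp : feasible p.

Lemma f_pos i : feasible i -> feasible (fun e => pos (iend e) (W e) (p e) (i e)).
Proof.
move=> fi'; apply: (f_iter (b := fun e => p e + W e)) => //; last first.
  by move=> e k _; apply: pos_le.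
  by feas.
rewrite /feasible1 /nxt; apply: f_if; [apply: f_bit; feas | | feas].
apply: f_minn; last by feas.
apply: (@f_app1 _ _ (fun e => iend (fun j => e j.+1)) (fun e => (e 0).+1)); last by feas.
exact: (@f_ren _ (fun j => if j is j'.+1 then j'.+2 else 0) _ fi).
Qed.

End Items.

Section Items2.
Variables (iend : env -> nat -> nat) (W p : env -> nat).
Hypothesis fi : feasible1 L iend.
Hypothesis fW : feasible W.
Hypothesis fp : feasible p.

Lemma f_cnt : feasible (fun e => cnt (iend e) (W e) (p e)).
Proof.
rewrite /cnt; apply: f_find => //; rewrite /feasible1; apply: f_neg; apply: f_bit; first by feas.
apply: (@f_pos (fun e => iend (fun j => e j.+1)) (fun e => W (fun j => e j.+1))
  (fun e => p (fun j => e j.+1))); try by feas.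
exact: (@f_ren _ (fun j => if j is j'.+1 then j'.+2 else 0) _ fi).
Qed.

Lemma f_send : feasible (fun e => send (iend e) (W e) (p e)).
Proof. by apply: f_succ; apply: f_pos => //; apply: f_cnt. Qed.

Lemma f_item i : feasible i -> feasible (fun e => item (iend e) (W e) (p e) (i e)).
Proof. by move=> ?; apply: f_succ; apply: f_pos. Qed.

End Items2.

Section Fixed.
Variables (W p : env -> nat).
Hypothesis fW : feasible W.
Hypothesis fp : feasible p.

Lemma f_succ1 : feasible1 L (fun _ => succn).
Proof. by rewrite /feasible1; feas. Qed.

Lemma f_nend : feasible (fun e => nend (W e) (p e)).
Proof. by apply: f_send => //; apply: f_succ1. Qed.

Lemma f_nval : feasible (fun e => nval (W e) (p e)).
Proof.
rewrite /nval; apply: f_find => //; rewrite /feasible1; apply: f_all.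
  by apply: (@f_cnt (fun _ => succn) (fun e => W (fun j => e j.+1)) (fun e => p (fun j => e j.+1)));
    [exact: f_succ1 | feas ..].
rewrite /feasible1; apply: f_eqb; apply: f_bit; try by feas.
by apply: (@f_item (fun _ => succn) (fun e => W (fun j => e j.+2)) (fun e => p (fun j => e j.+2)));
    [exact: f_succ1 | feas ..].
Qed.

End Fixed.

Lemma f_nend1 W : feasible W -> feasible1 L (fun e => nend (W e)).
Proof. by move=> fW; apply: f_nend; feas. Qed.

Lemma f_aend W p : feasible W -> feasible p -> feasible (fun e => aend (W e) (p e)).
Proof. by move=> fW fp; do 3!apply: f_nend => //. Qed.

Lemma f_aend1 W : feasible W -> feasible1 L (fun e => aend (W e)).
Proof. by move=> fW; apply: f_aend; feas. Qed.

Lemma f_cend W p : feasible W -> feasible p -> feasible (fun e => cend (W e) (p e)).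
Proof. by move=> fW fp; apply: f_send => //; apply: f_aend1. Qed.

Lemma f_cend1 W : feasible W -> feasible1 L (fun e => cend (W e)).
Proof. by move=> fW; apply: f_cend; feas. Qed.

Lemma f_elab W p : feasible W -> feasible p -> feasible (fun e => elab (W e) (p e)).
Proof. by move=> fW fp; apply: f_cend => //; apply: f_nend. Qed.

Lemma f_ereset W p : feasible W -> feasible p -> feasible (fun e => ereset (W e) (p e)).
Proof.
move=> fW fp; have fl := f_elab fW fp; apply: f_if; first exact: f_bit.
  by apply: f_nend => //; apply: f_succ.
exact: f_succ.
Qed.

Lemma f_etgt W p : feasible W -> feasible p -> feasible (fun e => etgt (W e) (p e)).
Proof. by move=> fW fp; apply: f_send => //; [apply: f_nend1 | apply: f_ereset]. Qed.

Lemma f_eend W p : feasible W -> feasible p -> feasible (fun e => eend (W e) (p e)).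
Proof. by move=> fW fp; apply: f_nend => //; apply: f_etgt. Qed.

Lemma f_eend1 W : feasible W -> feasible1 L (fun e => eend (W e)).
Proof. by move=> fW; apply: f_eend; feas. Qed.

Lemma f_id1 : feasible1 L (fun _ => id).
Proof. by rewrite /feasible1; feas. Qed.

Lemma f_nclk W : feasible W -> feasible (fun e => nclk (W e)).
Proof. by move=> fW; apply: f_cnt => //; [exact: f_id1 | exact: f_const]. Qed.

Lemma f_pact W : feasible W -> feasible (fun e => pact (W e)).
Proof. by move=> fW; apply: f_send => //; [exact: f_id1 | exact: f_const]. Qed.

Lemma f_ploc W : feasible W -> feasible (fun e => ploc (W e)).
Proof. by move=> fW; apply: f_send => //; [exact: f_succ1 | exact: f_pact]. Qed.

Lemma f_pini W : feasible W -> feasible (fun e => pini (W e)).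
Proof. by move=> fW; apply: f_send => //; [exact: f_cend1 | exact: f_ploc]. Qed.

Lemma f_pedg W : feasible W -> feasible (fun e => pedg (W e)).
Proof. by move=> fW; apply: f_nend => //; exact: f_pini. Qed.

Lemma f_pinv W q : feasible W -> feasible q -> feasible (fun e => pinv (W e) (q e)).
Proof. by move=> fW fq; apply: f_item => //; [exact: f_cend1 | exact: f_ploc]. Qed.

Lemma f_nedg W : feasible W -> feasible (fun e => nedg (W e)).
Proof. by move=> fW; apply: f_cnt => //; [exact: f_eend1 | exact: f_pedg]. Qed.

Lemma f_edgp W j : feasible W -> feasible j -> feasible (fun e => edgp (W e) (j e)).
Proof. by move=> fW fj; apply: f_item => //; [exact: f_eend1 | exact: f_pedg]. Qed.

Lemma f_inreset W p x : feasible W -> feasible p -> feasible x ->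
  feasible (fun e => inreset (W e) (p e) (x e)).
Proof.
move=> fW fp fx; rewrite /inreset; apply: f_has.
  by apply: f_cnt => //; [exact: f_nend1 | exact: f_ereset].
rewrite /feasible1; apply: f_eq; last by feas.
apply: f_nval; first by feas.
apply: (@f_item (fun e => nend (W (fun j => e j.+1))) (fun e => W (fun j => e j.+1))
  (fun e => ereset (W (fun j => e j.+1)) (p (fun j => e j.+1)))).
- by apply: f_nend1; feas.
- by feas.
- by apply: f_ereset; feas.
by feas.
Qed.

End Feasibility.

Ltac feas_hook ::= lazymatch goal with
  | |- feasible _ (fun e => nat_of_bool (bit (@?a e) (@?b e))) => apply (@f_bit _ _ a b)
  | |- feasible _ (fun e => nat_of_bool (inreset (@?a e) (@?b e) (@?c e))) => apply (@f_inreset _ _ a b c)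
  | |- feasible _ (fun e => nend (@?a e) (@?b e)) => apply (@f_nend _ _ a b)
  | |- feasible _ (fun e => nval (@?a e) (@?b e)) => apply (@f_nval _ _ a b)
  | |- feasible _ (fun e => elab (@?a e) (@?b e)) => apply (@f_elab _ _ a b)
  | |- feasible _ (fun e => ereset (@?a e) (@?b e)) => apply (@f_ereset _ _ a b)
  | |- feasible _ (fun e => etgt (@?a e) (@?b e)) => apply (@f_etgt _ _ a b)
  | |- feasible _ (fun e => nclk (@?a e)) => apply (@f_nclk _ _ a)
  | |- feasible _ (fun e => pact (@?a e)) => apply (@f_pact _ _ a)
  | |- feasible _ (fun e => pini (@?a e)) => apply (@f_pini _ _ a)
  | |- feasible _ (fun e => nedg (@?a e)) => apply (@f_nedg _ _ a)
  | |- feasible _ (fun e => pinv (@?a e) (@?b e)) => apply (@f_pinv _ _ a b)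
  | |- feasible _ (fun e => edgp (@?a e) (@?b e)) => apply (@f_edgp _ _ a b)
  | |- feasible _ (fun e => item succn (@?a e) (@?b e) (@?i e)) =>
      apply (@f_item _ _ (fun _ => succn) a b (@f_succ1 _ _))
  | |- feasible _ (fun e => cnt (aend _) (@?a e) (@?b e)) =>
      apply (@f_cnt _ _ (fun e => aend (a e)) a b); [apply: f_aend1 | | ]
  | |- feasible _ (fun e => item (aend _) (@?a e) (@?b e) (@?i e)) =>
      apply (@f_item _ _ (fun e => aend (a e)) a b); [apply: f_aend1 | | |]
  end.

(** * Correctness of the parser on codes of automata *)

Lemma code_seq_cons (T : Type) (f : T -> seq bool) x s :
  code_seq f (x :: s) = true :: f x ++ code_seq f s.
Proof. by rewrite /code_seq /= catA. Qed.

Lemma size_code_seq (T : Type) (f : T -> seq bool) s : size s < size (code_seq f s).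
Proof. by elim: s => // x s IH; rewrite code_seq_cons /= size_cat; lia. Qed.

Section Correctness.
Variables (w : seq bool) (W : nat).

Definition occurs (p : nat) (u : seq bool) :=
  exists pre post, w = pre ++ u ++ post /\ size pre = p.

Lemma occurs_catl p u v : occurs p (u ++ v) -> occurs p u.
Proof. by move=> [pre [post [e <-]]]; exists pre, (v ++ post); rewrite e -catA. Qed.

Lemma occurs_catr p u v : occurs p (u ++ v) -> occurs (p + size u) v.
Proof.
move=> [pre [post [e <-]]]; exists (pre ++ u), post.
by rewrite size_cat e -!catA.
Qed.

Lemma occurs_behead p b u : occurs p (b :: u) -> occurs p.+1 u.
Proof. by rewrite -cat1s => /occurs_catr; rewrite addn1. Qed.

Lemma occurs_size p u : occurs p u -> p + size u <= size w.
Proof. by move=> [pre [post [-> <-]]]; rewrite !size_cat; lia. Qed.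

Hypothesis Wbit : forall i, i < size w -> bit W i = nth false w i.
Hypothesis Wsize : 2 ^ size w <= W.

Lemma occurs_bit p b u : occurs p (b :: u) -> bit W p = b.
Proof.
move=> [pre [post [e <-]]]; rewrite Wbit e ?nth_cat ?ltnn ?subnn //.
by rewrite !size_cat /=; lia.
Qed.

Lemma size_lt_W : size w < W.
Proof. by apply: leq_trans Wsize; apply: ltn_expl. Qed.

Section Seq.
Variables (T : Type) (f : T -> seq bool) (iend : nat -> nat).
Hypothesis iendP : forall p x, occurs p (f x) -> iend p = p + size (f x).

Lemma pos_code p s : occurs p (code_seq f s) ->
  [/\ forall x0 i, i < size s ->
        bit W (pos iend W p i) = true /\ occurs (pos iend W p i).+1 (f (nth x0 s i)),
      bit W (pos iend W p (size s)) = false &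
      (pos iend W p (size s)).+1 = p + size (code_seq f s)].
Proof.
elim: s p => [|x s IH] p.
  by move=> /occurs_bit h; split; rewrite ?h // addn1.
rewrite code_seq_cons => oc.
have b1 := occurs_bit oc; have o1 := occurs_catl (occurs_behead oc).
have o2 := occurs_catr (occurs_behead oc).
have n1 : nxt iend W p = p.+1 + size (f x).
  rewrite /nxt b1 (iendP o1); apply/minn_idPl.
  exact: leq_trans (occurs_size o1) (ltnW size_lt_W).
have pS i : pos iend W p i.+1 = pos iend W (p.+1 + size (f x)) i by rewrite /pos iterSr n1.
have [h1 h2 h3] := IH _ o2; split.
- by move=> x0 [|i] hi; [rewrite /pos /= | rewrite pS /=; apply: h1].
- by rewrite pS.
by rewrite pS h3 /= size_cat; lia.
Qed.

Lemma cnt_code p s : occurs p (code_seq f s) -> cnt iend W p = size s.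
Proof.
move=> oc; have [h1 h2 h3] := pos_code oc; apply: find_iotaE; last 2 first.
- by rewrite h2.
- case: s {oc h2 h3} h1 => // x s h1 i hi; rewrite (h1 x i hi).1 //.
apply: leq_ltn_trans size_lt_W; apply: leq_trans (occurs_size oc).
by have := size_code_seq f s; lia.
Qed.

Lemma send_code p s : occurs p (code_seq f s) -> send iend W p = p + size (code_seq f s).
Proof. by move=> oc; rewrite /send (cnt_code oc); case: (pos_code oc). Qed.

Lemma item_code x0 p s i : occurs p (code_seq f s) -> i < size s ->
  occurs (item iend W p i) (f (nth x0 s i)).
Proof. by move=> oc hi; have [h1 _ _] := pos_code oc; have [] := h1 x0 i hi. Qed.

End Seq.

Lemma bit_succP p (b : bool) : occurs p [:: b] -> p.+1 = p + size [:: b].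
Proof. by rewrite addn1. Qed.

Lemma nendP p n : occurs p (code_nat n) -> nend W p = p + size (code_nat n).
Proof. exact: (send_code (iend := succn) bit_succP). Qed.

Lemma bits_inj k m n : m < 2 ^ k -> n < 2 ^ k ->
  (forall i, i < k -> bit m i = bit n i) -> m = n.
Proof.
elim: k m n => [|k IH] m n; first by rewrite expn0; lia.
rewrite expnS => hm hn h.
have h0 := h 0 isT; rewrite /bit !divn1 in h0.
have : m %/ 2 = n %/ 2.
  apply: IH; [by rewrite ltn_divLR // mulnC | by rewrite ltn_divLR // mulnC |].
  by move=> i hi; have := h i.+1 hi; rewrite /bit expnS !divnMA.
by rewrite !divn2 => h1; rewrite -(odd_double_half m) -(odd_double_half n) h0 h1.
Qed.

Lemma nvalP p n : occurs p (code_nat n) -> nval W p = n.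
Proof.
move=> oc; rewrite /nval (cnt_code (iend := succn) bit_succP oc) size_mkseq.
set l := trunc_log 2 n.
have nl : n < 2 ^ l.+1.
  by rewrite /l; case: (posnP n) => [->//|h]; rewrite trunc_log_ltn.
have lw : l.+1 <= size w.
  have h := size_code_seq (fun b : bool => [:: b]) (mkseq (fun i => odd (n %/ 2 ^ i)) l.+1).
  by have := occurs_size oc; rewrite size_mkseq in h; rewrite /code_nat -/l; lia.
have itm i : i < l.+1 -> bit W (item succn W p i) = bit n i.
  move=> hi; have hs : i < size (mkseq (fun i => odd (n %/ 2 ^ i)) l.+1) by rewrite size_mkseq.
  have := item_code (iend := succn) bit_succP false oc hs.
  by rewrite nth_mkseq // => /occurs_bit.
apply: find_iotaE.
(* The range of the search is large enough: the digits of [n] occur in [w], and [W] is at least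
   [2 ^ size w]. *)
- apply: leq_trans nl _; apply: leq_trans Wsize; rewrite leq_exp2l //.
- by apply/allP => i; rewrite mem_iota => /andP[_ hi]; rewrite itm.
move=> v hv; apply/negP => /allP h; suff e : v = n by rewrite e ltnn in hv.
apply: (@bits_inj l.+1) => //; first exact: ltn_trans hv nl.
by move=> i hi; rewrite -(itm i hi); apply/eqP; apply: h; rewrite mem_iota.
Qed.

Section Automaton.
Variables (Q X S : finType).
Variables (A : timed_automaton Q X S) (high : {set S}).
Hypothesis wE : w = code_ta A high.

Definition code_atom (a : X * cmp * nat) : seq bool :=
  let: (x, o, c) := a in code_elt x ++ code_nat (nat_of_cmp o) ++ code_nat c.

Lemma aendP p a : occurs p (code_atom a) -> aend W p = p + size (code_atom a).
Proof.
case: a => [[x o] c] oc; rewrite /aend.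
rewrite (nendP (occurs_catl oc)) (nendP (occurs_catl (occurs_catr oc))).
by rewrite (nendP (occurs_catr (occurs_catr oc))) /code_atom !size_cat; lia.
Qed.

Lemma cendP p (g : constraint X) : occurs p (code_constraint g) ->
  cend W p = p + size (code_constraint g).
Proof. exact: (send_code aendP). Qed.

Lemma edge_fields p (q q' : Q) (g : constraint X) (a : option S) (r : {set X}) :
  occurs p (code_edge (q, g, a, r, q')) ->
  [/\ nval W p = enum_rank q, occurs (nend W p) (code_constraint g),
      (forall b, a = Some b -> nval W (elab W p).+1 = enum_rank b),
      (forall x : X, inreset W p (enum_rank x) = (x \in r)) &
      nval W (etgt W p) = enum_rank q' /\
      eend W p = p + size (code_edge (q, g, a, r, q'))].
Proof.
move=> oc; rewrite /code_edge in oc.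
have o1 := occurs_catl oc; have t1 := occurs_catr oc.
rewrite -(nendP o1) in t1; have o2 := occurs_catl t1; have t2 := occurs_catr t1.
rewrite -(cendP o2) -/(elab W p) in t2.
have t4 := occurs_catr t2; have o3 := occurs_catl t2.
have rE : ereset W p = elab W p + size (code_label a).
  rewrite /ereset; case: a o3 {oc t1 t2 t4} => [b|] o3; rewrite (occurs_bit o3); last first.
    by rewrite addn1.
  have o3' : occurs (elab W p).+1 (code_elt b) by exact: (occurs_behead o3).
  by rewrite (nendP o3') addSnnS.
rewrite -rE in t4.
have o4 := occurs_catl t4; have t5 := occurs_catr t4.
have nP (k : nat) (x : X) : occurs k (code_elt x) -> nend W k = k + size (code_elt x).
  exact: nendP.
have eT := send_code nP o4; rewrite -/(etgt W p) in eT; rewrite -eT in t5.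
split.
- exact: nvalP o1.
- exact: o2.
- move=> b ab; rewrite ab in o3; apply: nvalP; exact: (occurs_behead o3).
- move=> x; rewrite /inreset (cnt_code nP o4) -[in RHS]mem_enum.
  apply/hasP/idP => [[i]|xr].
    rewrite mem_iota => /andP[_ hi]; rewrite (nvalP (item_code nP x o4 hi)).
    by rewrite val_eqE => /eqP/enum_rank_inj <-; apply: mem_nth.
  exists (index x (enum r)); first by rewrite mem_iota /= index_mem.
  rewrite (nvalP (item_code nP x o4 _)) ?index_mem //.
  by rewrite nth_index.
split; first exact: nvalP t5.
by rewrite /eend (nendP t5) eT rE /elab (cendP o2) (nendP o1) /code_edge !size_cat; lia.
Qed.

Lemma eendP p (e : edge Q X S) : occurs p (code_edge e) -> eend W p = p + size (code_edge e).
Proof. by case: e => [[[[q g] a] r] q'] /edge_fields[_ _ _ _ []]. Qed.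

Lemma enum_rank_nth (T : finType) (x0 x : T) : nth x0 (enum T) (enum_rank x) = x.
Proof. exact: nth_enum_rank. Qed.

Lemma enum_rank_lt_card (T : finType) (x : T) : enum_rank x < #|T|.
Proof. exact: ltn_ord. Qed.

Lemma enum_rank_lt_size (T : finType) (x : T) : enum_rank x < size (enum T).
Proof. by rewrite -cardE; apply: ltn_ord. Qed.

Lemma ta_fields :
  [/\ nclk W = #|X|, nval W (pini W) = enum_rank (ta_init A),
      (forall q, occurs (pinv W (enum_rank q)) (code_constraint (ta_inv A q))) &
      (forall a, bit W (item succn W (pact W) (enum_rank a)) = (a \in high))] /\
  nedg W = size (ta_edges A) /\
  forall e0 j, j < size (ta_edges A) -> occurs (edgp W j) (code_edge (nth e0 (ta_edges A) j)).
Proof.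
have oc : occurs 0 (code_ta A high) by exists [::], [::]; rewrite cats0 wE.
have o1 := occurs_catl oc; have t1 := occurs_catr oc.
have iP (k : nat) (x : X) : occurs k [::] -> id k = k + size ([::] : seq bool).
  by rewrite addn0.
rewrite -(send_code iP o1) -/(pact W) in t1.
have o2 := occurs_catl t1; have t2 := occurs_catr t1.
have sP (k : nat) (x : S) : occurs k [:: x \in high] -> k.+1 = k + size [:: x \in high].
  by rewrite addn1.
rewrite -(send_code sP o2) -/(ploc W) in t2.
have o3 := occurs_catl t2; have t3 := occurs_catr t2.
have cP (k : nat) (q : Q) : occurs k (code_constraint (ta_inv A q)) ->
  cend W k = k + size (code_constraint (ta_inv A q)) by exact: cendP.
rewrite -(send_code cP o3) -/(pini W) in t3.
have o4 := occurs_catl t3; have t4 := occurs_catr t3.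
rewrite -(nendP o4) -/(pedg W) in t4.
split; first split.
- by rewrite /nclk (cnt_code iP o1) cardE.
- exact: nvalP o4.
- by move=> q; have := item_code cP q o3 (enum_rank_lt_size q); rewrite enum_rank_nth.
- move=> a; have := item_code sP a o2 (enum_rank_lt_size a); rewrite enum_rank_nth.
  exact: occurs_bit.
split; first exact: (cnt_code eendP t4).
by move=> e0 j hj; apply: (item_code eendP e0 t4).
Qed.

End Automaton.
End Correctness.

Import Order.TTheory GRing.Theory Num.Theory.

(** * Regions *)

Section Regions.
Local Open Scope ring_scope.
Variables (R : realType) (T : finType).

(* [u] represents [z] at granularity [1 / g]: the two families have the same
   integral comparisons between differences of coordinates. *)
Definition represents (g : nat) (z : T -> R) (u : T -> int) :=
  forall x y (n : int), (z x - z y <= n%:~R) = (u x - u y <= n * g%:Z).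

(** Take [g] times the integral part plus the rank of the fractional part among all of them. There
    are at most [#|T|] ranks, so they stay below [g]; an integral coordinate has the least
    fractional part, hence rank 0. *)
Lemma represents_exists g z : (#|T| <= g)%N ->
  exists2 u : T -> int, represents g z u &
    forall x (n : int), z x = n%:~R -> u x = n * g%:Z.
Proof.
move=> gT; pose fl x : int := Num.floor (z x).
have flP x : (fl x)%:~R <= z x < (fl x)%:~R + 1.
  by rewrite floor_le_tmp /= -[1]/(1%:~R) -intrD floorD1_gt.
pose f x := z x - (fl x)%:~R.
have f01 x : 0 <= f x < 1 by have := flP x; rewrite /f => /andP[h1 h2]; apply/andP; split; lra.
pose rho x := #|[set y | f y < f x]|.
have rg x : (rho x < g)%N.
  apply: leq_trans gT; rewrite -cardsT; apply: proper_card; apply/properP; split.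
    exact: finset.subsetT.
  by exists x; rewrite ?inE ?ltxx.
have rle x y : (rho x <= rho y)%N = (f x <= f y).
  case: (leP (f x) (f y)) => h.
    apply: subset_leq_card; apply/fintype.subsetP => t; rewrite !inE => ht.
    exact: lt_le_trans ht h.
  apply/negbTE; rewrite -ltnNge; apply: proper_card; apply/properP; split.
    by apply/fintype.subsetP => t; rewrite !inE => ht; apply: lt_trans ht h.
  by exists y; rewrite !inE ?ltxx.
exists (fun x => fl x * g%:Z + (rho x)%:Z).
  move=> x y n; have := rle x y; have := rg x; have := rg y.
  have [a aE] : exists a, fl x = a + fl y + n by exists (fl x - fl y - n); lia.
  have zE t : z t = (fl t)%:~R + f t by rewrite /f; lra.
  rewrite (zE x) (zE y) aE !rmorphD /=.
  have /andP[x0 x1] := f01 x; have /andP[y0 y1] := f01 y.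
  move=> ry rx h; case: (ltgtP a 0) => ha.
  - have ha' : a%:~R <= -1 :> R by rewrite -[-1]/((-1)%:~R) ler_int; lia.
    transitivity true; first by apply/idP; lra.
    apply/esym/idP; have : a * g%:Z <= - g%:Z by nia.
    by lia.
  - have ha' : 1 <= a%:~R :> R by rewrite -[1]/(1%:~R) ler_int; lia.
    transitivity false; first by apply/negbTE; rewrite -ltNge; lra.
    apply/esym/negbTE; rewrite -ltNge; have : g%:Z <= a * g%:Z by nia.
    by lia.
  rewrite ha; transitivity (f x <= f y); first by apply/idP/idP; lra.
  by rewrite -h; apply/idP/idP; lia.
move=> x n zx; have e : fl x = n by rewrite /fl zx; apply: floor_def; rewrite lexx ltr_int; lia.
have f0 : f x = 0 by rewrite /f zx e subrr.
rewrite e (_ : rho x = 0%N) ?addr0 //; apply/eqP; rewrite cards_eq0; apply/eqP/setP => y.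
by rewrite !inE f0; apply/negbTE; rewrite -leNgt; have /andP[] := f01 y.
Qed.

(** If some [u x + del] is a multiple of [g], then [z x + d] must be the corresponding integer,
    which determines [d]. Otherwise [d] has to lie strictly between [l x] and [l x + 1] for all [x],
    where [l x] brings [z x] to its integral part after the delay. These open intervals have a
    common point because the [l x] differ by less than 1, and the middle of the intersection is
    chosen. The zero coordinate gives [0 <= d]. *)
Lemma represents_delay g z u (x0 : T) (del : int) : (0 < g)%N -> represents g z u ->
  z x0 = 0 -> u x0 = 0 -> 0 <= del ->
  exists2 d : R, 0 <= d & forall x (n : int),
    ((z x + d <= n%:~R) = (u x + del <= n * g%:Z)) /\
    ((n%:~R <= z x + d) = (n * g%:Z <= u x + del)).
Proof.
move=> g0 rz z0 u0 d0.
suff [d hd] : exists d : R, forall x (n : int),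
    ((z x + d <= n%:~R) = (u x + del <= n * g%:Z)) /\
    ((n%:~R <= z x + d) = (n * g%:Z <= u x + del)).
  exists d => //; have [_] := hd x0 0; rewrite z0 u0 !add0r mul0r => ->.
  exact: d0.
case: (pselect (exists x (n : int), u x + del = n * g%:Z)) => [[x [n e]]|ne].
  exists (n%:~R - z x) => y m; split.
    transitivity (z y - z x <= (m - n)%:~R); first by rewrite rmorphB /=; apply/idP/idP; lra.
    rewrite rz; apply/idP/idP; lia.
  transitivity (z x - z y <= (n - m)%:~R); first by rewrite rmorphB /=; apply/idP/idP; lra.
  rewrite rz; apply/idP/idP; lia.
pose k x : int := ((u x + del) %/ g%:Z)%Z.
have kP x : k x * g%:Z < u x + del < (k x + 1) * g%:Z.
  have e := divz_eq (u x + del) g%:Z; rewrite -/(k x) in e.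
  have h1 : 0 <= ((u x + del) %% g%:Z)%Z by apply: modz_ge0; lia.
  have h2 : ((u x + del) %% g%:Z)%Z < g%:Z by apply: ltz_pmod; lia.
  have h3 : ((u x + del) %% g%:Z)%Z != 0.
    by apply/eqP => h; apply: ne; exists x, (k x); rewrite e h addr0.
  by apply/andP; split; lia.
pose l x : R := (k x)%:~R - z x.
have lP x y : l x < l y + 1.
  have := rz x y (k x - k y - 1); rewrite !rmorphB /= => e.
  have /andP[a1 a2] := kP x; have /andP[b1 b2] := kP y.
  have : (z x - z y <= (k x)%:~R - (k y)%:~R - 1) = false.
    by rewrite -[1]/(1%:~R) e; apply/negbTE; rewrite -ltNge; lia.
  by move/negbT; rewrite -ltNge /l; lra.
case: (@arg_maxP _ _ T x0 predT l) => // xm _ hm.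
case: (@arg_minP _ _ T x0 predT l) => // ym _ hn.
exists ((l xm + l ym + 1) / 2) => x n.
set d := _ / 2.
have d1 : (k x)%:~R < z x + d.
  by have : l x <= l xm := hm x isT; have := lP xm ym; rewrite /d /l; lra.
have d2 : z x + d < (k x)%:~R + 1.
  by have : l ym <= l x := hn x isT; have := lP xm ym; rewrite /d /l; lra.
have /andP[a1 a2] := kP x.
case: (leP (k x + 1) n) => hk.
  have hk' : (k x)%:~R + 1 <= n%:~R :> R by rewrite -[1]/(1%:~R) -intrD ler_int.
  split; first by apply/idP/idP => _; [nia | lra].
  by apply/idP/idP => h; exfalso; [lra | nia].
have hk' : n%:~R <= (k x)%:~R :> R by rewrite ler_int; lia.
split; first by apply/idP/idP => h; exfalso; [lra | nia].
by apply/idP/idP => _; [nia | lra].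
Qed.

(** The zero coordinate [x0] turns comparisons of differences into comparisons with integers, so [z]
    and [u] are capped at the same coordinates. *)
Lemma represents_cap g z u (M : nat) (x0 : T) : (0 < g)%N ->
  z x0 = 0 -> u x0 = 0 -> represents g z u ->
  represents g (fun x => Num.min (z x) M%:R) (fun x => Num.min (u x) (M%:Z * g%:Z)).
Proof.
move=> g0 z0 u0 rz.
have up x (n : int) : (z x <= n%:~R) = (u x <= n * g%:Z).
  by have := rz x x0 n; rewrite z0 u0 !subr0.
have lo x (n : int) : (n%:~R <= z x) = (n * g%:Z <= u x).
  have := rz x0 x (- n); rewrite z0 u0 !sub0r rmorphN /= mulNr.
  by rewrite !lerN2.
have cs x : [/\ Num.min (z x) M%:R = z x & Num.min (u x) (M%:Z * g%:Z) = u x] \/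
    [/\ Num.min (z x) M%:R = (M%:Z)%:~R & Num.min (u x) (M%:Z * g%:Z) = M%:Z * g%:Z].
  have e := up x M; case: (leP (z x) M%:R) => h; [left | right].
    by rewrite min_l // -e h.
  split=> //; rewrite min_r // ltW // ltNge -e -ltNge.
  exact: h.
move=> x y n; have [[-> ->]|[-> ->]] := cs x; have [[-> ->]|[-> ->]] := cs y.
- exact: rz.
- transitivity (z x <= (M%:Z + n)%:~R); first by rewrite rmorphD /=; apply/idP/idP; lra.
  by rewrite up; apply/idP/idP; lia.
- transitivity ((M%:Z - n)%:~R <= z y); first by rewrite rmorphB /=; apply/idP/idP; lra.
  by rewrite lo; apply/idP/idP; lia.
rewrite subrr subrr -[0 : R]/(0%:~R) ler_int.
by case: (ltngtP g 0) g0 => // g0 _; apply/idP/idP; nia.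
Qed.
End Regions.

(** * Non-interference as unreachability *)

Section Product.
Local Open Scope ring_scope.
Variables (R : realType) (Q X S : finType).
Variables (A : timed_automaton Q X S) (H : {set S}).

Implicit Types (v : X -> R) (q : Q).

Definition later v d : X -> R := fun x => v x + d.
Definition reset (r : {set X}) v : X -> R := fun x => if x \in r then 0 else v x.

Lemma later0 v : later v 0 = v.
Proof. by apply/funext => x; rewrite /later addr0. Qed.

Lemma later_add v d d' : later (later v d) d' = later v (d + d').
Proof. by apply/funext => x; rewrite /later addrA. Qed.

Lemma sat_earlier g v d d' : upper_bounded g -> d' <= d ->
  sat (later v d) g -> sat (later v d') g.
Proof.
move=> /allP ub dd /allP h; apply/allP => -[[x o] c] hx.
have hd : v x + d' <= v x + d by rewrite lerD2l.
have := ub _ hx; have := h _ hx; rewrite /later !inE /=.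
by case: o {hx} => //= h1 _; [exact: le_lt_trans hd h1 | exact: le_trans hd h1].
Qed.

Definition fires q a v q' v' :=
  exists g r, [/\ (q, g, Some a, r, q') \in ta_edges A, sat v g, v' = reset r v &
                  sat v' (ta_inv A q')].

Lemma delayP (B : timed_automaton Q X S) q v d s : ta_inv B = ta_inv A ->
  delay_step B (q, v) d s <->
  [/\ 0 <= d, s = (q, later v d) & sat (later v d) (ta_inv A q)].
Proof.
move=> BA; split=> [[d0 -> h]|[d0 -> h]]; split=> //.
  by rewrite -BA; apply: (h d); rewrite d0 lexx.
move=> d' /andP[_ dd]; rewrite BA.
exact: sat_earlier (ta_inv_upper A q) dd h.
Qed.

(* A run of A/H that leads, together with the run of A\H on the low-level
   actions it performs, to a low-level action that A\H cannot match. The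
   second component is stuck as soon as its invariant is violated, which
   persists because invariants are upper bounds. *)
Inductive bad : Q -> (X -> R) -> Q -> (X -> R) -> Prop :=
| bad_high q1 v1 q2 v2 d a q1' v1' :
    0 <= d -> sat (later v1 d) (ta_inv A q1) -> a \in H ->
    fires q1 a (later v1 d) q1' v1' -> bad q1' v1' q2 (later v2 d) ->
    bad q1 v1 q2 v2
| bad_low q1 v1 q2 v2 d a q1' v1' :
    0 <= d -> sat (later v1 d) (ta_inv A q1) -> a \notin H ->
    fires q1 a (later v1 d) q1' v1' ->
    ~ (sat (later v2 d) (ta_inv A q2) /\ exists q2' v2', fires q2 a (later v2 d) q2' v2') ->
    bad q1 v1 q2 v2
| bad_both q1 v1 q2 v2 d a q1' v1' q2' v2' :
    0 <= d -> sat (later v1 d) (ta_inv A q1) -> a \notin H ->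
    fires q1 a (later v1 d) q1' v1' ->
    sat (later v2 d) (ta_inv A q2) -> fires q2 a (later v2 d) q2' v2' ->
    bad q1' v1' q2' v2' -> bad q1 v1 q2 v2.

(** A\H makes no silent steps, so a trace lists the delays and actions of its run. The closing delay
    can be taken to be 0, which leaves only the invariant at the end. *)
Fixpoint accepts q v (w : seq (R * S)) : Prop :=
  if w is (d, a) :: w' then
    [/\ 0 <= d, sat (later v d) (ta_inv A q), a \notin H &
        exists q' v', fires q a (later v d) q' v' /\ accepts q' v' w']
  else sat v (ta_inv A q).

Hypothesis epsf : epsilon_free A.
Hypothesis det : deterministic R (delete_actions A H).

Lemma hide_stepP q v a q' v' :
  discrete_step (hide_actions A H) (q, v) a (q', v') <->
  exists b, hide_label H (Some b) = a /\ fires q b v q' v'.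
Proof.
split=> [[g [r [/mapP[[[[[q1 g1] a1] r1] q2] he [-> -> -> -> ->]] hs /= -> hi]]]|].
  case: a1 he => [b|] he; last by have := epsf he.
  by exists b; split=> //; exists g1, r1.
move=> [b [<- [g [r [he hs -> hi]]]]]; exists g, r; split=> //.
by apply/mapP; exists (q, g, Some b, r, q').
Qed.

Lemma delete_stepP q v a q' v' :
  discrete_step (delete_actions A H) (q, v) a (q', v') <->
  exists b, [/\ a = Some b, b \notin H & fires q b v q' v'].
Proof.
split=> [[g [r [/=]]]|[b [-> hb [g [r [he hs -> hi]]]]]].
  rewrite mem_filter => /andP[ha he] hs -> hi.
  case: a ha he => [b|] ha he; last by have := epsf he.
  by exists b; split=> //; exists g, r.
by exists g, r; split=> //=; rewrite mem_filter hb.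
Qed.

Lemma run_delete_accepts s u s' :
  run (delete_actions A H) s u s' -> accepts s.1 s.2 (absorb 0 u).
Proof.
elim=> {s u s'} [[q v] d s' hd|[q v] d s1 a [q' v'] u s' hd hs _ IH].
  move/delayP: hd => -[] // d0 _ h.
  by rewrite /= -(later0 v); apply: sat_earlier (ta_inv_upper A q) d0 h.
move/delayP: hd => -[] // d0 e1 h.
move: hs; rewrite e1 => /delete_stepP[b [-> hb f]].
by rewrite /= add0r; split=> //; exists q', v'.
Qed.

(** Used with [B] equal to A\H and to A/H: both perform all low-level firings under the same
    invariants. *)
Lemma accepts_run (B : timed_automaton Q X S) q v w : ta_inv B = ta_inv A ->
  (forall q v b q' v', b \notin H -> fires q b v q' v' ->
     discrete_step B (q, v) (Some b) (q', v')) ->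
  accepts q v w -> exists u s, run B (q, v) u s /\ w = absorb 0 u.
Proof.
move=> BA hB; elim: w q v => [|[d a] w IH] q v /=.
  move=> h; exists [::], (q, later v 0); split=> //; apply: (@run_last _ _ _ _ _ _ 0).
  by apply/delayP => //; rewrite later0.
move=> [d0 h ha [q' [v' [f /IH[u [s [r ->]]]]]]].
exists ((d, Some a) :: u), s; rewrite /= add0r; split=> //.
by apply: run_cons r; [apply/delayP | apply: hB].
Qed.

Lemma delete_languageP w :
  @ta_language R Q X S (delete_actions A H) w <-> accepts (ta_init A) (fun _ => 0) w.
Proof.
split=> [[u [s [r ->]]]|h]; first exact: run_delete_accepts r.
by apply: accepts_run h => // q v b q' v' hb f; apply/delete_stepP; exists b.
Qed.

Lemma accepts_hide w : accepts (ta_init A) (fun _ => 0) w ->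
  @ta_language R Q X S (hide_actions A H) w.
Proof.
move=> h; apply: accepts_run h => // q v b q' v' hb f.
by apply/hide_stepP; exists b; rewrite /= (negbTE hb).
Qed.

Lemma fires_det q a v q1 v1 q2 v2 : a \notin H -> (forall x, 0 <= v x) ->
  fires q a v q1 v1 -> fires q a v q2 v2 -> q1 = q2 /\ v1 = v2.
Proof.
move=> ha v0 [g [r [he hs -> _]]] [g' [r' [he' hs' -> _]]].
have [|||-> ->] := @det q g g' (Some a) r r' q1 q2; rewrite ?mem_filter ?ha //=.
by exists v.
Qed.

Lemma fires_ge0 q a v q' v' : (forall x, 0 <= v x) -> fires q a v q' v' -> forall x, 0 <= v' x.
Proof. by move=> v0 [g [r [_ _ -> _]]] x; rewrite /reset; case: ifP. Qed.

Lemma later_ge0 v d : 0 <= d -> (forall x, 0 <= v x) -> forall x, 0 <= later v d x.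
Proof. by move=> d0 v0 x; apply: addr_ge0. Qed.

(** [v] is the valuation of A\H after its last action and [d0] the delay since then; the hidden
    steps of A/H accumulate in [d0], just as in [absorb]. Determinism is needed when both components
    move: an accepting run must then continue from the successor chosen in [bad]. *)
Lemma bad_sound q1 v1 q2 v2 : bad q1 v1 q2 v2 ->
  forall v d0, 0 <= d0 -> v2 = later v d0 -> (forall x, 0 <= v2 x) ->
  exists u s, run (hide_actions A H) (q1, v1) u s /\ ~ accepts q2 v (absorb d0 u).
Proof.
elim=> {q1 v1 q2 v2} [q1 v1 q2 v2 d a q1' v1' d_ge h ha f _ IH
  | q1 v1 q2 v2 d a q1' v1' d_ge h ha f nf
  | q1 v1 q2 v2 d a q1' v1' q2' v2' d_ge h ha f h2 f2 _ IH] v d0 d0_ge e v2_ge.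
- have [|||u [s [r na]]] := IH v (d0 + d); rewrite ?addr_ge0 //.
  + by rewrite e later_add.
  + exact: later_ge0.
  exists ((d, None) :: u), s; split=> //.
  apply: run_cons r; first exact/delayP.
  by apply/hide_stepP; exists a; rewrite /= ha.
- exists [:: (d, Some a)], (q1', later v1' 0); split.
    apply: run_cons; first exact/delayP.
      by apply/hide_stepP; exists a; rewrite /= (negbTE ha); split; [|exact: f].
    apply: (@run_last _ _ _ _ _ _ 0); apply/delayP => //; rewrite later0; split=> //.
    by case: f => g [r []].
  move=> /= [_ h2 _ [q' [v' [f' _]]]]; apply: nf; rewrite e later_add; split=> //.
  by exists q', v'.
have f2_ge := fires_ge0 (later_ge0 d_ge v2_ge) f2.
have [|||u [s [r na]]] := IH v2' 0; rewrite ?later0 //.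
exists ((d, Some a) :: u), s; split.
  apply: run_cons r; first exact/delayP.
  by apply/hide_stepP; exists a; rewrite /= (negbTE ha).
move=> /= [_ _ _ [q' [v' [f' acc]]]]; apply: na.
rewrite e later_add in f2.
have ge : forall x, 0 <= later v (d0 + d) x by rewrite -later_add -e; apply: later_ge0.
by have [<- <-] := fires_det ha ge f' f2.
Qed.

(** The run of A/H is followed until A\H cannot match. It cannot end before that, since the empty
    trace is accepted wherever the invariant holds. *)
Lemma bad_complete s u s' : run (hide_actions A H) s u s' ->
  forall q2 v d0, 0 <= d0 -> sat v (ta_inv A q2) -> ~ accepts q2 v (absorb d0 u) ->
  bad s.1 s.2 q2 (later v d0).
Proof.
elim=> {s u s'} [s d s' _ q2 v d0 _ hs /(_ hs) //|].
move=> [q1 v1] d s1 a [q1' v1'] u s' hd hst _ IH q2 v d0 d0_ge hs na.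
move/delayP: hd => -[] // d_ge e h; move: hst; rewrite e => /hide_stepP[b [eb f]].
case: (boolP (b \in H)) => hb.
  apply: (bad_high d_ge h hb f); rewrite later_add.
  by apply: IH => //; [exact: addr_ge0 | move: na; rewrite -eb /= hb].
rewrite -eb /= (negbTE hb) /= in na.
case: (pselect (sat (later (later v d0) d) (ta_inv A q2) /\
   exists q2' v2', fires q2 b (later (later v d0) d) q2' v2')) => [[h2 [q2' [v2' f2]]]|nf].
  apply: (bad_both d_ge h hb f h2 f2); rewrite -(later0 v2').
  apply: IH => //; first by case: f2 => g [r []].
  move=> acc; apply: na; rewrite later_add in h2 f2; split=> //; first exact: addr_ge0.
  by exists q2', v2'.
exact: bad_low d_ge h hb f nf.
Qed.

Lemma run_sat (s : ta_state R Q X) u s' : run (hide_actions A H) s u s' -> sat s.2 (ta_inv A s.1).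
Proof.
by case=> {s u s'} [[q v] d s' hd|[q v] d s1 a s2 u s' hd _ _]; move/delayP: hd => -[] // d0 _ h;
  rewrite /= -(later0 v); apply: sat_earlier (ta_inv_upper A q) d0 h.
Qed.

(** The language of A\H is always included in that of A/H, so only a trace of A/H rejected by A\H
    can break the equality. *)
Theorem SNNI_bad : SNNI R A H <-> ~ bad (ta_init A) (fun _ => 0) (ta_init A) (fun _ => 0).
Proof.
split=> [e b|nb].
  have [|||u [s [r na]]] := bad_sound b (v := fun _ => 0) (d0 := 0); rewrite ?later0 //.
  apply: na; apply/delete_languageP; rewrite e.
  by exists u, s.
apply/funext => w; apply/propext; split.
  by move/delete_languageP; apply: accepts_hide.
move=> [u [s [r ->]]]; apply/delete_languageP; apply: contrapT => na; apply: nb.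
have s0 := run_sat r; rewrite /= in s0.
by have := bad_complete r (lexx 0) s0 na; rewrite later0.
Qed.

End Product.

(** * The region graph, coded by numbers *)

(* A state is a number whose digits in base [sbase W] are the location of A/H,
   the location of A\H, the failure flag, and the values of the clocks of both
   components in units of [1 / W], capped at [W]. *)
Definition ndig (W : nat) : nat := 2 * trunc_log 2 W + 3.
Definition sbase (W : nat) : nat := 2 ^ ndig W.
Definition nst (W : nat) : nat := sbase W ^ ndig W.
Definition dig (W s i : nat) : nat := (s %/ sbase W ^ i) %% sbase W.
(** Index [2 * nclk W], one past the clocks, reads as 0: it is the reference coordinate that makes
    comparisons with constants a special case of comparisons of differences. *)
Definition gv (W s k : nat) : nat := if k < 2 * nclk W then dig W s (3 + k) else 0.
Definition c1 (W s x : nat) : nat := dig W s (3 + x).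
Definition c2 (W s x : nat) : nat := dig W s (3 + (nclk W + x)).

Definition gcmp (o x y : nat) : bool :=
  if o == 0 then x < y else if o == 1 then x <= y else if o == 2 then x == y
  else if o == 3 then y <= x else y < x.

Definition csat (W : nat) (u : nat -> nat) (p : nat) : bool :=
  all (fun i => gcmp (nval W (nend W (item (aend W) W p i)))
                  (u (nval W (item (aend W) W p i)))
                  (nval W (nend W (nend W (item (aend W) W p i))) * W))
    (iota 0 (cnt (aend W) W p)).

(** Offsets up to [W] suffice: the values compared are at most [W * W], so a larger offset gives the
    same answer for all pairs. *)
Definition gequiv (W s r : nat) : bool :=
  all (fun x => all (fun y => all (fun n =>
     ((gv W s x <= gv W s y + n * W) == (gv W r x <= gv W r y + n * W)) &&
     ((gv W s x + n * W <= gv W s y) == (gv W r x + n * W <= gv W r y)))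
   (iota 0 W.+1)) (iota 0 (2 * nclk W).+1)) (iota 0 (2 * nclk W).+1).

(** The tuple of [s] is first exchanged for an equivalent one, [r], and only then advanced by [del]
    units and capped. Only the invariant of A/H is checked; that of A\H is tested at the next
    low-level action. A failed state has no successor. *)
Definition tdelay (W s t : nat) : bool :=
  has (fun r => has (fun del =>
      gequiv W s r &&
      all (fun x => (gv W r x <= W * W) && (gv W t x == minn (gv W r x + del) (W * W)))
        (iota 0 (2 * nclk W)))
    (iota 0 (W * W).+1)) (iota 0 (nst W)) &&
  ((dig W t 0 == dig W s 0) && ((dig W t 1 == dig W s 1) && ((dig W s 2 == 0) &&
   ((dig W t 2 == 0) && csat W (c1 W t) (pinv W (dig W t 0)))))).

Definition rst (W p : nat) (u : nat -> nat) (x : nat) : nat :=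
  if inreset W p x then 0 else u x.

Definition eok (W q : nat) (u : nat -> nat) (p : nat) : bool :=
  (nval W p == q) && (csat W u (nend W p) && csat W (rst W p u) (pinv W (nval W (etgt W p)))).

Definition moved (W p : nat) (u u' : nat -> nat) : bool :=
  all (fun x => u' x == rst W p u x) (iota 0 (nclk W)).

Definition elabel (W p : nat) : nat := nval W (elab W p).+1.
Definition ehigh (W p : nat) : bool := bit W (item succn W (pact W) (elabel W p)).

Definition matches (W t p p' : nat) : bool :=
  (elabel W p' == elabel W p) && eok W (dig W t 1) (c2 W t) p'.

Definition tedge (W t s : nat) : bool :=
  has (fun j =>
    eok W (dig W t 0) (c1 W t) (edgp W j) && ((dig W s 0 == nval W (etgt W (edgp W j))) &&
    (moved W (edgp W j) (c1 W t) (c1 W s) &&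
    (if ehigh W (edgp W j) then
       (dig W s 1 == dig W t 1) && ((dig W s 2 == 0) &&
        all (fun x => c2 W s x == c2 W t x) (iota 0 (nclk W)))
     else
       (csat W (c2 W t) (pinv W (dig W t 1)) && ((dig W s 2 == 0) &&
         has (fun j' => matches W t (edgp W j) (edgp W j') &&
            ((dig W s 1 == nval W (etgt W (edgp W j'))) && moved W (edgp W j') (c2 W t) (c2 W s)))
           (iota 0 (nedg W)))) ||
       ((dig W s 2 == 1) && ~~ (csat W (c2 W t) (pinv W (dig W t 1)) &&
         has (fun j' => matches W t (edgp W j) (edgp W j')) (iota 0 (nedg W))))))))
  (iota 0 (nedg W)).

Definition trans (W s s' : nat) : bool :=
  has (fun t => tdelay W s t && tedge W t s') (iota 0 (nst W)).

Definition sinit (W s : nat) : bool :=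
  (dig W s 0 == nval W (pini W)) && ((dig W s 1 == nval W (pini W)) && ((dig W s 2 == 0) &&
   all (fun x => gv W s x == 0) (iota 0 (2 * nclk W)))).

(** There are [nst W = 2 ^ (ndig W * ndig W)] states, whence the recursion depth. The remainders
    modulo [nst W] change nothing in the range of the search; they make the bound on the vertices
    hold for every environment, as [f_rch] demands. *)
Definition insecure (W : nat) : bool :=
  has (fun s => sinit W s && has (fun s' => (dig W s' 2 == 1) &&
    rch (trans W) (nst W) (ndig W * ndig W) (s %% nst W) (s' %% nst W)) (iota 0 (nst W)))
  (iota 0 (nst W)).

Section Arithmetic.

Lemma dig_exists W (f : nat -> nat) L : (forall i, f i < sbase W) ->
  exists2 s, s < sbase W ^ L & forall i, i < L -> dig W s i = f i.
Proof.
have B0 : 0 < sbase W by rewrite expn_gt0.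
elim: L f => [|L IH] f hf; first by exists 0.
have [|s hs hd] := IH (fun i => f i.+1); first by move=> i.
exists (s * sbase W + f 0).
  rewrite expnSr; apply: (@leq_trans (s.+1 * sbase W)); last by rewrite leq_mul2r hs orbT.
  by rewrite mulSn addnC ltn_add2r.
move=> [|i] hi; rewrite /dig; first by rewrite divn1 modnMDl modn_small.
by rewrite expnS divnMA divnMDl // (divn_small (hf 0)) addn0; apply: hd.
Qed.

Lemma W_lt W : W < 2 ^ (trunc_log 2 W).+1.
Proof. by case: (posnP W) => [->//|h]; rewrite trunc_log_ltn. Qed.

(** [W * W] is the largest clock digit: the cap [W] in units of 1/W. *)
Lemma WW_lt W : W * W < sbase W.
Proof.
have h := W_lt W; rewrite /sbase /ndig.
apply: (@leq_trans (2 ^ ((trunc_log 2 W).+1 + (trunc_log 2 W).+1))).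
  rewrite expnD; case: (posnP W) => [->|W0]; first by [].
  by apply: (@leq_trans (2 ^ (trunc_log 2 W).+1 * W)); rewrite ?ltn_mul2r ?W0 // leq_mul2l ltnW ?orbT.
by rewrite leq_exp2l //; lia.
Qed.

End Arithmetic.

Section Shift.
Local Open Scope ring_scope.
Variables (R : realType) (T : finType).

Lemma represents_ext g (z z' : T -> R) (u u' : T -> int) : z =1 z' -> u =1 u' ->
  represents g z u -> represents g z' u'.
Proof. by move=> hz hu h x y n; rewrite -!hz -!hu. Qed.

Lemma represents_map g (z z' : T -> R) (u u' : T -> int) :
  (forall k, exists l, z' k = z l /\ u' k = u l) -> represents g z u -> represents g z' u'.
Proof.
move=> h r x y n; have [a [-> ->]] := h x; have [b [-> ->]] := h y.
exact: r.
Qed.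

Lemma represents_shift g M (z : T -> R) (u : T -> int) x0 (d : R) (del : int) :
  (0 < g)%N -> z x0 = 0 -> u x0 = 0 -> represents g z u ->
  (forall x (n : int), ((z x + d <= n%:~R) = (u x + del <= n * g%:Z)) /\
    ((n%:~R <= z x + d) = (n * g%:Z <= u x + del))) ->
  represents g (fun k => Num.min (if k == x0 then 0 else z k + d) M%:R)
         (fun k => Num.min (if k == x0 then 0 else u k + del) (M%:Z * g%:Z)).
Proof.
move=> g0 z0 u0 r h; apply: (represents_cap M (x0 := x0) g0); rewrite ?eqxx //.
move=> x y n; case: eqP => [_|_]; case: eqP => [_|_].
- by have := r x0 x0 n; rewrite !subrr.
- transitivity ((- n)%:~R <= z y + d); first by rewrite rmorphN /=; apply/idP/idP; lra.
  by rewrite (h y _).2; apply/idP/idP; lia.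
- by rewrite !subr0 (h x n).1.
transitivity (z x - z y <= n%:~R); first by apply/idP/idP; lra.
by rewrite r; apply/idP/idP; lia.
Qed.

Lemma represents_nat g (z : T -> R) (u : T -> nat) x y n : represents g z (fun k => (u k)%:Z) ->
  ((u x <= u y + n * g)%N = (z x - z y <= n%:R)) /\
  ((u x + n * g <= u y)%N = (z x - z y <= - n%:R)).
Proof.
move=> r; have := r x y n; have := r x y (- n%:Z); rewrite rmorphN /= => -> ->.
by split; apply/idP/idP; lia.
Qed.

End Shift.

(** * The coded graph and the runs of the two components *)

Section Correctness.
Variables (R : realType) (Q X S : finType) (A : timed_automaton Q X S) (H : {set S}).
Hypothesis epsf : epsilon_free A.
Variables (w : seq bool) (W : nat).
Hypothesis wE : w = code_ta A H.
Hypothesis Wbit : forall i, i < size w -> bit W i = nth false w i.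
Hypothesis Wsize : 2 ^ size w <= W.

Notation K := #|X|.
Notation rk x := (nat_of_ord (enum_rank x)).

Let fields := ta_fields Wbit Wsize wE.

Lemma nclkE : nclk W = K. Proof. by case: fields => -[]. Qed.

Lemma sizes : K < size w /\ #|Q| < size w.
Proof.
have h1 := size_code_seq (fun _ : X => [::] : seq bool) (enum X).
have h2 := size_code_seq (fun q : Q => code_constraint (ta_inv A q)) (enum Q).
rewrite -!cardT in h1 h2.
have sl (a b : seq bool) : size a <= size (a ++ b) by rewrite size_cat leq_addr.
have sr (a b : seq bool) : size b <= size (a ++ b) by rewrite size_cat leq_addl.
rewrite wE /code_ta; split; first exact: leq_trans h1 (sl _ _).
exact: leq_trans h2 (leq_trans (sl _ _) (leq_trans (sr _ _) (sr _ _))).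
Qed.

Lemma size_lt_trunc_log : size w <= trunc_log 2 W.
Proof. exact: trunc_log_max. Qed.

(** Room for the fractional parts of all clocks of both components, of the zero coordinate and of a
    delay. *)
Lemma W_gt : (2 * K).+2 <= W.
Proof.
have [h _] := sizes; apply: leq_trans Wsize.
apply: (@leq_trans (2 ^ K.+1)); last by rewrite leq_exp2l.
by have := ltn_expl K (isT : 1 < 2); rewrite expnS; lia.
Qed.

(** Every clock costs at least one bit of the encoding, so [K] is below [size w], hence below the
    logarithm of [W]. *)
Lemma ndig_ge : 3 + 2 * K <= ndig W.
Proof. by have [h _] := sizes; have := size_lt_trunc_log; rewrite /ndig; lia. Qed.

Lemma rk_lt (q : Q) : rk q < sbase W.
Proof.
have [_ h] := sizes; have := size_lt_W Wsize; have := WW_lt W; have := enum_rank_lt_card q.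
by nia.
Qed.

(** This makes [W] a legitimate cap: every constant of a guard or an invariant is written in the
    encoding and so lies strictly below [W]. *)
Lemma code_nat_lt p n : occurs w p (code_nat n) -> n < W.
Proof.
move=> oc; apply: leq_trans Wsize.
apply: (@leq_trans (2 ^ (trunc_log 2 n).+1)); first exact: W_lt.
rewrite leq_exp2l //; have := occurs_size oc.
have := size_code_seq (fun b : bool => [:: b]) (mkseq (fun i => odd (n %/ 2 ^ i)) (trunc_log 2 n).+1).
by rewrite size_mkseq /code_nat; lia.
Qed.

Definition cmpok (u : nat -> nat) (v : X -> R) :=
  forall x c, c < W ->
  ((u (rk x) <= c * W) = (v x <= c%:R)%R) /\ ((c * W <= u (rk x)) = (c%:R <= v x)%R).

Lemma csatP u v p g : cmpok u v -> occurs w p (code_constraint g) -> csat W u p = sat v g.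
Proof.
move=> cu oc; have aP := aendP (X := X) Wbit Wsize.
rewrite /csat (cnt_code Wbit Wsize aP oc) /sat.
case: g oc => // a0 g' oc; set g := a0 :: g' in oc *.
rewrite -[in RHS](mkseq_nth a0 g) all_map; apply: eq_in_all => i.
rewrite mem_iota add0n => /andP[_ hi] /=.
have := item_code Wbit Wsize aP a0 oc hi; case: (nth a0 g i) => [[x o] c] o1.
have t1 := occurs_catr o1; have t2 := occurs_catr t1.
rewrite (nvalP Wbit Wsize (occurs_catl o1)).
rewrite -(nendP Wbit Wsize (occurs_catl o1)) in t1 t2.
rewrite (nvalP Wbit Wsize (occurs_catl t1)).
rewrite -(nendP Wbit Wsize (occurs_catl t1)) in t2.
rewrite (nvalP Wbit Wsize t2).
have [le ge] := cu x c (code_nat_lt t2); case: o {o1 t1 t2}; rewrite /gcmp /=.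
- by rewrite ltnNge ge -ltNge.
- by rewrite le.
- by rewrite eqn_leq eq_le le ge.
- by rewrite ge.
by rewrite ltnNge le -ltNge.
Qed.

Local Open Scope ring_scope.

Definition vec (v1 v2 : X -> R) (k : nat) : R :=
  nth 0 ([seq v1 x | x <- enum X] ++ [seq v2 x | x <- enum X]) k.

Lemma vec1 v1 v2 x : vec v1 v2 (rk x) = v1 x.
Proof.
rewrite /vec nth_cat size_map -cardE ltn_ord (nth_map x) -?cardE ?ltn_ord //.
by rewrite nth_enum_rank.
Qed.

Lemma vec2 v1 v2 x : vec v1 v2 (K + rk x) = v2 x.
Proof.
rewrite /vec nth_cat size_map -cardE ltnNge leq_addr /= addKn.
by rewrite (nth_map x) -?cardE ?ltn_ord // nth_enum_rank.
Qed.

Lemma vec0 v1 v2 k : (2 * K <= k)%N -> vec v1 v2 k = 0.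
Proof.
move=> h; apply: nth_default; apply: leq_trans h.
by rewrite size_cat size_map size_map -cardE mul2n addnn.
Qed.

Lemma idx_cases k : (k < 2 * K)%N ->
  (exists x : X, k = rk x) \/ (exists x : X, k = (K + rk x)%N).
Proof.
move=> h; case: (ltnP k K) => hk; [left | right].
  by exists (enum_val (Ordinal hk)); rewrite enum_valK.
have hk' : (k - K < K)%N by lia.
by exists (enum_val (Ordinal hk')); rewrite enum_valK /= subnKC.
Qed.

Definition capz v1 v2 (k : 'I_(2 * K).+1) : R := Num.min (vec v1 v2 k) W%:R.

Definition codes (s : nat) (q1 : Q) (v1 : X -> R) (q2 : Q) (v2 : X -> R) :=
  [/\ dig W s 0 = rk q1, dig W s 1 = rk q2, dig W s 2 = 0%N,
      (forall k, (gv W s k <= W * W)%N) &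
      represents W (capz v1 v2) (fun k => (gv W s k)%:Z)].

Lemma gv_out s k : (2 * K <= k)%N -> gv W s k = 0%N.
Proof. by move=> h; rewrite /gv nclkE ltnNge h. Qed.

Lemma gv1 s (x : X) : gv W s (rk x) = c1 W s (rk x).
Proof. by rewrite /gv nclkE; case: ltnP => //; have := enum_rank_lt_card x; lia. Qed.

Lemma gv2 s (x : X) : gv W s (K + rk x) = c2 W s (rk x).
Proof. by rewrite /gv /c2 nclkE; case: ltnP => //; have := enum_rank_lt_card x; lia. Qed.

Definition izero : 'I_(2 * K).+1 := ord_max.

Lemma capz0 v1 v2 : capz v1 v2 izero = 0.
Proof. by rewrite /capz vec0 // min_l // ler0n. Qed.

Lemma min_cmp (x : R) c : (c < W)%N ->
  ((Num.min x W%:R <= c%:R) = (x <= c%:R)) * ((c%:R <= Num.min x W%:R) = (c%:R <= x)).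
Proof.
move=> h; have h' : (c%:R : R) < W%:R by rewrite ltr_nat.
split; first by rewrite ge_min [(W%:R <= _)]leNgt h' orbF.
by rewrite le_min [(_ <= W%:R)]ltW ?andbT.
Qed.

Lemma codes_cmp s q1 v1 q2 v2 k c : codes s q1 v1 q2 v2 -> (k < 2 * K)%N -> (c < W)%N ->
  ((gv W s k <= c * W)%N = (vec v1 v2 k <= c%:R)) /\
  ((c * W <= gv W s k)%N = (c%:R <= vec v1 v2 k)).
Proof.
move=> [_ _ _ _ r] hk hc; have hk' : (k < (2 * K).+1)%N by apply: leqW.
have [le _] := represents_nat (Ordinal hk') izero c r.
have [_ ge] := represents_nat izero (Ordinal hk') c r.
rewrite (@gv_out s izero) // capz0 add0n in le ge; split.
  by move: le; rewrite subr0 /capz (min_cmp _ hc).1; exact.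
by move: ge; rewrite sub0r lerN2 /capz (min_cmp _ hc).2; exact.
Qed.

Lemma codes_cmp1 s q1 v1 q2 v2 : codes s q1 v1 q2 v2 -> cmpok (c1 W s) v1.
Proof.
move=> r x c hc; rewrite -gv1 -(vec1 v1 v2); apply: codes_cmp r _ hc.
by have := enum_rank_lt_card x; lia.
Qed.

Lemma codes_cmp2 s q1 v1 q2 v2 : codes s q1 v1 q2 v2 -> cmpok (c2 W s) v2.
Proof.
move=> r x c hc; rewrite -gv2 -(vec2 v1 v2); apply: codes_cmp r _ hc.
by have := enum_rank_lt_card x; lia.
Qed.

Lemma vec_later v1 v2 d k : (k < 2 * K)%N ->
  vec (later v1 d) (later v2 d) k = vec v1 v2 k + d.
Proof. by case/idx_cases=> [[x ->]|[x ->]]; rewrite ?vec1 ?vec2. Qed.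

Lemma vec_ge0 v1 v2 : (forall x, 0 <= v1 x) -> (forall x, 0 <= v2 x) -> forall k, 0 <= vec v1 v2 k.
Proof.
move=> h1 h2 k; case: (ltnP k (2 * K)) => [/idx_cases[[x ->]|[x ->]]|h].
- by rewrite vec1.
- by rewrite vec2.
by rewrite vec0.
Qed.

Lemma W0 : (0 < W)%N. Proof. by have := W_gt; lia. Qed.

Lemma izeroP (k : 'I_(2 * K).+1) : (k == izero) = ~~ (k < 2 * K)%N.
Proof. by rewrite -val_eqE /= -leqNgt eqn_leq -[(k <= _)%N]ltnS ltn_ord. Qed.

(** Two delays occur because the delay itself may be capped before it is coded: [d] is the real one,
    and [d'], applied to capped clocks, leads to the same capped values. Soundness takes [d' = d],
    completeness the minimum of [d] and [W]. *)
Lemma delay_codes t r del q1 v1 q2 v2 (d d' : R) :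
  (forall k, 0 <= vec v1 v2 k) -> 0 <= d ->
  (forall y : R, 0 <= y -> Num.min (Num.min y W%:R + d') W%:R = Num.min (y + d) W%:R) ->
  represents W (capz v1 v2) (fun k => (gv W r k)%:Z) ->
  (forall (x : 'I_(2 * K).+1) (n : int),
    ((capz v1 v2 x + d' <= n%:~R) = ((gv W r x)%:Z + del%:Z <= n * W%:Z)) /\
    ((n%:~R <= capz v1 v2 x + d') = (n * W%:Z <= (gv W r x)%:Z + del%:Z))) ->
  dig W t 0 = rk q1 -> dig W t 1 = rk q2 -> dig W t 2 = 0%N ->
  (forall x, (x < 2 * K)%N -> gv W t x = minn (gv W r x + del) (W * W)) ->
  codes t q1 (later v1 d) q2 (later v2 d).
Proof.
move=> v0 d0 hd r0 hc e0 e1 e2 ht; split=> //.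
  move=> k; case: (ltnP k (2 * K)) => hk; last by rewrite gv_out.
  by rewrite ht // geq_minr.
have gz : (gv W r izero)%:Z = 0 by rewrite gv_out.
apply: represents_ext (represents_shift W W0 (capz0 v1 v2) gz r0 hc) => k; rewrite izeroP.
  case: ltnP => hk /=; first by rewrite /capz vec_later // hd.
  by rewrite /capz vec0.
case: ltnP => hk /=; last by rewrite gv_out // min_l //; lia.
by rewrite ht //; lia.
Qed.

Lemma tdelay_complete s q1 v1 q2 v2 d : codes s q1 v1 q2 v2 -> 0 <= d ->
  (forall x, 0 <= v1 x) -> (forall x, 0 <= v2 x) -> sat (later v1 d) (ta_inv A q1) ->
  exists t, [/\ (t < nst W)%N, tdelay W s t & codes t q1 (later v1 d) q2 (later v2 d)].
Proof.
move=> rs d0 v10 v20 hs; have [e0 e1 e2 hW rp] := rs.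
have v0 := vec_ge0 v10 v20; set z := capz v1 v2.
have z0 k : 0 <= z k by rewrite /z /capz le_min v0 ler0n.
have zW k : z k <= W%:R by rewrite /z /capz ge_min lexx orbT.
pose d' := Num.min d W%:R.
have d'0 : 0 <= d' by rewrite /d' le_min d0 ler0n.
have d'W : d' <= W%:R by rewrite /d' ge_min lexx orbT.
(* The negated delay becomes one more coordinate. Comparing [z x + d'] with an integer is then a
   comparison of a difference, and the integral tuple respects the clocks and the delay
   simultaneously. *)
pose zt (o : option 'I_(2 * K).+1) : R := if o is Some k then z k else - d'.
have [|U rU intU] := @represents_exists R _ W zt.
  by rewrite card_option card_ord; exact: W_gt.
have U0 : U (Some izero) = 0 by rewrite (intU _ 0) ?mul0r // /zt /z capz0.
have Uge k : 0 <= U (Some k).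
  have := rU (Some izero) (Some k) 0; rewrite /zt {1}/z capz0 U0 mul0r !sub0r !oppr_le0.
  by rewrite z0 => <-.
have UW k : U (Some k) <= W%:Z * W%:Z.
  have := rU (Some k) (Some izero) W; rewrite /zt {2}/z capz0 U0 !subr0.
  by rewrite zW => <-.
have Un : U None <= 0.
  have := rU None (Some izero) 0; rewrite /zt /z capz0 U0 mul0r !subr0 oppr_le0.
  by rewrite d'0 => <-.
have UnW : - U None <= W%:Z * W%:Z.
  have := rU (Some izero) None W; rewrite /zt /z capz0 U0 !sub0r opprK.
  by rewrite d'W => <-.
pose ut (k : nat) : nat := if insub k is Some i then `|U (Some i)|%N else 0%N.
have utE (k : 'I_(2 * K).+1) : (ut k)%:Z = U (Some k).
  by rewrite /ut valK gez0_abs.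
have utW k : (ut k <= W * W)%N.
  rewrite /ut; case: insub => // i; have h1 := gez0_abs (Uge i); have h2 := UW i.
  by rewrite -lez_nat PoszM h1.
pose del := `|U None|%N.
have delE : del%:Z = - U None by rewrite /del lez0_abs.
have Bw := WW_lt W.
have [|r rN rd] := @dig_exists W (fun i => if (i < 3)%N then 0%N else ut (i - 3)%N) (ndig W).
  by move=> i; case: ifP => _; [rewrite expn_gt0 | apply: leq_ltn_trans (utW _) Bw].
have rg (k : 'I_(2 * K).+1) : gv W r k = ut k.
  have nk := ndig_ge; case: (ltnP k (2 * K)) => hk.
    rewrite /gv nclkE hk (rd (3 + k)%N); last lia.
    by rewrite -[LHS]/(ut (3 + k - 3)%N) addKn.
  rewrite gv_out //; have -> : k = izero by apply/eqP; rewrite izeroP -leqNgt.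
  by move: (utE izero); rewrite U0 => -[].
have rr : represents W z (fun k => (gv W r k)%:Z).
  move=> x y n; have := rU (Some x) (Some y) n; rewrite /zt -!utE => ->.
  by rewrite !rg.
have [|t tN td] := @dig_exists W (fun i => if i == 0%N then rk q1 else if i == 1%N then rk q2
   else if i == 2%N then 0%N else minn (ut (i - 3)%N + del)%N (W * W)%N) (ndig W).
  move=> [|[|[|i]]] /=; rewrite ?rk_lt ?expn_gt0 //.
  by apply: leq_ltn_trans (geq_minr _ _) Bw.
have nk := ndig_ge.
have t0 : dig W t 0 = rk q1 by rewrite td //; lia.
have t1 : dig W t 1 = rk q2 by rewrite td //; lia.
have t2 : dig W t 2 = 0%N by rewrite td //; lia.
have tg x : (x < 2 * K)%N -> gv W t x = minn (gv W r x + del) (W * W).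
  move=> hx; have hx' : (x < (2 * K).+1)%N by apply: leqW.
  have -> : gv W r x = ut x by exact: (rg (Ordinal hx')).
  rewrite /gv nclkE hx (td (3 + x)%N); last lia.
  by rewrite -[LHS]/(minn (ut (3 + x - 3)%N + del) (W * W)) addKn.
have rt : codes t q1 (later v1 d) q2 (later v2 d).
  apply: (delay_codes v0 d0 (d' := d') _ rr (del := del)) => //.
    move=> y y0; rewrite /d'.
    by case: (leP y W%:R) => h1; case: (leP d W%:R) => h2 //;
      [rewrite min_r ?min_r // | rewrite !min_r // | rewrite !min_r //]; lra.
  move=> x n; rewrite rg utE delE; split.
    have := rU (Some x) None n; rewrite /zt => <-.
    by rewrite opprK.
  have := rU None (Some x) (- n); rewrite /zt rmorphN /= => h.
  transitivity (- d' - z x <= - n%:~R); first by rewrite -/z; apply/idP/idP; lra.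
  by rewrite h; apply/idP/idP; lia.
exists t; split=> //; rewrite /tdelay t0 t1 t2 e0 e1 e2 !eqxx !andTb.
apply/andP; split; last first.
  have [[_ _ inv _] _] := fields.
  by rewrite (csatP (codes_cmp1 rt) (inv q1)).
apply/hasP; exists r; first by rewrite mem_iota.
apply/hasP; exists del; first by rewrite mem_iota /=; lia.
apply/andP; split; last first.
  apply/allP => x; rewrite mem_iota nclkE add0n /= => hx.
  have hx' : (x < (2 * K).+1)%N by apply: leqW.
  by rewrite tg // eqxx andbT (rg (Ordinal hx')) utW.
apply/allP => x; rewrite mem_iota nclkE add0n => /andP[_ hx].
apply/allP => y; rewrite mem_iota add0n => /andP[_ hy].
apply/allP => n _.
have [a1 a2] := represents_nat (Ordinal hx) (Ordinal hy) n rp.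
have [b1 b2] := represents_nat (Ordinal hx) (Ordinal hy) n rr.
by rewrite /= in a1 a2 b1 b2; rewrite a1 a2 b1 b2 !eqxx.
Qed.

Lemma tdelay_sound s t q1 v1 q2 v2 : codes s q1 v1 q2 v2 ->
  (forall x, 0 <= v1 x) -> (forall x, 0 <= v2 x) -> tdelay W s t ->
  exists d, [/\ 0 <= d, sat (later v1 d) (ta_inv A q1) & codes t q1 (later v1 d) q2 (later v2 d)].
Proof.
move=> rs v10 v20; have [e0 e1 e2 hW rp] := rs; have v0 := vec_ge0 v10 v20.
set z := capz v1 v2 in rp.
have z0 k : 0 <= z k by rewrite /z /capz le_min v0 ler0n.
have zW k : z k <= W%:R by rewrite /z /capz ge_min lexx orbT.
case/andP=> /hasP[r rN /hasP[del _ /andP[ge /allP ht]]].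
case/andP=> /eqP t0 /andP[/eqP t1 /andP[_ /andP[/eqP t2 cs]]].
have rW k : (gv W r k <= W * W)%N.
  case: (ltnP k (2 * K)) => hk; last by rewrite gv_out.
  by have := ht k; rewrite mem_iota nclkE add0n hk => /(_ isT) /andP[].
have rr : represents W z (fun k => (gv W r k)%:Z).
  have gq (x y : 'I_(2 * K).+1) (n : nat) : (n <= W)%N ->
     ((gv W s x <= gv W s y + n * W) = (gv W r x <= gv W r y + n * W))%N /\
     ((gv W s x + n * W <= gv W s y) = (gv W r x + n * W <= gv W r y))%N.
    move=> hn; have /allP/(_ x) := ge; rewrite mem_iota nclkE add0n ltn_ord => /(_ isT).
    move/allP/(_ y); rewrite mem_iota ?nclkE add0n ltn_ord => /(_ isT).
    by move/allP/(_ n); rewrite mem_iota add0n ltnS hn => /(_ isT) /andP[/eqP-> /eqP->].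
  (* The test [gequiv] only covers offsets up to [W]; beyond that both sides are settled by the
     range of the capped values. *)
  move=> x y n; case: (leqP `|n| W) => hn; last first.
    have zx := z0 x; have zy := z0 y; have zx' := zW x; have zy' := zW y.
    have rx := rW x; have ry := rW y.
    have hWn : (W%:R : R) = (W%:Z)%:~R by [].
    case: (lerP 0 n) => n0.
      have hn' : (W%:R : R) <= n%:~R by rewrite hWn ler_int; lia.
      transitivity true; first by apply/idP; lra.
      by apply/esym/idP; nia.
    have hn' : n%:~R < - (W%:R : R) by rewrite hWn -rmorphN /= ltr_int; lia.
    transitivity false; first by apply/negbTE; rewrite -ltNge; lra.
    by apply/esym/negbTE; rewrite -ltNge; nia.
  case: n hn => n hn; rewrite ?NegzE.
    have [<- _] := represents_nat x y n rp; have [-> _] := gq x y n hn.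
    by apply/idP/idP; lia.
  rewrite rmorphN /=; have [_ <-] := represents_nat x y n.+1 rp; have [_ ->] := gq x y n.+1 hn.
  rewrite mulNr -PoszM lerBlDr [- _ + _]addrC lerBrDr -PoszD.
  by rewrite lez_nat.
have gz : (gv W r izero)%:Z = 0 by rewrite gv_out.
have [d d0 hd] := represents_delay W0 rr (capz0 v1 v2) gz (isT : 0 <= del%:Z).
exists d; have rt : codes t q1 (later v1 d) q2 (later v2 d).
  apply: (delay_codes v0 d0 (d' := d) _ rr (del := del)) => //; rewrite ?t0 ?t1 //.
    by move=> y y0; case: (leP y W%:R) => h //; rewrite !min_r //; lra.
  by move=> x hx; have := ht x; rewrite mem_iota nclkE add0n hx => /(_ isT) /andP[_ /eqP].
split=> //; have [[_ _ inv _] _] := fields.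
by rewrite -(csatP (codes_cmp1 rt) (inv q1)) -{1}e0 -t0.
Qed.

Lemma edge_at j : (j < nedg W)%N -> exists q g a r q',
  (q, g, Some a, r, q') \in ta_edges A /\ occurs w (edgp W j) (code_edge (q, g, Some a, r, q')).
Proof.
have [_ [-> oc]] := fields; case E : (ta_edges A) => [//|e0 es] hj.
have hj' : (j < size (ta_edges A))%N by rewrite E.
have := oc e0 j hj'; have := mem_nth e0 hj'; rewrite -E.
case: (nth e0 (ta_edges A) j) => [[[[q g] [a|]] r] q'] he o; last by have := epsf he.
by exists q, g, a, r, q'.
Qed.

Lemma edge_idx e : e \in ta_edges A ->
  exists2 j, j \in iota 0 (nedg W) & occurs w (edgp W j) (code_edge e).
Proof.
have [_ [nE oc]] := fields => he; exists (index e (ta_edges A)).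
  by rewrite mem_iota nE /= index_mem.
by have := oc e (index e (ta_edges A)); rewrite nth_index // index_mem; apply.
Qed.

Lemma cmpok_rst p u v (q : Q) (g : constraint X) (a : option S) r (q' : Q) : cmpok u v ->
  occurs w p (code_edge (q, g, a, r, q')) -> cmpok (rst W p u) (reset r v).
Proof.
move=> cu oc x c hc; have [_ _ _ hr _] := edge_fields Wbit Wsize oc.
rewrite /rst hr /reset; case: ifP => _; last exact: cu.
by rewrite ler0n lern0 leqn0 muln_eq0 (gtn_eqF W0) orbF.
Qed.

Lemma eokP p u v q0 (q : Q) (g : constraint X) (a : option S) r (q' : Q) : cmpok u v ->
  occurs w p (code_edge (q, g, a, r, q')) ->
  eok W (rk q0) u p = [&& q == q0, sat v g & sat (reset r v) (ta_inv A q')].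
Proof.
move=> cu oc; have [e1 og _ _ [e2 _]] := edge_fields Wbit Wsize oc.
have [[_ _ inv _] _] := fields.
rewrite /eok e1 e2 (csatP cu og) (csatP (cmpok_rst cu oc) (inv q')).
by rewrite val_eqE (inj_eq enum_rank_inj).
Qed.

Lemma ehighP p (q : Q) (g : constraint X) (a : S) r (q' : Q) : occurs w p (code_edge (q, g, Some a, r, q')) ->
  ehigh W p = (a \in H) /\ elabel W p = rk a.
Proof.
move=> oc; have [_ _ /(_ a erefl) ea _ _] := edge_fields Wbit Wsize oc.
by have [[_ _ _ hi] _] := fields; rewrite /ehigh /elabel ea hi.
Qed.

Lemma matchesP t q1 v1 q2 v2 p a : codes t q1 v1 q2 v2 -> elabel W p = rk a ->
  has (fun j' => matches W t p (edgp W j')) (iota 0 (nedg W)) <->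
  exists q' v', fires A q2 a v2 q' v'.
Proof.
move=> ct ea; have cu := codes_cmp2 ct; have [_ e1 _ _ _] := ct.
split=> [/hasP[j]|[q' [v' [g [r [he hs -> hi]]]]]].
  rewrite mem_iota add0n => /andP[_ /edge_at[q [g [b [r [q' [he oc]]]]]]].
  have [_ eb] := ehighP oc; rewrite /matches ea eb e1 (eokP _ cu oc).
  case/and4P=> /eqP/val_inj/enum_rank_inj eab /eqP eq hs hi.
  by rewrite eq eab in he; exists q', (reset r v2), g, r.
have [j hj oc] := edge_idx he; apply/hasP; exists j => //.
have [_ eb] := ehighP oc; rewrite /matches ea eb eqxx e1 (eokP _ cu oc).
by rewrite eqxx hs.
Qed.

(** Each new coordinate is an old one or the zero coordinate, so the new tuple is a reindexing of
    the old and all comparisons are inherited. *)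
Lemma codes_edge t s q1 v1 q2 v2 q1' v1' q2' v2' : codes t q1 v1 q2 v2 ->
  dig W s 0 = rk q1' -> dig W s 1 = rk q2' -> dig W s 2 = 0%N ->
  (forall x, (c1 W s (rk x) = c1 W t (rk x) /\ v1' x = v1 x) \/
             (c1 W s (rk x) = 0%N /\ v1' x = 0)) ->
  (forall x, (c2 W s (rk x) = c2 W t (rk x) /\ v2' x = v2 x) \/
             (c2 W s (rk x) = 0%N /\ v2' x = 0)) ->
  codes s q1' v1' q2' v2'.
Proof.
move=> [_ _ _ hW r] e0 e1 e2 h1 h2; split=> //.
  move=> k; case: (ltnP k (2 * K)) => [/idx_cases[[x ->]|[x ->]]|hk]; last by rewrite gv_out.
    by rewrite gv1; have [[-> _]|[-> _]] := h1 x; rewrite // -gv1.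
  by rewrite gv2; have [[-> _]|[-> _]] := h2 x; rewrite // -gv2.
have z0 v v' : Num.min (0 : R) W%:R = capz v v' izero by rewrite capz0 min_l // ler0n.
apply: represents_map r => k; rewrite /capz.
case: (ltnP k (2 * K)) => [/idx_cases[[x kx]|[x kx]]|hk].
- rewrite kx gv1 vec1; have [[-> ->]|[-> ->]] := h1 x.
    by exists k; rewrite kx gv1 vec1.
  by exists izero; rewrite gv_out // vec0.
- rewrite kx gv2 vec2; have [[-> ->]|[-> ->]] := h2 x.
    by exists k; rewrite kx gv2 vec2.
  by exists izero; rewrite gv_out // vec0.
by exists izero; rewrite !gv_out // !vec0.
Qed.

Lemma dig_lt s i : (dig W s i < sbase W)%N.
Proof. by rewrite /dig ltn_mod expn_gt0. Qed.

Lemma rst_lt p u x : (forall k, u k < sbase W)%N -> (rst W p u x < sbase W)%N.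
Proof. by move=> h; rewrite /rst; case: ifP => _; rewrite ?h ?expn_gt0. Qed.

Lemma state_exists a b f (u1 u2 : nat -> nat) : (a < sbase W)%N -> (b < sbase W)%N ->
  (f <= 1)%N -> (forall k, u1 k < sbase W)%N -> (forall k, u2 k < sbase W)%N ->
  exists s, [/\ (s < nst W)%N, dig W s 0 = a, dig W s 1 = b, dig W s 2 = f &
    forall k, (k < K)%N -> c1 W s k = u1 k /\ c2 W s k = u2 k].
Proof.
move=> ha hb hf h1 h2; have nk := ndig_ge.
have hf' : (f < sbase W)%N by apply: leq_ltn_trans (WW_lt W); have := W0; nia.
have [|s sN sd] := @dig_exists W (fun i => if i == 0%N then a else if i == 1%N then b
   else if i == 2%N then f else if (i - 3 < K)%N then u1 (i - 3)%N else u2 (i - 3 - K)%N) (ndig W).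
  by move=> [|[|[|i]]] //=; case: ifP.
exists s; split=> //; try by rewrite sd //; lia.
move=> k hk; rewrite /c1 /c2 nclkE !sd; try lia.
split.
  by rewrite -[LHS]/(if (3 + k - 3 < K)%N then u1 (3 + k - 3)%N else u2 (3 + k - 3 - K)%N)
    addKn hk.
by rewrite -[LHS]/(if (3 + (K + k) - 3 < K)%N then u1 (3 + (K + k) - 3)%N
  else u2 (3 + (K + k) - 3 - K)%N) addKn ltnNge leq_addr addKn.
Qed.

Lemma moved_ok p u u' : moved W p u u' <-> forall x : X, u' (rk x) = rst W p u (rk x).
Proof.
rewrite /moved nclkE; split=> [/allP h x|h].
  by apply/eqP; apply: h; rewrite mem_iota add0n enum_rank_lt_card.
apply/allP => k; rewrite mem_iota add0n => /andP[_ hk]; apply/eqP.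
by have := h (enum_val (Ordinal hk)); rewrite enum_valK.
Qed.

Lemma rst_cases p u v (q : Q) (g : constraint X) (a : option S) r (q' : Q) x : occurs w p (code_edge (q, g, a, r, q')) ->
  (rst W p u (rk x) = u (rk x) /\ reset r v x = v x :> R) \/
  (rst W p u (rk x) = 0%N /\ reset r v x = 0).
Proof.
move=> oc; have [_ _ _ hr _] := edge_fields Wbit Wsize oc.
by rewrite /rst hr /reset; case: ifP => _; [right | left].
Qed.

Lemma tedge_high t q1 v1 q2 v2 a q1' v1' : codes t q1 v1 q2 v2 -> a \in H ->
  fires A q1 a v1 q1' v1' ->
  exists s, [/\ (s < nst W)%N, tedge W t s & codes s q1' v1' q2 v2].
Proof.
move=> ct ha [g [r [he hs -> hi]]]; have [e0 e1 e2 _ _] := ct.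
have [j hj oc] := edge_idx he; have cu := codes_cmp1 ct.
set p := edgp W j in oc.
have [||s [sN s0 s1 s2 sc]] := @state_exists (rk q1') (rk q2) 0 (rst W p (c1 W t)) (c2 W t)
  (rk_lt _) (rk_lt _) isT; try by move=> k; rewrite ?rst_lt // ?dig_lt // => ?; apply: dig_lt.
have hc x := sc (rk x) (enum_rank_lt_card x).
exists s; split=> //.
  apply/hasP; exists j => //; have [_ _ _ _ [e _]] := edge_fields Wbit Wsize oc.
  rewrite -/p e0 (eokP _ cu oc) eqxx hs hi s0 s1 s2 e e1 !eqxx /=.
  have -> : moved W p (c1 W t) (c1 W s) by apply/moved_ok => x; case: (hc x).
  rewrite (ehighP oc).1 ha /= nclkE; apply/allP => k; rewrite mem_iota add0n => /andP[_ hk].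
  by rewrite (sc k hk).2.
apply: (codes_edge ct) => // x; rewrite ?(hc x).1 ?(hc x).2; first exact: rst_cases oc.
by left.
Qed.

Lemma tedge_both t q1 v1 q2 v2 a q1' v1' q2' v2' : codes t q1 v1 q2 v2 -> a \notin H ->
  fires A q1 a v1 q1' v1' -> sat v2 (ta_inv A q2) -> fires A q2 a v2 q2' v2' ->
  exists s, [/\ (s < nst W)%N, tedge W t s & codes s q1' v1' q2' v2'].
Proof.
move=> ct ha [g [r [he hs -> hi]]] hs2 [g' [r' [he' hs' -> hi']]].
have [e0 e1 e2 _ _] := ct; have [[_ _ inv _] _] := fields.
have [j hj oc] := edge_idx he; have cu := codes_cmp1 ct.
have [j' hj' oc'] := edge_idx he'; have cu' := codes_cmp2 ct.
set p := edgp W j in oc; set p' := edgp W j' in oc'.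
have [||s [sN s0 s1 s2 sc]] := @state_exists (rk q1') (rk q2') 0 (rst W p (c1 W t))
  (rst W p' (c2 W t)) (rk_lt _) (rk_lt _) isT;
  try by move=> k; rewrite ?rst_lt // ?dig_lt // => ?; apply: dig_lt.
have hc x := sc (rk x) (enum_rank_lt_card x).
exists s; split=> //.
  apply/hasP; exists j => //; have [_ _ _ _ [e _]] := edge_fields Wbit Wsize oc.
  have [_ _ _ _ [e' _]] := edge_fields Wbit Wsize oc'.
  rewrite -/p e0 (eokP _ cu oc) eqxx hs hi s0 s1 s2 e e1 !eqxx /=.
  have -> : moved W p (c1 W t) (c1 W s) by apply/moved_ok => x; case: (hc x).
  rewrite (ehighP oc).1 (negbTE ha) (csatP cu' (inv q2)) hs2 /=; apply/orP; left.
  apply/hasP; exists j' => //; rewrite -/p' /matches (ehighP oc).2 (ehighP oc').2 e1.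
  rewrite (eokP _ cu' oc') !eqxx hs' hi' e' eqxx /=.
  by apply/moved_ok => x; case: (hc x).
by apply: (codes_edge ct) => // x; rewrite ?(hc x).1 ?(hc x).2; [exact: rst_cases oc | exact: rst_cases oc'].
Qed.

Lemma tedge_low t q1 v1 q2 v2 a q1' v1' : codes t q1 v1 q2 v2 -> a \notin H ->
  fires A q1 a v1 q1' v1' ->
  ~ (sat v2 (ta_inv A q2) /\ exists q2' v2', fires A q2 a v2 q2' v2') ->
  exists s, [/\ (s < nst W)%N, tedge W t s & dig W s 2 = 1%N].
Proof.
move=> ct ha [g [r [he hs -> hi]]] nf.
have [e0 e1 e2 _ _] := ct; have [[_ _ inv _] _] := fields.
have [j hj oc] := edge_idx he; have cu := codes_cmp1 ct; have cu' := codes_cmp2 ct.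
set p := edgp W j in oc.
(* After a failure nothing but the flag is read from the second component, so its location digit is
   set to 0. *)
have [|||s [sN s0 s1 s2 sc]] := @state_exists (rk q1') 0 1 (rst W p (c1 W t)) (c2 W t)
  (rk_lt _) _ isT; try by move=> *; rewrite ?rst_lt // ?dig_lt ?expn_gt0 // => ?; apply: dig_lt.
have hc x := sc (rk x) (enum_rank_lt_card x).
exists s; split=> //.
apply/hasP; exists j => //; have [_ _ _ _ [e _]] := edge_fields Wbit Wsize oc.
rewrite -/p e0 (eokP _ cu oc) eqxx hs hi s0 s2 e !eqxx /=.
have -> : moved W p (c1 W t) (c1 W s) by apply/moved_ok => x; case: (hc x).
rewrite (ehighP oc).1 (negbTE ha) e1 (csatP cu' (inv q2)) /=; apply/orP; right.
apply/negP => /andP[h2 /(matchesP ct (ehighP oc).2) hf]; apply: nf; split=> //.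
Qed.

Lemma tedge_sound t s q1 v1 q2 v2 : codes t q1 v1 q2 v2 -> tedge W t s ->
  exists a q1' v1', fires A q1 a v1 q1' v1' /\
  [\/ a \in H /\ codes s q1' v1' q2 v2,
      a \notin H /\ sat v2 (ta_inv A q2) /\
        (exists q2' v2', fires A q2 a v2 q2' v2' /\ codes s q1' v1' q2' v2') |
      [/\ a \notin H, dig W s 2 = 1%N &
        ~ (sat v2 (ta_inv A q2) /\ exists q2' v2', fires A q2 a v2 q2' v2')]].
Proof.
move=> ct /hasP[j]; rewrite mem_iota add0n => /andP[_ /edge_at[q [g [a [r [q' [he oc]]]]]]].
have [e0 e1 e2 _ _] := ct; have [[_ _ inv _] _] := fields.
have cu := codes_cmp1 ct; have cu' := codes_cmp2 ct.
have [_ _ _ _ [et _]] := edge_fields Wbit Wsize oc.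
set p := edgp W j in oc et *; rewrite e0 e1 (eokP _ cu oc) et.
case/and4P=> /and3P[/eqP qq hs hi] /eqP s0 /moved_ok mv.
rewrite qq in he; have fr : fires A q1 a v1 q' (reset r v1) by exists g, r.
rewrite (ehighP oc).1 (csatP cu' (inv q2)) => h; exists a, q', (reset r v1); split=> //.
have r1 x : (c1 W s (rk x) = c1 W t (rk x) /\ reset r v1 x = v1 x) \/
             (c1 W s (rk x) = 0%N /\ reset r v1 x = 0).
  by rewrite mv; exact: rst_cases oc.
case: (boolP (a \in H)) h => ha.
  case/and3P=> /eqP s1 /eqP s2 /allP h2; constructor 1; split=> //.
  apply: (codes_edge ct) => // x; left; split=> //; apply/eqP; apply: h2.
  by rewrite mem_iota nclkE add0n enum_rank_lt_card.
case/orP=> [/and3P[h2 /eqP s2 /hasP[j']]|/andP[/eqP s2 hn]]; last first.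
  constructor 3; split=> // -[h2 hf]; move/negP: hn; apply; rewrite h2 /=.
  exact/(matchesP ct (ehighP oc).2).
rewrite mem_iota add0n => /andP[_ /edge_at[q3 [g' [b [r' [q'' [he' oc']]]]]]].
have [_ _ _ _ [et' _]] := edge_fields Wbit Wsize oc'.
rewrite /matches (ehighP oc).2 (ehighP oc').2 e1 (eokP _ cu' oc') et'.
case/andP=> /and4P[/eqP/val_inj/enum_rank_inj eab /eqP eq hs' hi'] /andP[/eqP s1 /moved_ok mv'].
rewrite eab eq in he'.
constructor 2; split=> //; split=> //; exists q'', (reset r' v2); split; first by exists g', r'.
by apply: (codes_edge ct) => // x; rewrite mv'; exact: rst_cases oc'.
Qed.

Lemma bad_path q1 v1 q2 v2 : bad A H q1 v1 q2 v2 ->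
  forall s, codes s q1 v1 q2 v2 -> (forall x, 0 <= v1 x) -> (forall x, 0 <= v2 x) ->
  exists p, path (fun a b => (b < nst W)%N && trans W a b) s p /\ dig W (last s p) 2 = 1%N.
Proof.
elim=> {q1 v1 q2 v2} [q1 v1 q2 v2 d a q1' v1' d_ge h ha f _ IH
  | q1 v1 q2 v2 d a q1' v1' d_ge h ha f nf
  | q1 v1 q2 v2 d a q1' v1' q2' v2' d_ge h ha f h2 f2 _ IH] s cs p1 p2;
  have [t [tN td ct]] := tdelay_complete cs d_ge p1 p2 h;
  have p1' := later_ge0 d_ge p1; have p2' := later_ge0 d_ge p2.
- have [s' [s'N te cs']] := tedge_high ct ha f.
  have [p [pp pl]] := IH s' cs' (fires_ge0 p1' f) p2'.
  exists (s' :: p); rewrite /= pp s'N andbT; split=> //.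
  by apply/hasP; exists t; rewrite ?mem_iota ?td.
- have [s' [s'N te cs']] := tedge_low ct ha f nf.
  exists [:: s']; rewrite /= s'N andbT; split=> //.
  by apply/hasP; exists t; rewrite ?mem_iota ?td.
have [s' [s'N te cs']] := tedge_both ct ha f h2 f2.
have [p [pp pl]] := IH s' cs' (fires_ge0 p1' f) (fires_ge0 p2' f2).
exists (s' :: p); rewrite /= pp s'N andbT; split=> //.
by apply/hasP; exists t; rewrite ?mem_iota ?td.
Qed.

(** The invariant looks backwards: a bad pair coded by [s] would make the initial pair bad. It
    survives transitions without recording how [s] was reached. A state whose flag is 1 codes no
    pair, so there only the first alternative is possible. *)
Definition goodst (s : nat) : Prop :=
  bad A H (ta_init A) (fun _ => 0 : R) (ta_init A) (fun _ => 0) \/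
  exists q1 v1 q2 v2, [/\ codes s q1 v1 q2 v2, (forall x, 0 <= v1 x), (forall x, 0 <= v2 x) &
    bad A H q1 v1 q2 v2 -> bad A H (ta_init A) (fun _ => 0 : R) (ta_init A) (fun _ => 0)].

Lemma goodst_trans s s' : (s' < nst W)%N -> goodst s -> trans W s s' -> goodst s'.
Proof.
move=> _ [?|[q1 [v1 [q2 [v2 [cs p1 p2 hb]]]]]]; first by left.
case/hasP=> t _ /andP[td te].
have [d [d_ge h ct]] := tdelay_sound cs p1 p2 td.
have p1' := later_ge0 d_ge p1; have p2' := later_ge0 d_ge p2.
have [a [q1' [v1' [f]]]] := tedge_sound ct te.
case=> [[ha cs']|[ha [h2 [q2' [v2' [f2 cs']]]]]|[ha _ nf]].
- right; exists q1', v1', q2, (later v2 d); split=> //; first exact: fires_ge0 p1' f.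
  by move=> b; apply: hb; apply: bad_high d_ge h ha f b.
- right; exists q1', v1', q2', v2'; split=> //; [exact: fires_ge0 p1' f|exact: fires_ge0 p2' f2|].
  by move=> b; apply: hb; apply: bad_both d_ge h ha f h2 f2 b.
by left; apply: hb; apply: bad_low d_ge h ha f nf.
Qed.

Lemma sinitP s : sinit W s ->
  codes s (ta_init A) (fun _ => 0) (ta_init A) (fun _ => 0).
Proof.
have [[_ eI _ _] _] := fields.
case/and4P=> /eqP s0 /eqP s1 /eqP s2 /allP h.
have g0 k : gv W s k = 0%N.
  case: (ltnP k (2 * K)) => hk; last by rewrite gv_out.
  by apply/eqP; apply: h; rewrite mem_iota nclkE.
have v0 k : vec (fun _ => 0 : R) (fun _ => 0) k = 0.
  case: (ltnP k (2 * K)) => [/idx_cases[[x ->]|[x ->]]|hk]; last by rewrite vec0.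
    by rewrite vec1.
  by rewrite vec2.
split; rewrite ?s0 ?s1 ?eI //; first by move=> k; rewrite g0.
move=> x y n; rewrite /capz !v0 !g0 !subrr -[0 : R]/(0%:~R) ler_int.
by apply/idP/idP; have := W0; nia.
Qed.

Lemma insecureP : insecure W <->
  bad A H (ta_init A) (fun _ => 0 : R) (ta_init A) (fun _ => 0).
Proof.
have N0 : (0 < nst W)%N by rewrite expn_gt0 expn_gt0.
split=> [/hasP[s sN /andP[si /hasP[s' s'N /andP[/eqP s2 hr]]]]|b].
  rewrite mem_iota add0n /= in sN; rewrite mem_iota add0n /= in s'N.
  rewrite !modn_small // in hr.
  have gs : goodst s.
    by right; exists (ta_init A), (fun _ => 0), (ta_init A), (fun _ => 0); split=> //; exact: sinitP.
  have [//|[q1 [v1 [q2 [v2 [[_ _ e2 _ _] _ _ _]]]]]] :=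
    rch_sound (P := goodst) (fun a b hb ga => goodst_trans hb ga) sN s'N hr gs.
  by rewrite s2 in e2.
have [[_ eI _ _] _] := fields.
have iB : (rk (ta_init A) < sbase W)%N by exact: rk_lt.
have [||s [sN s0 s1 s2 sc]] := @state_exists _ _ 0 (fun _ => 0%N) (fun _ => 0%N) iB iB isT;
  try by move=> k; rewrite expn_gt0.
have si : sinit W s.
  rewrite /sinit s0 s1 s2 eI !eqxx /=; apply/allP => k; rewrite mem_iota nclkE add0n => /andP[_ hk].
  case/idx_cases: hk => [[x ->]|[x ->]]; have [h1 h2] := sc (rk x) (enum_rank_lt_card x).
    by rewrite gv1 h1.
  by rewrite gv2 h2.
have [p [pp pl]] := bad_path b (sinitP si) (fun _ => lexx 0) (fun _ => lexx 0).
apply/hasP; exists s; rewrite ?mem_iota // si /=.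
have lastN x q : (x < nst W)%N -> path (fun a b => (b < nst W)%N && trans W a b) x q ->
    all (fun y => (y < nst W)%N) (x :: q).
  elim: q x => [|y q IH] x xN /=; rewrite xN //= => /andP[/andP[yN _] hq].
  exact: IH.
(* Repetitions are removed from the path, so that its length falls below the number of states and
   Savitch's depth suffices. *)
move: pl; case/shortenP: pp => p' pp' up _ pl.
have al := lastN _ _ sN pp'.
have lN : (last s p' < nst W)%N by move/allP: al; apply; apply: mem_last.
apply/hasP; exists (last s p'); rewrite ?mem_iota // pl eqxx /= !modn_small //.
apply: rch_path => //.
rewrite expnM -/(sbase W) -/(nst W); apply: ltnW.
have -> : nst W = size (iota 0 (nst W)) by rewrite size_iota.
apply: (uniq_leq_size (s1 := s :: p')) => // y /(allP al) hy.
by rewrite mem_iota.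
Qed.

End Correctness.

(** * Membership in PSPACE *)

Lemma f_ndig W : PS W -> PS (fun e => ndig (W e)).
Proof. by move=> fW; rewrite /ndig; feas. Qed.

Lemma small_ndig W : PS W -> small_fun (fun e => ndig (W e)).
Proof.
move=> fW; apply: small_fun_add (small_fun_const _).
by apply: small_fun_mul (small_fun_const _) _; apply: small_fun_log.
Qed.

Lemma f_sbase W : PS W -> PS (fun e => sbase (W e)).
Proof. by move=> fW; apply: f_pow; [exact: f_const | exact: f_ndig | exact: small_ndig]. Qed.

Lemma f_nst W : PS W -> PS (fun e => nst (W e)).
Proof. by move=> fW; apply: f_pow; [exact: f_sbase | exact: f_ndig | exact: small_ndig]. Qed.

Lemma f_dig W s i : PS W -> PS s -> PS i -> PS (fun e => dig (W e) (s e) (i e)).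
Proof.
move=> fW fs fi; apply: f_mod; last exact: f_sbase.
by apply: f_div_iter => //; exact: f_sbase.
Qed.

Lemma f_c1 W s x : PS W -> PS s -> PS x -> PS (fun e => c1 (W e) (s e) (x e)).
Proof. by move=> fW fs fx; apply: f_dig => //; feas. Qed.

Lemma f_c2 W s x : PS W -> PS s -> PS x -> PS (fun e => c2 (W e) (s e) (x e)).
Proof. by move=> fW fs fx; apply: f_dig => //; feas. Qed.

Lemma f_gv W s k : PS W -> PS s -> PS k -> PS (fun e => gv (W e) (s e) (k e)).
Proof.
move=> fW fs fk; rewrite /gv; apply: f_if; [by feas | | exact: f_const].
by apply: f_dig => //; feas.
Qed.

Lemma f_gcmp o x y : PS o -> PS x -> PS y -> PS (fun e => gcmp (o e) (x e) (y e)).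
Proof.
move=> fo fx fy; rewrite /gcmp.
by do 4!(apply: f_ifb; [by feas | by feas |]); feas.
Qed.

Lemma f_csat W (u : env -> nat -> nat) p : PS W -> feasible1 (expn 2) u -> PS p ->
  PS (fun e => csat (W e) (u e) (p e)).
Proof.
move=> fW fu fp; rewrite /csat; apply: f_all; first by feas.
rewrite /feasible1; apply: f_gcmp; [by feas | | by feas].
apply: (@f_app1 _ _ (fun e => u (fun j => e j.+1))
  (fun e => nval (W (fun j => e j.+1)) (item (aend (W (fun j => e j.+1)))
     (W (fun j => e j.+1)) (p (fun j => e j.+1)) (e 0)))); last by feas.
exact: (@f_ren _ (fun j => if j is j'.+1 then j'.+2 else 0) _ fu).
Qed.

Ltac feas_hook2 := lazymatch goal with
  | |- feasible _ (fun e => ndig (@?a e)) => apply (@f_ndig a)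
  | |- feasible _ (fun e => nst (@?a e)) => apply (@f_nst a)
  | |- feasible _ (fun e => dig (@?a e) (@?b e) (@?c e)) => apply (@f_dig a b c)
  | |- feasible _ (fun e => c1 (@?a e) (@?b e) (@?c e)) => apply (@f_c1 a b c)
  | |- feasible _ (fun e => c2 (@?a e) (@?b e) (@?c e)) => apply (@f_c2 a b c)
  | |- feasible _ (fun e => gv (@?a e) (@?b e) (@?c e)) => apply (@f_gv a b c)
  | |- feasible _ (fun e => nat_of_bool (csat (@?a e) (@?u e) (@?c e))) => apply (@f_csat a u c)
  | |- feasible _ (fun e => rst (@?w e) (@?p e) (@?u e) (@?x e)) =>
      apply (@f_if _ _ (fun e => inreset (w e) (p e) (x e)) (fun _ => 0) (fun e => u e (x e)))
  | |- feasible _ (fun e => nat_of_bool (bit (@?a e) (@?b e))) => apply (@f_bit _ _ a b)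
  | |- feasible _ (fun e => nat_of_bool (inreset (@?a e) (@?b e) (@?c e))) => apply (@f_inreset _ _ a b c)
  | |- feasible _ (fun e => nend (@?a e) (@?b e)) => apply (@f_nend _ _ a b)
  | |- feasible _ (fun e => nval (@?a e) (@?b e)) => apply (@f_nval _ _ a b)
  | |- feasible _ (fun e => elab (@?a e) (@?b e)) => apply (@f_elab _ _ a b)
  | |- feasible _ (fun e => etgt (@?a e) (@?b e)) => apply (@f_etgt _ _ a b)
  | |- feasible _ (fun e => nclk (@?a e)) => apply (@f_nclk _ _ a)
  | |- feasible _ (fun e => pact (@?a e)) => apply (@f_pact _ _ a)
  | |- feasible _ (fun e => pini (@?a e)) => apply (@f_pini _ _ a)
  | |- feasible _ (fun e => nedg (@?a e)) => apply (@f_nedg _ _ a)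
  | |- feasible _ (fun e => pinv (@?a e) (@?b e)) => apply (@f_pinv _ _ a b)
  | |- feasible _ (fun e => edgp (@?a e) (@?b e)) => apply (@f_edgp _ _ a b)
  | |- feasible _ (fun e => item succn (@?a e) (@?b e) (@?i e)) =>
      apply (@f_item _ _ (fun _ => succn) a b (@f_succ1 _ _))
  end.
Ltac feas_hook ::= feas_hook2.

Lemma f_gequiv W s r : PS W -> PS s -> PS r -> PS (fun e => gequiv (W e) (s e) (r e)).
Proof. by move=> fW fs fr; rewrite /gequiv; feas. Qed.

Lemma f_eok W q (u : env -> nat -> nat) p : PS W -> PS q -> feasible1 (expn 2) u -> PS p ->
  PS (fun e => eok (W e) (q e) (u e) (p e)).
Proof.
move=> fW fq fu fp; rewrite /eok; apply: f_and; first by feas.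
apply: f_and; first by apply: f_csat => //; feas.
apply: f_csat => //; last by feas.
rewrite /feasible1 /rst; apply: f_if; [by feas | exact: f_const | exact: fu].
Qed.

Ltac feas_hook3 := lazymatch goal with
  | |- feasible _ (fun e => nat_of_bool (gequiv (@?a e) (@?b e) (@?c e))) => apply (@f_gequiv a b c)
  | |- feasible _ (fun e => nat_of_bool (eok (@?a e) (@?b e) (@?u e) (@?c e))) => apply (@f_eok a b u c)
  | _ => feas_hook2
  end.
Ltac feas_hook ::= feas_hook3.

Lemma f_tdelay W s t : PS W -> PS s -> PS t -> PS (fun e => tdelay (W e) (s e) (t e)).
Proof. by move=> fW fs ft; rewrite /tdelay; feas. Qed.

Lemma f_matches W t p p' : PS W -> PS t -> PS p -> PS p' ->
  PS (fun e => matches (W e) (t e) (p e) (p' e)).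
Proof. by move=> fW ft fp fp'; rewrite /matches /elabel; feas. Qed.

Ltac feas_hook4 := lazymatch goal with
  | |- feasible _ (fun e => nat_of_bool (tdelay (@?a e) (@?b e) (@?c e))) => apply (@f_tdelay a b c)
  | |- feasible _ (fun e => nat_of_bool (matches (@?a e) (@?b e) (@?c e) (@?d e))) =>
      apply (@f_matches a b c d)
  | _ => feas_hook3
  end.
Ltac feas_hook ::= feas_hook4.

Lemma f_tedge W t s : PS W -> PS t -> PS s -> PS (fun e => tedge (W e) (t e) (s e)).
Proof.
move=> fW ft fs; rewrite /tedge /moved /ehigh /elabel.
apply: f_has; first by feas.
rewrite /feasible1; apply: f_and; first by feas.
apply: f_and; first by feas.
apply: f_and; first by feas.
by apply: f_ifb; feas.
Qed.

Lemma f_trans W s s' : PS W -> PS s -> PS s' -> PS (fun e => trans (W e) (s e) (s' e)).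
Proof.
move=> fW fs fs'; rewrite /trans; apply: f_has; first by feas.
by rewrite /feasible1; apply: f_and; [apply: f_tdelay | apply: f_tedge]; feas.
Qed.

Lemma nst_gt0 W : 0 < nst W. Proof. by rewrite !expn_gt0. Qed.

Lemma f_insecure W : PS W -> PS (fun e => insecure (W e)).
Proof.
move=> fW; rewrite /insecure /sinit; apply: f_has; first by feas.
rewrite /feasible1; apply: f_and; first by feas.
apply: f_has; first by feas.
rewrite /feasible1; apply: f_and; first by feas.
apply: (@f_rch (fun e => trans (W (fun j => e j.+2))) (fun e => nst (W (fun j => e j.+2)))
  (fun e => ndig (W (fun j => e j.+2)) * ndig (W (fun j => e j.+2)))
  (fun e => e 1 %% nst (W (fun j => e j.+2))) (fun e => e 0 %% nst (W (fun j => e j.+2)))).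
- by apply: f_trans; feas.
- by feas.
- by feas.
- by apply: small_fun_mul; apply: small_ndig; feas.
- by feas.
- by feas.
- by move=> e; rewrite ltn_mod nst_gt0.
by move=> e; rewrite ltn_mod nst_gt0.
Qed.

(** * Reading the input into a counter, and the decision procedure *)

Lemma bval_rcons l b : bval (rcons l b) = bval l + b * 2 ^ size l.
Proof. by elim: l => [|c l IH] /=; [rewrite muln1 addn0 | rewrite IH expnS; lia]. Qed.

Lemma bit_bval l i : bit (bval l) i = nth false l i.
Proof.
elim: l i => [|b l IH] i; first by rewrite /bit div0n nth_nil.
case: i => [|i]; first by rewrite /bit divn1 /= oddD odd_double oddb addbF.
rewrite /= -IH /bit expnS divnMA; congr (odd (_ %/ _)).
by rewrite divn2 halfD odd_double andbF doubleK; case: b.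
Qed.

Lemma bval_lt l : bval l < 2 ^ size l.
Proof. by elim: l => //= b l IH; rewrite expnS; case: b; lia. Qed.

Definition cdouble := CSeq (CLoop 2 (CSeq (CInc 3) (CInc 3))) (CLoop 3 (CInc 2)).
Definition cadd := CSeq (CLoop 2 (CSeq (CInc 1) (CInc 3))) (CLoop 3 (CInc 2)).

Definition regs (a b : nat) : nat -> nat := upd (upd (fun _ => 0) 1 a) 2 b.

Lemma exec_double V w a b i : b + b < V ->
  exists t, exec V w cdouble (regs a b) i (regs a (b + b)) i [::] t.
Proof.
move=> hV.
have := @execs_loop V w 2 (CSeq (CInc 3) (CInc 3)) b
  (fun k => upd (regs a (b - k)) 3 (k + k)) (fun _ => 2) (fun _ => [::]) i.
rewrite flatten_nil subn0 subnn => H.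
have [||t1 _ e1] := H.
- by move=> k hk; rewrite /regs; updv.
- move=> k hk; set s := upd _ 2 _.
  have s3 : s 3 = k + k by rewrite /s; updv.
  apply: (@execs_seq0 _ _ _ _ _ _ _ _ 1 _ _ _ 1).
    by apply: execs_inc; rewrite s3; lia.
  rewrite [X in execs _ _ _ _ _ X](_ : _ = upd (upd s 3 (s 3).+1) 3 (upd s 3 (s 3).+1 3).+1).
    by apply: execs_inc; rewrite upd_eq s3; lia.
  by rewrite upd_eq upd_upd s3 /s /regs; updsolve.
have [|t2 _ e2] := @execs_move V w 3 2 (upd (regs a 0) 3 (b + b)) i isT.
  by rewrite /regs; updv.
have E1 : upd (regs a b) 3 (0 + 0) = regs a b by rewrite /regs; updsolve.
rewrite E1 in e1; exists (t1 + t2); rewrite -[[::]]/([::] ++ [::]); apply: (ESeq e1).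
move: e2; rewrite [X in exec _ _ _ _ _ X](_ : _ = regs a (b + b)) //.
by rewrite /regs; updsolve.
Qed.

Lemma exec_add V w a b i : a + b < V ->
  exists t, exec V w cadd (regs a b) i (regs (a + b) b) i [::] t.
Proof.
move=> hV.
have := @execs_loop V w 2 (CSeq (CInc 1) (CInc 3)) b
  (fun k => upd (regs (a + k) (b - k)) 3 k) (fun _ => 2) (fun _ => [::]) i.
rewrite flatten_nil subn0 subnn addn0 => H.
have [||t1 _ e1] := H.
- by move=> k hk; rewrite /regs; updv.
- move=> k hk; set s := upd _ 2 _.
  have s1 : s 1 = a + k by rewrite /s /regs; updv.
  have s3 : upd s 1 (s 1).+1 3 = k by rewrite /s /regs; updv.
  apply: (@execs_seq0 _ _ _ _ _ _ _ _ 1 _ _ _ 1).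
    by apply: execs_inc; rewrite s1; lia.
  rewrite [X in execs _ _ _ _ _ X](_ : _ = upd (upd s 1 (s 1).+1) 3 (upd s 1 (s 1).+1 3).+1).
    by apply: execs_inc; rewrite s3; lia.
  by rewrite s3 s1 /s /regs; updsolve.
have [|t2 _ e2] := @execs_move V w 3 2 (upd (regs (a + b) 0) 3 b) i isT.
  by rewrite /regs; updv.
have E1 : upd (regs a b) 3 0 = regs a b by rewrite /regs; updsolve.
rewrite E1 in e1; exists (t1 + t2); rewrite -[[::]]/([::] ++ [::]); apply: (ESeq e1).
move: e2; rewrite [X in exec _ _ _ _ _ X](_ : _ = regs (a + b) b) //.
by rewrite /regs; updsolve.
Qed.

(** Register 2 runs through the powers of two while register 1 sums up those of the bits set. The
    last loop adds the power reached at the end of the input, a leading one that forces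
    [2 ^ size w <= W] even if the input ends in zeros. *)
Definition creadnum := CSeq (CInc 2) (CSeq (CReadAll cdouble (CSeq cadd cdouble)) (CLoop 2 (CInc 1))).

Lemma exec_readnum V w : 2 ^ (size w).+1 < V ->
  exists t, exec V w creadnum (fun _ => 0) 0 (regs (bval (rcons w true)) 0) (size w) [::] t.
Proof.
move=> hV.
have V2 : 1 < V by apply: leq_ltn_trans hV; rewrite expn_gt0.
have loop k i : i + k = size w ->
  exists t, exec V w (CReadAll cdouble (CSeq cadd cdouble))
    (regs (bval (take i w)) (2 ^ i)) i (regs (bval w) (2 ^ size w)) (size w) [::] t.
  elim: k i => [|k IH] i ik.
    exists 2; have -> : i = size w by lia.
    by rewrite take_size; apply: EReadEnd.
  have iw : i < size w by lia.
  have [|t2 e2] := IH i.+1; first lia.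
  have tE := take_nth false iw; have st : size (take i w) = i by rewrite size_take iw.
  have p1 : 2 ^ i + 2 ^ i < V.
    apply: leq_ltn_trans hV; rewrite addnn -mul2n -expnS leq_exp2l //; lia.
  have vl := bval_lt (take i w); rewrite st in vl.
  have [t1 e1] : exists t, exec V w (if nth false w i then CSeq cadd cdouble else cdouble)
     (regs (bval (take i w)) (2 ^ i)) i.+1 (regs (bval (take i.+1 w)) (2 ^ i.+1)) i.+1 [::] t.
    rewrite tE bval_rcons st expnS mul2n -addnn; case: nth.
      have [|ta ea] := @exec_add V w (bval (take i w)) (2 ^ i) i.+1; first lia.
      have [td ed] := @exec_double V w (bval (take i w) + 2 ^ i) (2 ^ i) i.+1 p1.
      by exists (ta + td); rewrite mul1n -[[::]]/([::] ++ [::]); apply: ESeq ea ed.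
    by rewrite mul0n addn0; apply: exec_double.
  by exists (t1 + t2 + 2); rewrite -[[::]]/([::] ++ [::]); apply: ERead iw e1 e2.
have [t1 e1] := loop (size w) 0 (add0n _).
have bl := bval_lt w.
have [|t2 _ e2] := @execs_move V w 2 1 (regs (bval w) (2 ^ size w)) (size w) isT.
  by apply: leq_ltn_trans hV; rewrite expnS /regs /upd /=; lia.
exists (1 + (t1 + t2)); rewrite -[[::]]/([::] ++ ([::] ++ [::])).
apply: (@ESeq _ _ _ _ _ _ (regs 0 1) 0).
  have -> : regs 0 1 = upd (fun _ => 0) 2 1 by rewrite /regs; updsolve.
  exact: EInc.
rewrite take0 in e1; apply: (ESeq e1).
move: e2; rewrite [X in exec _ _ _ _ _ X](_ : _ = regs (bval (rcons w true)) 0) //.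
by rewrite bval_rcons mul1n /regs; updsolve.
Qed.

Theorem SNNI_in_PSPACE (R : realType) : in_PSPACE (SNNI_problem R).
Proof.
have fs : PS (fun e => ~~ insecure (e 0)) by apply/f_neg/f_insecure/f_var.
have [mx [ct [[c hc] _ [k [cc hm]] _]]] := fs.
(* Variable 0 lives in register 1, where the number is read; all other variables share register 0,
   which is never written. *)
pose rho := fun j => if j == 0 then 1 else 0.
have [P hP] : exists P : {poly nat}, forall n, pb cc n.+1 + (n + 2) + n + 3 <= P.[n]%R.
  have p1 : polyb (fun n => pb cc n.+1).
    apply: (@polyb_comp (pb cc) succn); first exact: polyb_pb.
      by exists 1 => n; rewrite /pb expn1 mul1n.
    exact: pb_mono.
  apply: polyb_horner; apply: polyb_add (polyb_const 3); apply: polyb_add polyb_id.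
  by apply: polyb_add p1 _; apply: polyb_add polyb_id (polyb_const 2).
exists (decider (CSeq creadnum (c rho 2)) 2), P => I.
set w := encode I; set W := bval (rcons w true); set n := size w.
have Wlt : W < 2 ^ n.+1 by have := bval_lt (rcons w true); rewrite size_rcons.
(* The first summand accommodates the evaluation of [insecure] on a number of at most [n.+1] digits,
   the second the powers of two used while reading. *)
pose B := pb cc n.+1 + (n + 2).
pose e := fun j => regs W 0 (rho j).
have me : mx e < 2 ^ B.
  apply: (@leq_trans (2 ^ pb cc n.+1)); last by rewrite leq_exp2l // leq_addr.
  by apply: hm => -[|j] _ /=; rewrite /e /regs /rho /upd //= expn_gt0.
have [|t1 e1] := @exec_readnum (2 ^ B) w.
  by rewrite -/n ltn_exp2l // /B; lia.
have [||t2 _ e2] := hc rho 2 (regs W 0) n (2 ^ B) w _ _ me.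
- by case.
- by move=> j hj; rewrite /regs; updv.
have ex := ESeq e1 e2; rewrite cats0 in ex.
have [sp [t ht]] := decider_correct 2 ex.
split.
  by move=> t' i; apply: leq_trans (sp t' i) _; apply: leq_trans (hP n); rewrite /B -/n; lia.
exists t, (~~ insecure W); split; first by move: ht; rewrite upd_eq; case: insecure.
have Wbit i : i < size w -> bit W i = nth false w i.
  by move=> hi; rewrite bit_bval nth_rcons hi.
have Wsize : 2 ^ size w <= W by rewrite /W bval_rcons mul1n leq_addl.
have ins : insecure W <-> bad (si_ta I) (si_high I) (ta_init (si_ta I)) (fun _ => 0%R : R)
    (ta_init (si_ta I)) (fun _ => 0%R).
  by eapply insecureP; [exact: (@si_eps_free _ I) | | exact: Wbit | exact: Wsize].
have sb := SNNI_bad (@si_eps_free R I) (@si_det R I).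
split=> [/negP h|h]; first by apply/sb => b; apply: h; apply/ins.
by apply/negP => /ins; apply/sb.
Qed.

(** * Strings output in polynomial time *)

(** All registers are restored, so that outputs can be concatenated. A single [ct] bounds both the
    counters and the steps, since here both must be polynomial. *)
Definition emits (f : env -> seq bool) (ct : env -> nat) :=
  exists c : (nat -> nat) -> nat -> cmd, forall rho d sg i V w,
    (forall j, rho j < d) -> (forall j, d <= j -> sg j = 0) ->
    let e := fun j => sg (rho j) in ct e < V ->
    execs V w (c rho d) sg i sg i (f e) (ct e).

Definition emittable (f : env -> seq bool) := exists2 ct, emits f ct & bnd succn ct.

Definition emittable1 (F : env -> nat -> seq bool) :=
  emittable (fun e => F (fun j => e j.+1) (e 0)).

Lemma e_ext f g : f =1 g -> emittable f -> emittable g.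
Proof. by move=> h; have -> // : g = f by apply/funext. Qed.

Lemma e_nil : emittable (fun _ => [::]).
Proof.
exists (fun _ => 0); last exact: bnd_const.
by exists (fun _ _ => CSkip) => rho d sg i V w _ _ e _; exists 0 => //; apply: ESkip.
Qed.

Lemma e_cat f g : emittable f -> emittable g -> emittable (fun e => f e ++ g e).
Proof.
move=> [ct [c hc] b] [ct' [c' hc'] b']; exists (fun e => ct e + ct' e); last exact: bnd_add.
exists (fun rho d => CSeq (c rho d) (c' rho d)) => rho d sg i V w hr hz e he.
by apply: execs_seq; [apply: hc | apply: hc'] => //; rewrite -/e; lia.
Qed.

Lemma e_const s : emittable (fun _ => s).
Proof.
elim: s => [|b s IH]; first exact: e_nil.
rewrite -cat1s; apply: (@e_cat (fun _ => [:: b])) => //.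
exists (fun _ => 1); last exact: bnd_const.
by exists (fun _ _ => COut b) => rho d sg i V w _ _ e _; exists 1 => //; apply: EOut.
Qed.

Lemma e_ren xi f : emittable f -> emittable (fun e => f (fun j => e (xi j))).
Proof.
move=> [ct [c hc] b]; exists (fun e => ct (fun j => e (xi j))); last exact: bnd_ren.
by exists (fun rho d => c (fun j => rho (xi j)) d) => rho d sg i V w hr hz e he; apply: hc.
Qed.

Lemma e_for n F : PV n -> emittable1 F ->
  emittable (fun e => flatten (mkseq (F e) (n e))).
Proof.
move=> [mx [ctn [[cn hn] bn bmx bct]]] [ct [c hc] b].
pose cF e k := ct (scons k e).
have bF : ubnd succn n cF.
  pose h e := ct (fun j => if j is j'.+1 then e j'.+2 else e 0).
  have bh : bnd succn h.
    by have := bnd_ren (fun j => if j is j'.+1 then j'.+2 else 0) b; congr bnd;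
      apply/funext => e; congr ct; apply/funext => -[].
  apply: ubnd_le (ubnd_env bn bh (ubnd_const n (bnd_const 0))) => e i _.
  have -> // : cF e i = h (scons i (scons 0 e)).
  by rewrite /cF /h; congr ct; apply/funext => -[].
exists (fun e => ctn e + mx e + 3 * n e + 4 + \sum_(k < n e) (cF e k + 3)).
  exists (fun rho d => CSeq (cn rho d) (CSeq
    (CLoop d (CSeq (c (scons d.+1 rho) d.+2) (CInc d.+1))) (CLoop d.+1 CSkip))).
  move=> rho d sg i V w hr hz e he; set N := n e in he *.
  have hk k : k < N -> cF e k <= \sum_(k < N) (cF e k + 3).
    by move=> h; rewrite (bigD1 (Ordinal h)) //=; lia.
  pose st k := upd (upd sg d (N - k)) d.+1 k.
  apply: (@execs_le _ _ _ _ _ _ _ _ (ctn e + (\sum_(k < N) (cF e k + 1 + 2) + 1 + (2 * N + 1)))).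
    set A := (A in _ + (A + 1 + _)); set B := (B in _ <= _ + B).
    have -> : A = B by apply: eq_bigr => k _; lia.
    lia.
  apply: execs_seq0; first by apply: hn => //; rewrite -/e; lia.
  rewrite -/e -/N; have -> : upd sg d N = st 0.
    rewrite /st subn0 [RHS]upd0 //; rewrite upd_neq ?hz //; lia.
  rewrite -[flatten _]cats0; apply: (@execs_seq _ _ _ _ _ _ (st N)); last first.
    have sN : st N d.+1 = N by rewrite /st upd_eq.
    have -> : sg = upd (st N) d.+1 0.
      by rewrite /st subnn upd_upd !upd0 // ?upd_neq ?hz //; lia.
    by have := @execs_clear V w d.+1 (st N) i; rewrite sN; apply.
  apply: (execs_loop (tt := fun k => cF e k + 1)).
    by move=> k hk'; rewrite /st; updv.
  move=> k hkN; set s1 := upd _ _ _.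
  have s1z j : d.+2 <= j -> s1 j = 0 by move=> hj; rewrite /s1 /st !upd_neq ?hz //; lia.
  have s1d : s1 d.+1 = k by rewrite /s1 /st; updv.
  have e3 : (fun j => s1 (scons d.+1 rho j)) = scons k e.
    apply/funext => -[|j] //=.
    by rewrite /s1 /st !upd_neq //; have := hr j; lia.
  have e4 : (fun j => s1 (rho j)) = e.
    by apply/funext => j; have := congr1 (fun f => f j.+1) e3.
  rewrite -[F e k]cats0; apply: (@execs_seq _ _ _ _ _ _ s1 i).
    have:= hc (scons d.+1 rho) d.+2 s1 i V w; rewrite /= e3 e4 s1d; apply => //.
      by move=> [|j] //=; have := hr j; lia.
    apply: leq_ltn_trans (hk k hkN) _; apply: leq_ltn_trans he; exact: leq_addl.
  have -> : st k.+1 = upd s1 d.+1 (s1 d.+1).+1 by rewrite s1d /s1 /st; updsolve.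
  by apply: execs_inc; rewrite s1d; lia.
apply: bnd_add; first apply: bnd_add (bnd_const 4).
  apply: bnd_add; first exact: bnd_add.
  by apply: bnd_mul => //; exact: bnd_const.
apply: (bnd_sum (F := fun e k => cF e k + 3)) => //.
by apply: ubnd_add => //; exact: (ubnd_const _ (bnd_const 3)).
Qed.

(** A conditional is a loop executed [p e] times, that is 0 or 1 times. *)
Lemma e_if (p : env -> bool) f : PV p -> emittable f ->
  emittable (fun e => if p e then f e else [::]).
Proof.
move=> fp ef; apply: (@e_ext (fun e => flatten (mkseq (fun _ => f e) (p e)))).
  by move=> e; case: (p e) => //=; rewrite cats0.
by apply: e_for => //; exact: (@e_ren succn).
Qed.

Lemma e_ifelse (p : env -> bool) f g : PV p -> emittable f -> emittable g ->
  emittable (fun e => if p e then f e else g e).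
Proof.
move=> fp ef eg.
apply: (@e_ext (fun e => (if p e then f e else [::]) ++ (if ~~ p e then g e else [::]))).
  by move=> e; case: (p e); rewrite ?cats0.
by apply: e_cat; apply: e_if => //; apply: f_neg.
Qed.

Lemma e_bit (p : env -> bool) : PV p -> emittable (fun e => [:: p e]).
Proof.
move=> fp; apply: (@e_ext (fun e => if p e then [:: true] else [:: false])).
  by move=> e; case: (p e).
by apply: e_ifelse => //; exact: e_const.
Qed.

Lemma e_code_nat a : PV a -> emittable (fun e => code_nat (a e)).
Proof.
move=> fa.
apply: (@e_ext (fun e => flatten (mkseq (fun i => [:: true] ++ [:: odd (a e %/ 2 ^ i)])
   (trunc_log 2 (a e)).+1) ++ [:: false])).
  move=> e; rewrite /code_nat /code_seq; congr (flatten _ ++ _).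
  by rewrite /mkseq -map_comp.
apply: e_cat; last exact: e_const.
apply: e_for; first by feas.
rewrite /emittable1; apply: e_cat; [exact: e_const | apply: e_bit].
by feas.
Qed.

Lemma e_flatten (T : Type) (F : T -> env -> seq bool) l : (forall x, emittable (F x)) ->
  emittable (fun e => flatten [seq F x e | x <- l]).
Proof. by move=> h; elim: l => [|x l IH] /=; [exact: e_nil | exact: e_cat]. Qed.

Section Transducer.
Variables (f1 f2 : env -> seq bool) (F0 F1 : env -> nat -> seq bool).
Hypothesis ef1 : emittable f1.
Hypothesis ef2 : emittable f2.
Hypothesis eF0 : emittable1 F0.
Hypothesis eF1 : emittable1 F1.

(* Two passes over the input: the first one counts its length. *)
Definition output (w : seq bool) : seq bool :=
  let e := scons (size w) (fun _ => 0) in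
  f1 e ++ flatten (mkseq (fun j => if nth false w j then F1 e j else F0 e j) (size w)) ++ f2 e.

Lemma transducer_exists : exists (M : turing_machine) (p : {poly nat}),
  forall w, outputs_in_time M w (output w) p.[size w]%R.
Proof.
have [ct1 [cd1 h1] [k1 [b1 B1]]] := ef1; have [ct2 [cd2 h2] [k2 [b2 B2]]] := ef2.
have [cg0 [cd3 h3] [k3 [b3 B3]]] := eF0; have [cg1 [cd4 h4] [k4 [b4 B4]]] := eF1.
pose rho := fun j => if j == 0 then 1 else 0.
pose prog := CSeq (CReadAll (CInc 1) (CInc 1)) (CSeq (ccopy 1 2) (CSeq (CLoop 2 CLeft)
  (CSeq (cd1 rho 2) (CSeq (CReadAll (CSeq (cd3 (scons 2 rho) 3) (CInc 2))
     (CSeq (cd4 (scons 2 rho) 3) (CInc 2))) (CSeq (CLoop 2 CSkip) (cd2 rho 2)))))).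
pose T n := (3 * n + 2) + ((7 * n + 2) + ((3 * n + 1) + (pb b1 n +
  (n * (pb b3 n + pb b4 n + 3) + 2 + ((2 * n + 1) + pb b2 n))))).
have pT : polyb T by rewrite /T; polyt.
have [P hP] : exists P : {poly nat}, forall n, T n * ((T n + n).*2 + 6) <= P.[n]%R.
  apply: polyb_horner; apply: polyb_mul => //; apply: polyb_add (polyb_const 6).
  apply: (@polyb_le _ (fun n => 2 * (T n + n))); first by move=> n; rewrite mul2n.
  by apply: polyb_mul (polyb_const 2) _; apply: polyb_add pT polyb_id.
exists (transducer prog), P => w; set n := size w.
(* Bounding the number of digits by the values themselves is wasteful but still polynomial. *)
set B := T n + n; set V := 2 ^ B.
have TV : B < V by apply: ltn_expl.
pose sn (a b : nat) : nat -> nat := upd (upd (fun _ => 0) 1 a) 2 b.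
have snE a b : sn a b = upd (upd (fun _ => 0) 1 a) 2 b by [].
have s0 a : sn a 0 = upd (fun _ => 0) 1 a.
  by rewrite snE upd0 // upd_neq.
have eE : (fun j => sn n 0 (rho j)) = scons n (fun _ => 0).
  by apply/funext => -[|j]; rewrite /sn /rho /upd.
have eE1 k : (fun j => sn n k (rho j)) = scons n (fun _ => 0).
  by apply/funext => -[|j]; rewrite /sn /rho /upd.
have eE2 k : (fun j => sn n k (scons 2 rho j)) = scons k (scons n (fun _ => 0)).
  by apply/funext => -[|[|j]]; rewrite /sn /rho /upd.
have sm1 kk : small_env succn kk n (scons n (fun _ => 0)) by move=> [|j] _ /=.
have sm2 kk k : k <= n -> small_env succn kk n (scons k (scons n (fun _ => 0))).
  by move=> hk [|[|j]] _ //=.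
have r2 j : rho j < 2 by rewrite /rho; case: eqP.
have z2 a j : 2 <= j -> sn a 0 j = 0 by move=> hj; rewrite /sn; updv.
have c1n : ct1 (scons n (fun _ => 0)) <= pb b1 n by have := B1 _ _ (sm1 k1); rewrite ltnS.
have c2n : ct2 (scons n (fun _ => 0)) <= pb b2 n by have := B2 _ _ (sm1 k2); rewrite ltnS.
have c3n k : k <= n -> cg0 (scons k (scons n (fun _ => 0))) <= pb b3 n.
  by move=> hk; have := B3 _ _ (sm2 k3 k hk); rewrite ltnS.
have c4n k : k <= n -> cg1 (scons k (scons n (fun _ => 0))) <= pb b4 n.
  by move=> hk; have := B4 _ _ (sm2 k4 k hk); rewrite ltnS.
have hT : 20 * n + pb b1 n + pb b2 n <= 2 * T n by rewrite /T; lia.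
have hTn : n < T n by rewrite /T; lia.
have hTb1 : pb b1 n < T n by rewrite /T; lia.
have hTb2 : pb b2 n < T n by rewrite /T; lia.
have hTb3 : 0 < n -> pb b3 n + pb b4 n < T n by rewrite /T; nia.
have ex1 : execs V w (CReadAll (CInc 1) (CInc 1)) (fun _ => 0) 0 (sn n 0) n [::] (3 * n + 2).
  suff H k i : i + k = n -> execs V w (CReadAll (CInc 1) (CInc 1)) (sn i 0) i (sn n 0) n [::] (3 * k + 2).
    by have := H n 0 (add0n _); rewrite s0 upd0.
  elim: k i => [|k IH] i ik.
    have -> : i = n by lia.
    by exists 2 => //; apply: EReadEnd.
  have [|t ht ex] := IH i.+1; first lia.
  exists (1 + t + 2); first lia.
  rewrite -[[::]]/([::] ++ [::]); apply: ERead ex; first by rewrite -/n; lia.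
  rewrite if_same; have -> : sn i.+1 0 = upd (sn i 0) 1 (sn i 0 1).+1 by rewrite /sn; updsolve.
  by apply: EInc; rewrite /sn /upd /=; lia.
have ex2 : execs V w (ccopy 1 2) (sn n 0) n (sn n n) n [::] (7 * n + 2).
  have -> : sn n n = upd (sn n 0) 2 (sn n 0 1) by rewrite /sn; updsolve.
  by apply: execs_copy => //; rewrite /sn /upd /=; lia.
have ex3 : execs V w (CLoop 2 CLeft) (sn n n) n (sn n 0) 0 [::] (3 * n + 1).
  suff H k : execs V w (CLoop 2 CLeft) (sn n k) k (sn n 0) 0 [::] (3 * k + 1) by exact: H.
  elim: k => [|k [t ht ex]]; first by exists 1 => //; apply: ELoop0.
  exists (1 + t + 2); first lia.
  rewrite -[[::]]/([::] ++ [::]); apply: (ELoopS (n := k)) ex; first by [].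
  rewrite /sn upd_upd; exact: ELeft.
have ex4 : execs V w (cd1 rho 2) (sn n 0) 0 (sn n 0) 0 (f1 (scons n (fun _ => 0))) (pb b1 n).
  have := h1 rho 2 (sn n 0) 0 V w r2 (z2 n); rewrite /= eE => H.
  by apply: execs_le (H _) => //; lia.
have ex5 : execs V w (CReadAll (CSeq (cd3 (scons 2 rho) 3) (CInc 2))
     (CSeq (cd4 (scons 2 rho) 3) (CInc 2))) (sn n 0) 0 (sn n n) n
    (flatten (mkseq (fun j => if nth false w j then F1 (scons n (fun _ => 0)) j
        else F0 (scons n (fun _ => 0)) j) n)) (n * (pb b3 n + pb b4 n + 3) + 2).
  set G := fun j => _.
  suff H k i : i + k = n -> execs V w (CReadAll (CSeq (cd3 (scons 2 rho) 3) (CInc 2))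
     (CSeq (cd4 (scons 2 rho) 3) (CInc 2))) (sn n i) i (sn n n) n
     (flatten [seq G j | j <- iota i k]) (k * (pb b3 n + pb b4 n + 3) + 2).
    exact: H n 0 (add0n _).
  elim: k i => [|k IH] i ik.
    have -> : i = n by lia.
    by exists 2 => //; apply: EReadEnd.
  have [|t ht ex] := IH i.+1; first lia.
  have inc : execs V w (CInc 2) (sn n i) i.+1 (sn n i.+1) i.+1 [::] 1.
    have -> : sn n i.+1 = upd (sn n i) 2 (sn n i 2).+1 by rewrite /sn; updsolve.
    by apply: execs_inc; rewrite /sn /upd /=; lia.
  have r3 j : scons 2 rho j < 3 by case: j => [|j] //=; apply: leqW.
  have z3 j : 3 <= j -> sn n i j = 0 by move=> hj; rewrite /sn; updv.
  have iw : i < size w by rewrite -/n; lia.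
  have hb := hTb3 ltac:(lia).
  have i_n : i <= n by lia.
  have c3i := c3n i i_n; have c4i := c4n i i_n.
  have [t1 ht1 e1] : execs V w (if nth false w i then CSeq (cd4 (scons 2 rho) 3) (CInc 2)
       else CSeq (cd3 (scons 2 rho) 3) (CInc 2)) (sn n i) i.+1 (sn n i.+1) i.+1 (G i)
       (pb b3 n + pb b4 n + 1).
    rewrite /G; case: nth; rewrite -[X in execs _ _ _ _ _ _ _ X]cats0.
      apply: execs_le (execs_seq (T1 := pb b4 n) _ inc); first lia.
      have := h4 (scons 2 rho) 3 (sn n i) i.+1 V w r3 z3; rewrite /= eE2 eE1 => H.
      by apply: execs_le (H _) => //; lia.
    apply: execs_le (execs_seq (T1 := pb b3 n) _ inc); first lia.
    have := h3 (scons 2 rho) 3 (sn n i) i.+1 V w r3 z3; rewrite /= eE2 eE1 => H.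
    by apply: execs_le (H _) => //; lia.
  by exists (t1 + t + 2); [lia | apply: ERead iw e1 ex].
have ex6 : execs V w (CLoop 2 CSkip) (sn n n) n (sn n 0) n [::] (2 * n + 1).
  have := @execs_clear V w 2 (sn n n) n; have -> : sn n n 2 = n by [].
  by rewrite {2}/sn upd_upd.
have ex7 : execs V w (cd2 rho 2) (sn n 0) n (sn n 0) n (f2 (scons n (fun _ => 0))) (pb b2 n).
  have := h2 rho 2 (sn n 0) n V w r2 (z2 n); rewrite /= eE => H.
  by apply: execs_le (H _) => //; lia.
have [t ht ex] := execs_seq0 ex1 (execs_seq0 ex2 (execs_seq0 ex3 (execs_seq ex4
  (execs_seq ex5 (execs_seq0 ex6 ex7))))).
have [t' [b [h h' h'']]] := transducer_correct ex.
exists t', b; split=> //; apply: leq_trans h (leq_trans _ (hP n)).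
by rewrite leq_mul.
Qed.

End Transducer.

(** * Simulating a space-bounded machine by a timed automaton *)

Section RankLemmas.

(** The encoding replaces locations and clocks by their ranks; explicit formulas for these let the
    reduction produce them by arithmetic. *)
Lemma enum_rank_index (T : finType) (x : T) : enum_rank x = index x (enum T) :> nat.
Proof.
rewrite -{2}(nth_enum_rank x x) index_uniq ?enum_uniq //.
by rewrite -cardE ltn_ord.
Qed.

Lemma enum_option (T : finType) : enum {: option T} = None :: map Some (enum T).
Proof. by rewrite !enumT [in LHS]unlock. Qed.

Lemma rank_None (T : finType) : enum_rank (None : option T) = 0 :> nat.
Proof. by rewrite enum_rank_index enum_option. Qed.

Lemma rank_Some (T : finType) (x : T) : enum_rank (Some x) = (enum_rank x).+1 :> nat.
Proof.
rewrite !enum_rank_index enum_option /= index_map //.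
by move=> ? ? [].
Qed.

Lemma enum_sum (T U : finType) : enum {: T + U} = map inl (enum T) ++ map inr (enum U).
Proof. by rewrite !enumT [in LHS]unlock. Qed.

Lemma rank_inl (T U : finType) (x : T) : enum_rank (inl x : T + U) = enum_rank x :> nat.
Proof.
rewrite !enum_rank_index enum_sum index_cat mem_map; last by move=> ? ? [].
by rewrite mem_enum index_map // => ? ? [].
Qed.

Lemma rank_inr (T U : finType) (x : U) : enum_rank (inr x : T + U) = #|T| + enum_rank x :> nat.
Proof.
rewrite !enum_rank_index enum_sum index_cat.
have -> : (inr x \in map inl (enum T)) = false by apply/mapP => -[].
rewrite size_map -cardE index_map // => ? ? [].
by [].
Qed.

Lemma index_allpairs (T U : eqType) (s : seq T) (t : seq U) x y :
  x \in s -> y \in t ->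
  index (x, y) [seq (a, b) | a <- s, b <- t] = index x s * size t + index y t.
Proof.
elim: s => //= a s IH xs yt; rewrite index_cat.
have [<-|ne] := eqVneq a x.
  rewrite mem_map ?yt; last by move=> ? ? [].
  by rewrite index_map ?mul0n // => ? ? [].
have -> : ((x, y) \in [seq (a, b) | b <- t]) = false.
  by apply/mapP => -[b _ [e _]]; rewrite e eqxx in ne.
rewrite size_map IH //; last by move: xs; rewrite inE eq_sym (negbTE ne).
by rewrite mulSn addnA.
Qed.

Lemma rank_pair (T U : finType) (x : T) (y : U) :
  enum_rank (x, y) = enum_rank x * #|U| + enum_rank y :> nat.
Proof.
have e : enum {: T * U} = [seq (a, b) | a <- enum T, b <- enum U].
  by rewrite [LHS]enumT Finite.enum.unlock.
by rewrite !enum_rank_index cardE e index_allpairs // mem_enum.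
Qed.

Lemma rank_ord n (i : 'I_n) : enum_rank i = i :> nat.
Proof. by rewrite enum_rank_ord. Qed.

End RankLemmas.

(** * The automaton simulating a machine on [s] cells *)

Section Reduction.
Variables (M : turing_machine).
Notation k := (tm_tapes M).
Notation Sym := (tm_symbol M).
Notation St := (tm_state M).

(* A column collects a cell of each tape, marked if the head is there. *)
Definition colT : finType := {ffun 'I_k.+1 -> Sym * bool}.
(** The action depends on the symbols under all heads, whereas cells to the left of a head are
    rewritten before that head is met; hence these symbols are guessed when the pass starts. *)
Definition guess : finType := {ffun 'I_k.+1 -> Sym}.
(* State and symbols read, then the contents of the previous and current cells. *)
Definition passT : finType := (St * guess * option colT * colT)%type.

Definition blankcol : colT := [ffun _ => (tm_blank M, false)].

Definition initcol (o : option bool) (first : bool) : colT :=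
  [ffun i => (if i == ord0 then oapp (tm_input M) (tm_blank M) o else tm_blank M, first)].

(* The component [a] of [x] is the old contents of the left neighbour, missing at
   the left end of the tape, and [c] that of the right neighbour. *)
Definition newcol (x : passT) (c : colT) : colT :=
  let: (q, g, a, b) := x in
  let act := (tm_delta q g).2 in
  [ffun i =>
    (if (b i).2 then (act i).1 else (b i).1,
     [|| (b i).2 && (if (act i).2 is MoveStay then true
                     else if (act i).2 is MoveLeft then ~~ a else false),
         oapp (fun a' : colT => (a' i).2) false a && (if (act i).2 is MoveRight then true else false) |
         (c i).2 && (if (act i).2 is MoveLeft then true else false)])].

Arguments newcol : simpl never.

(** Verifies the guess at the marked cells. A complete pass meets every head, so no wrong guess
    survives it. *)
Definition agrees (x : passT) : bool :=
  let: (q, g, a, b) := x in [forall i, (b i).2 ==> ((b i).1 == g i)].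

Section Automaton.
Variables (s : nat) (inp : nat -> option bool).

Definition loc : finType := option (St + 'I_s.+1 * option passT)%type.
Definition clk : finType := option ('I_s * colT)%type.

Definition fin : loc := None.
Definition ready (q : St) : loc := Some (inl q).
Definition ini (j : 'I_s.+1) : loc := Some (inr (j, None)).
Definition pas (j : 'I_s.+1) (x : passT) : loc := Some (inr (j, Some x)).

Definition lo (j : 'I_s) : 'I_s.+1 := widen_ord (leqnSn s) j.
Definition hi (j : 'I_s) : 'I_s.+1 := lift ord0 j.

Definition tclk : clk := None.
Definition xclk (j : 'I_s) (d : colT) : clk := Some (j, d).

Definition tedg := edge loc clk bool.

Definition E_fin : seq tedg := [:: (fin, [::], Some false, finset.set0, fin)].
Definition E_rej : seq tedg :=
  [seq (ready q, [::], Some true, finset.set0, fin) | q <- enum St & tm_verdict q == Some false].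
Definition E_start : seq tedg :=
  [seq (ready x.1.1, [:: (tclk, CmpEq, 1)], Some true, [set tclk],
        pas ord0 (x.1.1, x.1.2, None, x.2))
  | x : St * guess * colT <- enum {: St * guess * colT} & tm_verdict x.1.1 == None].
(** The whole initialisation takes place at time 1, so that the clocks of the actual contents end up
    one unit behind all others. *)
Definition e_ini (j : 'I_s) : tedg :=
  (ini (lo j), [:: (tclk, CmpEq, 1)], Some true, [set xclk j (initcol (inp j) (j == 0 :> nat))],
   ini (hi j)).
Definition E_iend : seq tedg :=
  [:: (ini ord_max, [:: (tclk, CmpEq, 1)], Some true, [set tclk], ready (tm_start M))].
(** The guard on [tclk] makes the pass instantaneous. The second component [x.2] is a guess for the
    next column; it is needed now because a head moving left from there enters this cell, and it is
    tested by the guard of the next step. *)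
Definition E_step (j : 'I_s) : seq tedg :=
  [seq (pas (lo j) x.1, [:: (tclk, CmpEq, 0); (xclk j x.1.2, CmpLe, 1)], Some true,
        [set xclk j (newcol x.1 x.2)],
        pas (hi j) (x.1.1.1.1, x.1.1.1.2, Some x.1.2, x.2))
  | x : passT * colT <- enum {: passT * colT} & agrees x.1].
(** The column guessed for the nonexistent cell [s] has no clock to be tested against, so it is
    required to be blank and unmarked. *)
Definition E_end : seq tedg :=
  [seq (pas ord_max x, [:: (tclk, CmpEq, 0)], Some true, finset.set0,
        ready (tm_delta x.1.1.1 x.1.1.2).1)
  | x : passT <- enum passT & x.2 == blankcol].

Definition redges : seq tedg :=
  E_fin ++ E_rej ++ E_start ++ map e_ini (enum 'I_s) ++ E_iend ++
  flatten (map E_step (enum 'I_s)) ++ E_end.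

Definition no_inv (q : loc) : constraint clk := [::].
Lemma no_inv_upper q : upper_bounded (no_inv q). Proof. by []. Qed.

Definition rta : timed_automaton loc clk bool :=
  TimedAutomaton (ini ord0) redges no_inv_upper.

Definition rhigh : {set bool} := [set true].

Lemma redgesP e : e \in redges ->
  [\/ e = (fin, [::], Some false, finset.set0, fin),
      exists2 q, tm_verdict q = Some false & e = (ready q, [::], Some true, finset.set0, fin) |
      [\/ exists q g b, tm_verdict q = None /\
            e = (ready q, [:: (tclk, CmpEq, 1)], Some true, [set tclk], pas ord0 (q, g, None, b)),
          exists j, e = e_ini j |
      [\/ e = (ini ord_max, [:: (tclk, CmpEq, 1)], Some true, [set tclk], ready (tm_start M)),
          exists j q g a b c, agrees (q, g, a, b) /\
            e = (pas (lo j) (q, g, a, b), [:: (tclk, CmpEq, 0); (xclk j b, CmpLe, 1)], Some true,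
                 [set xclk j (newcol (q, g, a, b) c)], pas (hi j) (q, g, Some b, c)) |
          exists q g a, e = (pas ord_max (q, g, a, blankcol), [:: (tclk, CmpEq, 0)], Some true, finset.set0,
                 ready (tm_delta q g).1)]]].
Proof.
rewrite /redges !mem_cat => /or4P[|||/or4P[|||]].
- by rewrite inE => /eqP ->; constructor 1.
- case/mapP=> q; rewrite mem_filter => /andP[/eqP hv _] ->.
  by constructor 2; exists q.
- case/mapP=> -[[q g] b]; rewrite mem_filter => /andP[/eqP hv _] ->.
  by constructor 3; constructor 1; exists q, g, b.
- by case/mapP=> j _ ->; constructor 3; constructor 2; exists j.
- by rewrite inE => /eqP ->; constructor 3; constructor 3; constructor 1.
- case/flatten_mapP=> j _ /mapP[[[[[q g] a] b] c]]; rewrite mem_filter => /andP[ha _] ->.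
  by constructor 3; constructor 3; constructor 2; exists j, q, g, a, b, c.
case/mapP=> -[[[q g] a] b]; rewrite mem_filter => /andP[/eqP /= -> _] ->.
by constructor 3; constructor 3; constructor 3; exists q, g, a.
Qed.

Lemma rta_eps_free : epsilon_free rta.
Proof.
move=> q g a r q' /redgesP.
by case=> [[_ _ -> _ _]|[? _ [_ _ -> _ _]]|[[? [? [? [_ [_ _ -> _ _]]]]]|[? [_ _ -> _ _]]|
  [[_ _ -> _ _]|[? [? [? [? [? [? [_ [_ _ -> _ _]]]]]]]]|[? [? [? [_ _ -> _ _]]]]]]].
Qed.

Lemma rta_low q g r q' : (q, g, Some false, r, q') \in redges ->
  q = fin /\ r = finset.set0 /\ q' = fin.
Proof.
move/redgesP.
by case=> [[-> _ -> ->]|[? _ []]|[[? [? [? [_ []]]]]|[? []]|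
  [[]|[? [? [? [? [? [? [_ []]]]]]]]|[? [? [? []]]]]]].
Qed.

(** The loop at [fin] is the only low-level edge, and there are no silent ones. *)
Lemma rta_det (R : realType) : deterministic R (delete_actions rta rhigh).
Proof.
move=> q g g' a r r' q' q''; rewrite !mem_filter.
case: a => [[]|].
- by rewrite inE.
- by move=> /andP[_ /rta_low[_ [-> ->]]] /andP[_ /rta_low[_ [-> ->]]].
by move=> /andP[_ he]; have := rta_eps_free he.
Qed.

Definition rinst (R : realType) : SNNI_instance R :=
  SNNIInstance rta_eps_free (rta_det (R := R)).

End Automaton.
End Reduction.

(** * Runs of the automaton against runs of the machine *)

Section SimulationCorrect.
Variables (R : realType) (M : turing_machine) (w : seq bool) (s : nat).
Hypothesis heads : forall t i, cfg_head (tm_run M w t) i < s.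

Notation run m := (tm_run M w m).
Notation config := (config M).

Definition inp (j : nat) : option bool := if j < size w then Some (nth false w j) else None.

Definition col (c : config) (j : nat) : colT M :=
  [ffun i => (cfg_tape c i j, cfg_head c i == j)].
Definition reading (c : config) : guess M := [ffun i => cfg_tape c i (cfg_head c i)].
Definition acol (c : config) (j : nat) : option (colT M) :=
  if j is j'.+1 then Some (col c j') else None.

(** Of the right neighbour only the head marks enter the new column, so the guess [cc] need not have
    the right symbols. *)
Lemma newcol_col c j (cc : colT M) : tm_verdict (cfg_state c) = None ->
  (forall i, (cc i).2 = (cfg_head c i == j.+1)) ->
  newcol (cfg_state c, reading c, acol c j, col c j) cc = col (tm_step c) j.
Proof.
move=> hv hc; apply/ffunP => i; rewrite !ffunE /tm_step hv /newcol hc.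
rewrite -/(reading c); case: tm_delta => q' act /=.
rewrite [j == _]eq_sym; congr pair.
case: (act i).2 => /=; rewrite ?andbT ?andbF ?orbF ?orFb //.
  by case: j hc => [|j] _ /=; rewrite ?andbT ?andbF; case: (cfg_head c i) => [|[|h]].
case: j hc => [|j] _ /=; rewrite ?andbF ?ffunE //=.
Qed.

Lemma col_init j : col (run 0) j = initcol M (inp j) (j == 0).
Proof.
apply/ffunP => i; rewrite !ffunE /= [0 == j]eq_sym; congr pair.
rewrite /written /inp; case: eqP => _; last by rewrite nth_nil.
case: ltnP => h; first by rewrite (nth_map false).
by rewrite nth_default // size_map.
Qed.

Local Open Scope ring_scope.

Notation clk := (clk M s).
Notation loc := (loc M s).
Notation A := (rta M s inp).

Implicit Types (v : clk -> R) (c : config).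

(** Clocks of wrong contents are only bounded below, since nothing keeps them from growing. The gap
    of one unit is what the guard of the next pass detects: at [tau = 1] the right clocks equal 1
    and the others are at least 2. *)
Definition resting c (tau : R) v :=
  v (tclk M s) = tau /\ forall (i : 'I_s) d,
  if d == col c i then v (xclk i d) = tau else 1 + tau <= v (xclk i d).

Definition ncol c (g : guess M) (j : nat) (b : colT M) (i : nat) : colT M :=
  newcol (cfg_state c, g, acol c i, col c i) (if i.+1 == j then b else col c i.+1).

(* In the middle of a pass the cells before [j] have been rewritten, the last
   of them on the basis of the guess [b] for the contents of cell [j]. *)
Definition passing c g (j : nat) (b : colT M) v :=
  v (tclk M s) = 0 /\ forall (i : 'I_s) d,
  if (i < j)%N then if d == ncol c g j b i then v (xclk i d) = 0 else 1 <= v (xclk i d)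
  else if d == col c i then v (xclk i d) = 1 else 2 <= v (xclk i d).

Definition initial (j : nat) (tau : R) v :=
  v (tclk M s) = tau /\ forall (i : 'I_s) d,
  v (xclk i d) = if (i < j)%N && (d == col (run 0) i) then tau - 1 else tau.

Lemma resting_later c tau v d : resting c tau v -> resting c (tau + d) (later v d).
Proof.
move=> [ht h]; split; first by rewrite /later ht.
move=> i x; have := h i x; rewrite /later; case: ifP => _; first by move=> ->.
by move=> ?; lra.
Qed.

Lemma initial_later j tau v d : initial j tau v -> initial j (tau + d) (later v d).
Proof.
move=> [ht h]; split; first by rewrite /later ht.
by move=> i x; rewrite /later h; case: ifP => _ //; rewrite addrAC.
Qed.

Lemma passing_start c g b v : resting c 1 v -> passing c g 0 b (reset [set tclk M s] v).
Proof.
move=> [_ h]; split; first by rewrite /reset inE eqxx.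
by move=> i d; rewrite /= /reset inE /=; exact: h.
Qed.

Lemma passing_step c g (j : 'I_s) cc v : passing c g j (col c j) v ->
  passing c g j.+1 cc (reset [set xclk j (newcol (cfg_state c, g, acol c j, col c j) cc)] v).
Proof.
move=> [ht h]; split; first by rewrite /reset inE.
move=> i d; have := h i d; rewrite /reset inE /xclk.
have -> : (Some (i, d) == Some (j, newcol (cfg_state c, g, acol c j, col c j) cc) :> clk) =
  (i == j) && (d == newcol (cfg_state c, g, acol c j, col c j) cc) by [].
rewrite ltnS; case: (ltngtP i j) => ij.
- have -> : (i == j) = false by apply/negbTE; rewrite -val_eqE /= ltn_eqF.
  rewrite /= /ncol eqSS (ltn_eqF ij).
  by have -> : (if i.+1 == j then col c j else col c i.+1) = col c i.+1 by case: eqP => [->|].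
- by have -> : (i == j) = false by apply/negbTE; rewrite -val_eqE /= gtn_eqF.
have -> : i = j by apply: val_inj.
rewrite eqxx andTb /ncol eqxx; case: (d == newcol _ _) => //.
by case: (d == col _ _) => [->|] //; lra.
Qed.

(** The blank column assumed beyond the last cell is harmless: no head is ever at cell [s], and only
    the marks are used. *)
Lemma resting_end m v : tm_verdict (cfg_state (run m)) = None ->
  passing (run m) (reading (run m)) s (blankcol M) v -> resting (run m.+1) 0 v.
Proof.
move=> hv [ht h]; split=> // i d; have := h i d; rewrite ltn_ord.
have -> : ncol (run m) (reading (run m)) s (blankcol M) i = col (run m.+1) i.
  apply: newcol_col => // k; case: eqP => [e|_]; rewrite !ffunE //=.
  by apply/esym/negbTE; rewrite ltn_eqF // e.
by case: ifP => _ //; rewrite addr0.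
Qed.

Lemma initial_step (j : 'I_s) v : initial j 1 v ->
  initial j.+1 1 (reset [set xclk j (initcol M (inp j) (j == 0%N :> nat))] v).
Proof.
move=> [ht h]; split; first by rewrite /reset inE.
move=> i d; rewrite /reset inE h -col_init subrr ltnS.
have -> : (xclk i d == xclk j (col (run 0) j)) = (i == j) && (d == col (run 0) j) by [].
case: (ltngtP i j) => ij.
- by have -> : (i == j) = false by apply/negbTE; rewrite -val_eqE /= ltn_eqF.
- by have -> : (i == j) = false by apply/negbTE; rewrite -val_eqE /= gtn_eqF.
have -> : i = j by apply: val_inj.
by rewrite eqxx /=.
Qed.

Lemma initial_end v : initial s 1 v -> resting (run 0) 0 (reset [set tclk M s] v).
Proof.
move=> [ht h]; split; first by rewrite /reset inE eqxx.
move=> i d; rewrite /reset inE /= h ltn_ord /=.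
by case: (d == _); rewrite ?subrr ?addr0.
Qed.

Definition rejects := exists m, tm_verdict (cfg_state (run m)) = Some false.

(** An invariant of the reachable states. If time has passed during a pass, the run is stuck and
    nothing more is claimed. The guess [g] has to be right only on the tapes whose head lies in a
    cell already rewritten. *)
Definition good (q : loc) v : Prop :=
  match q with
  | None => rejects
  | Some (inl q) => exists m tau, [/\ 0 <= tau, cfg_state (run m) = q & resting (run m) tau v]
  | Some (inr (j, None)) => exists2 tau, 0 <= tau & initial j tau v
  | Some (inr (j, Some (q, g, a, b))) =>
      0 < v (tclk M s) \/ exists m, [/\ cfg_state (run m) = q, tm_verdict q = None,
        a = acol (run m) j,
        forall i, (cfg_head (run m) i < j)%N -> g i = reading (run m) i &
        passing (run m) g j b v]
  end.

Lemma good_later q v d : 0 <= d -> good q v -> good q (later v d).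
Proof.
move=> d0; case: q => [[q|[j [[[[q g] a] b]|]]]|] //=.
- by move=> [m [tau [t0 e h]]]; exists m, (tau + d); split; [exact: addr_ge0| | exact: resting_later].
- move=> h; have [->|dn] := eqVneq d 0; first by rewrite later0.
  have dp : 0 < d by rewrite lt_def dn.
  by case: h => [h|[m [_ _ _ _ [h _]]]]; left; rewrite /later; [exact: addr_gt0 | rewrite h add0r].
by move=> [tau t0 h]; exists (tau + d); [exact: addr_ge0 | exact: initial_later].
Qed.

Lemma sat_eq1 (x : clk) n v : sat v [:: (x, CmpEq, n)] -> v x = n%:R.
Proof. by rewrite /sat /= andbT => /eqP. Qed.

Lemma good_fires q v q' v' : fires A q true v q' v' -> good q v -> good q' v'.
Proof.
move=> [g [r [he hs -> _]]]; move: hs; case: (redgesP he) => {he} [[] //|[q0 hv [-> -> -> ->]]|].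
  by move=> _ /= [m [tau [_ e _]]]; exists m; rewrite e.
case=> [[q0 [g0 [b [hv [-> -> -> ->]]]]]|[j [-> -> -> ->]]|].
- move=> /sat_eq1 t1 /= [m [tau [_ e h]]]; right; exists m.
  have tE : tau = 1 by case: h => <- _.
  by split=> //; rewrite ?e //; apply: passing_start; rewrite -tE.
- move=> /sat_eq1 t1 /= [tau _ h]; exists 1; first exact: ler01.
  have tE : tau = 1 by case: h => <- _.
  by rewrite /= -[bump 0 j]/(j.+1); apply: initial_step; rewrite -tE.
case=> [[-> -> -> ->]|[j [q0 [g0 [a [b [c [ag [-> -> -> ->]]]]]]]]|[q0 [g0 [a [-> -> -> ->]]]]].
- move=> /sat_eq1 t1 /= [tau _ h]; exists 0%N, 0.
  have tE : tau = 1 by case: h => <- _.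
  by split=> //; apply: initial_end; rewrite -tE.
- rewrite /sat /= andbT => /andP[/eqP t0 xb] [|[m [e hv ea hg h]]]; first by rewrite t0 ltxx.
  right; exists m.
  (* A wrong column has a clock of value at least 2, contrary to the guard. *)
  have bE : b = col (run m) j.
    apply/eqP; case: h => _ /(_ j b); rewrite ltnn; case: eqP => // _ h.
    by have := le_trans h xb; rewrite ler_nat.
  split=> //; first by rewrite bE.
    move=> i; rewrite /= -[bump 0 j]/(j.+1) ltnS leq_eqVlt => /orP[/eqP hi|/hg //].
    by move/forallP/(_ i): ag; rewrite bE !ffunE hi eqxx /= => /eqP <-.
  by rewrite /= -[bump 0 j]/(j.+1) ea -e bE; apply: passing_step; rewrite -bE.
move=> /sat_eq1 t0 /= [|[m [e hv ea hg h]]]; first by rewrite t0 ltxx.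
(* All heads are below [s], so at the end of the pass each of them has been met and its symbol
   verified. *)
have gE : g0 = reading (run m) by apply/ffunP => i; apply: hg; apply: heads.
exists m.+1, 0; split=> //.
  rewrite /tm_run iterS -/(run m) /tm_step e hv gE.
  by rewrite -/(reading (run m)); case: tm_delta.
have -> : reset finset.set0 v = v by apply/funext => x; rewrite /reset inE.
by apply: resting_end; rewrite ?e // -gE.
Qed.

Lemma fires_low q v q' v' : fires A q false v q' v' -> q = fin M s.
Proof. by move=> [g [r [he _ _ _]]]; have [] := rta_low he. Qed.

Lemma bad_rejects q1 v1 q2 v2 : bad A rhigh q1 v1 q2 v2 -> good q1 v1 -> rejects.
Proof.
elim=> {q1 v1 q2 v2} [q1 v1 q2 v2 d a q1' v1' d0 _ ha f _ IH|
  q1 v1 q2 v2 d a q1' v1' d0 _ ha f _|q1 v1 q2 v2 d a q1' v1' q2' v2' d0 _ ha f _ _ _ _] gd.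
- rewrite inE in ha; rewrite (eqP ha) in f.
  by apply: IH; apply: good_fires f _; apply: good_later.
- by rewrite inE in ha; case: a ha f => // _ /fires_low e; move: gd; rewrite e.
by rewrite inE in ha; case: a ha f => // _ /fires_low e; move: gd; rewrite e.
Qed.

(** A\H never leaves its initial location, where no low-level action is possible, so the clocks of
    the second component are irrelevant. *)
Definition doomed q v := forall v2, bad A rhigh q v (ini M (ord0 : 'I_s.+1)) v2.

Lemma doomed_step q v d g r q' : 0 <= d -> (q, g, Some true, r, q') \in redges M s inp ->
  sat (later v d) g -> doomed q' (reset r (later v d)) -> doomed q v.
Proof.
move=> d0 he hs h v2; apply: (bad_high d0 (a := true)) (h _) => //; first by rewrite inE.
by exists g, r.
Qed.

Lemma doomed_fin v : doomed (fin M s) v.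
Proof.
move=> v2; apply: (bad_low (d := 0) (a := false) (q1' := fin M s) (lexx 0)) => //.
- by rewrite inE.
- exists [::], finset.set0; split=> //.
  by rewrite /= /redges mem_cat inE eqxx.
by move=> [_ [q2' [v2' /fires_low]]].
Qed.

(** The right guess at every position of a pass, including the blank that [E_end] demands after the
    last cell. *)
Definition bcol c (j : nat) : colT M := if (j < s)%N then col c j else blankcol M.

Lemma doomed_pass m n j v : (j + n = s)%N -> tm_verdict (cfg_state (run m)) = None ->
  passing (run m) (reading (run m)) j (bcol (run m) j) v ->
  (forall v', resting (run m.+1) 0 v' -> doomed (ready s (cfg_state (run m.+1))) v') ->
  doomed (pas (inord j : 'I_s.+1) (cfg_state (run m), reading (run m), acol (run m) j, bcol (run m) j)) v.
Proof.
move=> jn hv; elim: n j jn v => [|n IH] j jn v h hn.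
  have je : j = s by lia.
  have e1 : inord j = ord_max :> 'I_s.+1 by apply: val_inj; rewrite /= inordK // je.
  have e2 : bcol (run m) j = blankcol M by rewrite /bcol je ltnn.
  rewrite e1 e2; rewrite e2 je in h.
  have rE : reset finset.set0 (later v 0) = v.
    by rewrite later0; apply/funext => x; rewrite /reset inE.
  apply: (@doomed_step _ _ 0 [:: (tclk M s, CmpEq, 0%N)] finset.set0
    (ready s (tm_delta (cfg_state (run m)) (reading (run m))).1)) => //.
  - rewrite /redges !mem_cat; do 6!(apply/orP; right).
    apply/mapP; exists (cfg_state (run m), reading (run m), acol (run m) j, blankcol M) => //.
    by rewrite mem_filter eqxx mem_enum.
  - by rewrite later0 /sat /= h.1 eqxx.
  rewrite rE; have := hn v (resting_end hv h).
  rewrite /tm_run iterS -/(run m) /tm_step hv -/(reading (run m)).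
  by case: tm_delta.
have js : (j < s)%N by lia.
pose jo := Ordinal js.
have e1 : inord j = lo jo by apply: val_inj; rewrite /= inordK // leqW.
have e2 : inord j.+1 = hi jo by apply: val_inj; rewrite /= inordK.
have bE : bcol (run m) j = col (run m) jo by rewrite /bcol js.
rewrite bE in h *; rewrite e1.
apply: (@doomed_step _ _ 0 [:: (tclk M s, CmpEq, 0%N); (xclk jo (col (run m) jo), CmpLe, 1%N)]
  [set xclk jo (newcol (cfg_state (run m), reading (run m), acol (run m) j, col (run m) jo) (bcol (run m) j.+1))]
  (pas (hi jo) (cfg_state (run m), reading (run m), Some (col (run m) jo), bcol (run m) j.+1))) => //.
- rewrite /redges !mem_cat; do 5!(apply/orP; right); apply/orP; left.
  apply/flatten_mapP; exists jo; first by rewrite mem_enum.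
  apply/mapP; exists ((cfg_state (run m), reading (run m), acol (run m) j, col (run m) jo), bcol (run m) j.+1) => //.
  rewrite mem_filter mem_enum andbT /=; apply/forallP => i; apply/implyP.
  by rewrite !ffunE /= => /eqP <-.
- rewrite later0 /sat /= h.1 eqxx /= andbT.
  by have := h.2 jo (col (run m) jo); rewrite ltnn eqxx => ->.
rewrite later0 -e2; apply: IH => //; first lia.
exact: (passing_step (j := jo)).
Qed.

(** Induction on the number [n] of machine steps to a rejecting configuration; one unit of time
    elapses before each pass, and the passes themselves take none. *)
Lemma doomed_ready n m v : tm_verdict (cfg_state (run (m + n))) = Some false ->
  resting (run m) 0 v -> doomed (ready s (cfg_state (run m))) v.
Proof.
elim: n m v => [|n IH] m v hv h.
  rewrite addn0 in hv.
  apply: (@doomed_step _ _ 0 [::] finset.set0 (fin M s)) (doomed_fin _) => //.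
  rewrite /redges !mem_cat; apply/orP; right; apply/orP; left.
  by apply/mapP; exists (cfg_state (run m)) => //; rewrite mem_filter hv eqxx mem_enum.
case hm : (tm_verdict (cfg_state (run m))) => [b|]; last first.
  apply: (@doomed_step _ _ 1 [:: (tclk M s, CmpEq, 1%N)] [set tclk M s]
    (pas ord0 (cfg_state (run m), reading (run m), None, bcol (run m) 0))) => //.
  - rewrite /redges !mem_cat; do 2!(apply/orP; right); apply/orP; left.
    apply/mapP; exists (cfg_state (run m), reading (run m), bcol (run m) 0) => //.
    by rewrite mem_filter /= hm mem_enum.
  - by rewrite /sat /= /later h.1 add0r eqxx.
  have e0 : ord0 = inord 0 :> 'I_s.+1 by apply: val_inj; rewrite /= inordK.
  rewrite e0; apply: (@doomed_pass m s 0) => //.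
    apply: passing_start; have := resting_later 1 h; rewrite add0r; exact.
  by move=> v'; apply: IH; rewrite addSnnS.
(* The machine has already halted, with [n.+1] idle steps left, so fewer idle steps do as well. *)
have e t : run (m + t) = run m.
  by rewrite /tm_run addnC iterD -/(run m) halted_iter // hm.
by apply: IH => //; rewrite e -(e n.+1).
Qed.

Lemma doomed_ini n j tau v : (j + n = s)%N -> tau <= 1 -> initial j tau v -> rejects ->
  doomed (ini M (inord j : 'I_s.+1)) v.
Proof.
move=> jn t1 h [m hm]; have d0 : 0 <= 1 - tau by rewrite subr_ge0.
elim: n j jn tau t1 v h d0 => [|n IH] j jn tau t1 v h d0.
  have je : j = s by lia.
  have e1 : inord j = ord_max :> 'I_s.+1 by apply: val_inj; rewrite /= inordK // je.
  have := initial_later (1 - tau) h; rewrite addrC subrK => h1; rewrite je in h1.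
  rewrite e1; apply: (doomed_step d0 (g := [:: (tclk M s, CmpEq, 1%N)]) (r := [set tclk M s])
    (q' := ready s (tm_start M))).
  - by rewrite /redges !mem_cat; do 4!(apply/orP; right); apply/orP; left; rewrite inE.
  - by rewrite /sat /= h1.1 eqxx.
  by apply: (@doomed_ready m 0) => //; apply: initial_end.
have js : (j < s)%N by lia.
pose jo := Ordinal js.
have e1 : inord j = lo jo by apply: val_inj; rewrite /= inordK // leqW.
have e2 : inord j.+1 = hi jo by apply: val_inj; rewrite /= inordK.
have := initial_later (1 - tau) h; rewrite addrC subrK => h1.
rewrite e1; apply: (doomed_step d0 (g := [:: (tclk M s, CmpEq, 1%N)])
  (r := [set xclk jo (initcol M (inp jo) (jo == 0%N :> nat))]) (q' := ini M (hi jo))).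
- rewrite /redges !mem_cat; do 3!(apply/orP; right); apply/orP; left.
  by apply/mapP; exists jo; rewrite ?mem_enum.
- by rewrite /sat /= h1.1 eqxx.
rewrite -e2; apply: (IH j.+1 _ 1) => //; first lia.
  exact: (initial_step (j := jo)).
by rewrite subrr.
Qed.

Theorem rta_correct : SNNI R A rhigh <-> ~ rejects.
Proof.
have i0 : initial 0 0 (fun _ => 0) by split.
have sb := SNNI_bad (@rta_eps_free M s inp) (@rta_det M s inp R).
split=> [/sb nb rj|nr].
  have e0 : ord0 = inord 0 :> 'I_s.+1 by apply: val_inj; rewrite /= inordK.
  apply: nb; rewrite /= [X in bad _ _ X _ _ _]/ini {1}e0.
  exact: (@doomed_ini s 0 0).
by apply/sb => /bad_rejects b; apply: nr; apply: b; exists 0.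
Qed.

End SimulationCorrect.

(** * Computing the reduction in polynomial time *)

Lemma f_horner (p : {poly nat}) a : PV a -> PV (fun e => p.[a e]%R).
Proof.
move=> fa; rewrite /horner; elim: (polyseq p) => [|c l IH]; first exact: f_const.
exact: (f_add (f_mul IH fa) (f_const c)).
Qed.

Lemma e_cons b f : emittable f -> emittable (fun e => b :: f e).
Proof. exact: (@e_cat (fun _ => [:: b]) f (e_const _)). Qed.

(** The types of locations and clocks depend on [s] and so vary with the input; an edge is therefore
    described by ranks alone. The leading [true] is the list marker of [code_seq]. *)
Definition estr (q : nat) (g : seq (nat * nat * nat)) (b : bool) (r : seq nat) (q' : nat) : seq bool :=
  true :: code_nat q ++
  code_seq (fun a => code_nat a.1.1 ++ code_nat a.1.2 ++ code_nat a.2) g ++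
  (true :: code_elt b) ++ code_seq code_nat r ++ code_nat q'.

Lemma code_seq_map (T U : Type) (f : U -> seq bool) (h : T -> U) l :
  code_seq f (map h l) = code_seq (fun x => f (h x)) l.
Proof. by rewrite /code_seq -map_comp. Qed.

Lemma code_edge_estr (Q X : finType) (q : Q) (g : constraint X) (b : bool) (r : {set X}) q' :
  true :: code_edge (q, g, Some b, r, q') =
  estr (enum_rank q) [seq (enum_rank x.1.1 : nat, nat_of_cmp x.1.2, x.2) | x <- g] b
    [seq enum_rank x : nat | x <- enum r] (enum_rank q').
Proof.
rewrite /estr !code_seq_map.
have <- // : code_constraint g =
  code_seq (fun x => code_nat (enum_rank x.1.1) ++ code_nat (nat_of_cmp x.1.2) ++ code_nat x.2) g.
by rewrite /code_constraint /code_seq; congr (flatten _ ++ _); apply: eq_map => -[[]].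
Qed.

Lemma flatten_map_const (T : Type) (k : seq bool) (l : seq T) :
  flatten [seq k | _ <- l] = flatten (mkseq (fun _ => k) (size l)).
Proof.
have h (U : Type) (l' : seq U) : [seq k | _ <- l'] = nseq (size l') k by elim: l' => //= ? ? ->.
by rewrite /mkseq !h size_iota.
Qed.

Lemma mkseqD (T : Type) (f : nat -> T) m n :
  mkseq f (m + n) = mkseq f m ++ mkseq (fun i => f (m + i)) n.
Proof. by rewrite /mkseq iotaD map_cat -[X in iota X n]addn0 iotaDl -map_comp. Qed.

Lemma map_enum_ord (T : Type) (f : nat -> T) n : [seq f i | i : 'I_n <- enum 'I_n] = mkseq f n.
Proof. by rewrite /mkseq -val_enum_ord -map_comp. Qed.

Section Strings.
Variable M : turing_machine.
Notation St := (tm_state M).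

Definition nready (q : St) : nat := (enum_rank q).+1.
Definition nini (j : nat) : nat := (#|St| + j * #|{: option (passT M)}|).+1.
Definition npas (j : nat) (x : passT M) : nat :=
  (#|St| + (j * #|{: option (passT M)}| + (enum_rank x).+1)).+1.
Definition nclock (j : nat) (d : colT M) : nat := (j * #|colT M| + enum_rank d).+1.

Lemma rank_ready s q : enum_rank (ready s q) = nready q :> nat.
Proof. by rewrite /ready rank_Some rank_inl. Qed.
Lemma rank_ini s (j : 'I_s.+1) : enum_rank (ini M j) = nini j :> nat.
Proof. by rewrite /ini rank_Some rank_inr rank_pair rank_None addn0 rank_ord. Qed.
Lemma rank_pas s (j : 'I_s.+1) x : enum_rank (pas j x) = npas j x :> nat.
Proof. by rewrite /pas rank_Some rank_inr rank_pair rank_Some rank_ord. Qed.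
Lemma rank_xclk s (j : 'I_s) d : enum_rank (xclk j d) = nclock j d :> nat.
Proof. by rewrite /xclk rank_Some rank_pair rank_ord. Qed.
Lemma rank_fin s : enum_rank (fin M s) = 0 :> nat.
Proof. exact: rank_None. Qed.
Lemma rank_tclk s : enum_rank (tclk M s) = 0 :> nat.
Proof. exact: rank_None. Qed.

Definition rankE := (rank_ready, rank_ini, rank_pas, rank_xclk, rank_fin, rank_tclk).

Definition s_const : seq bool :=
  estr 0 [::] false [::] 0 ++
  flatten [seq estr (nready q) [::] true [::] 0 | q <- enum St & tm_verdict q == Some false] ++
  flatten [seq estr (nready x.1.1) [:: (0, 2, 1)] true [:: 0] (npas 0 (x.1.1, x.1.2, None, x.2))
  | x : St * guess M * colT M <- enum {: St * guess M * colT M} & tm_verdict x.1.1 == None].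
Definition s_ini (o : option bool) (j : nat) : seq bool :=
  estr (nini j) [:: (0, 2, 1)] true [:: nclock j (initcol M o (j == 0))] (nini j.+1).
Definition s_iend (s : nat) : seq bool :=
  estr (nini s) [:: (0, 2, 1)] true [:: 0] (nready (tm_start M)).
Definition s_step (j : nat) : seq bool :=
  flatten [seq estr (npas j x.1) [:: (0, 2, 0); (nclock j x.1.2, 1, 1)] true
                 [:: nclock j (newcol x.1 x.2)] (npas j.+1 (x.1.1.1.1, x.1.1.1.2, Some x.1.2, x.2))
  | x : passT M * colT M <- enum {: passT M * colT M} & agrees x.1].
Definition s_end (s : nat) : seq bool :=
  flatten [seq estr (npas s x) [:: (0, 2, 0)] true [::] (nready (tm_delta x.1.1.1 x.1.1.2).1)
  | x : passT M <- enum (passT M) & x.2 == blankcol M].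

Definition s_head (s : nat) : seq bool :=
  flatten (mkseq (fun _ => [:: true]) (s * #|colT M|).+1) ++ [:: false] ++
  code_seq (fun a : bool => [:: a \in rhigh]) (enum {: bool}) ++
  flatten (mkseq (fun _ => [:: true; false]) (#|St| + s.+1 * #|{: option (passT M)}|).+1) ++
  [:: false] ++ code_nat (nini 0) ++ s_const.

Lemma flatten_edges s (T : Type) (f : T -> tedg M s) (h : T -> seq bool) l :
  (forall x, true :: code_edge (f x) = h x) ->
  flatten [seq true :: code_edge e | e <- map f l] = flatten (map h l).
Proof. by move=> e; rewrite -map_comp; congr flatten; apply: eq_map. Qed.

Lemma flatten_seq1 (T U : Type) (f : T -> seq U) x : flatten [seq f y | y <- [:: x]] = f x.
Proof. exact: cats0. Qed.

Lemma card_clk s : #|clk M s| = (s * #|colT M|).+1.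
Proof. by rewrite card_option card_prod card_ord. Qed.

Lemma card_loc s : #|loc M s| = (#|St| + s.+1 * #|{: option (passT M)}|).+1.
Proof. by rewrite [LHS]card_option card_sum card_prod card_ord. Qed.

Lemma code_redges s inp : flatten [seq true :: code_edge e | e <- redges M s inp] =
  s_const ++ flatten (mkseq (fun j => s_ini (inp j) j) s) ++
  s_iend s ++ flatten (mkseq s_step s) ++ s_end s.
Proof.
pose f (e : tedg M s) := true :: code_edge e.
have h1 : flatten (map f (E_fin M s)) = estr 0 [::] false [::] 0.
  by rewrite [LHS]flatten_seq1 /f code_edge_estr enum_set0 !rankE.
have h2 : flatten (map f (E_rej M s)) = flatten [seq estr (nready q) [::] true [::] 0
    | q <- enum St & tm_verdict q == Some false].
  by apply: flatten_edges => q; rewrite code_edge_estr enum_set0 !rankE.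
have h3 : flatten (map f (E_start M s)) = flatten [seq estr (nready x.1.1) [:: (0, 2, 1)] true
    [:: 0] (npas 0 (x.1.1, x.1.2, None, x.2))
  | x : St * guess M * colT M <- enum {: St * guess M * colT M} & tm_verdict x.1.1 == None].
  by apply: flatten_edges => x; rewrite code_edge_estr enum_set1 !map_cons !rankE.
have h4 : flatten (map f (map (e_ini M inp) (enum 'I_s))) =
    flatten (mkseq (fun j => s_ini (inp j) j) s).
  rewrite -map_enum_ord; apply: flatten_edges => j.
  by rewrite code_edge_estr enum_set1 !map_cons !rankE.
have h5 : flatten (map f (E_iend M s)) = s_iend s.
  by rewrite [LHS]flatten_seq1 /f code_edge_estr enum_set1 !map_cons !rankE.
have h6 : flatten (map f (flatten (map (@E_step M s) (enum 'I_s)))) = flatten (mkseq s_step s).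
  rewrite -map_enum_ord; elim: (enum 'I_s) => // j l IH.
  have cons (T U : Type) (g : T -> seq U) x k : flatten (map g (x :: k)) = g x ++ flatten (map g k) by [].
  rewrite !cons map_cat flatten_cat IH; congr (_ ++ _).
  by apply: flatten_edges => x; rewrite code_edge_estr enum_set1 !map_cons !rankE.
have h7 : flatten (map f (E_end M s)) = s_end s.
  by apply: flatten_edges => x; rewrite code_edge_estr enum_set0 !map_cons !rankE.
by rewrite -/f /redges !map_cat !flatten_cat h1 h2 h3 h4 h5 h6 h7 /s_const -!catA.
Qed.

Lemma code_rta s inp : code_ta (rta M s inp) rhigh =
  s_head s ++ flatten (mkseq (fun j => s_ini (inp j) j) s) ++
  s_iend s ++ flatten (mkseq s_step s) ++ s_end s ++ [:: false].
Proof.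
have hX : code_seq (fun _ : clk M s => [::]) (enum (clk M s)) =
    flatten (mkseq (fun _ => [:: true]) (s * #|colT M|).+1) ++ [:: false].
  by rewrite /code_seq flatten_map_const -cardE card_clk.
have hQ : code_seq (fun q => code_constraint (ta_inv (rta M s inp) q)) (enum (loc M s)) =
    flatten (mkseq (fun _ => [:: true; false]) (#|St| + s.+1 * #|{: option (passT M)}|).+1) ++
    [:: false].
  by rewrite -card_loc cardE -flatten_map_const.
have hi : code_elt (ta_init (rta M s inp)) = code_nat (nini 0) by rewrite /code_elt rank_ini.
have hE : code_seq (@code_edge _ _ _) (ta_edges (rta M s inp)) =
    (s_const ++ flatten (mkseq (fun j => s_ini (inp j) j) s) ++
     s_iend s ++ flatten (mkseq s_step s) ++ s_end s) ++ [:: false].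
  by rewrite -code_redges.
by rewrite /code_ta hX hQ hi hE /s_head -!catA.
Qed.

Ltac emit := cbv beta; lazymatch goal with
  | |- emittable (fun _ => cons _ _) => apply: e_cons; emit
  | |- emittable (fun _ => cat _ _) => apply: e_cat; emit
  | |- emittable (fun e => code_nat (@?a e)) => apply: (@e_code_nat a); by feas
  | |- _ => exact: e_const
  end.

(** The rank of the initial column depends on [j] only through the test [j == 0], so it is a choice
    between two constants. *)
Lemma e_s_ini o j : PV j -> emittable (fun e => s_ini o (j e)).
Proof.
move=> fj.
apply: (@e_ext (fun e => estr (nini (j e)) [:: (0, 2, 1)] true
  [:: (j e * #|colT M| + (if j e == 0 then enum_rank (initcol M o true) : nat
       else enum_rank (initcol M o false))).+1] (nini (j e).+1))).
  by move=> e; rewrite /s_ini /nclock; case: eqP.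
rewrite /estr /code_seq /nini; cbn [map flatten foldr fst snd]; emit.
Qed.

Lemma e_s_iend s : PV s -> emittable (fun e => s_iend (s e)).
Proof.
move=> fs; rewrite /s_iend /estr /code_seq /nini; cbn [map flatten foldr fst snd]; emit.
Qed.

Lemma e_s_step j : PV j -> emittable (fun e => s_step (j e)).
Proof.
move=> fj; apply: (e_flatten (F := fun x e => _)) => x.
rewrite /estr /code_seq /npas /nclock; cbn [map flatten foldr fst snd]; emit.
Qed.

Lemma e_s_end s : PV s -> emittable (fun e => s_end (s e)).
Proof.
move=> fs; apply: (e_flatten (F := fun x e => _)) => x.
rewrite /estr /code_seq /npas; cbn [map flatten foldr fst snd]; emit.
Qed.

Lemma e_s_head s : PV s -> emittable (fun e => s_head (s e)).
Proof.
move=> fs; rewrite /s_head; apply: e_cat.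
  by apply: e_for; [feas | exact: e_const].
apply: e_cat; first exact: e_const.
apply: e_cat; first exact: e_const.
apply: e_cat; last exact: e_const.
by apply: e_for; [feas | exact: e_const].
Qed.

(** With [size w + p.[size w]] cells, the edges initialising the first [size w] cells are output
    while the input is read, one for each bit, and the remaining blank cells are counted by a
    loop. *)
Lemma rta_transducer (p : {poly nat}) : exists (T : turing_machine) (P : {poly nat}), forall w,
  outputs_in_time T w (code_ta (rta M (size w + p.[size w]%R) (inp w)) rhigh) P.[size w]%R.
Proof.
have f0 : PV (fun e => e 0) by exact: f_var.
have fs : PV (fun e => e 0 + p.[e 0]%R) by apply: f_add => //; exact: f_horner.
pose s (e : env) : nat := e 0 + p.[e 0]%R.
pose f1 e := s_head (s e).
pose f2 e := flatten (mkseq (fun i => s_ini None (e 0 + i)) p.[e 0]%R) ++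
  s_iend (s e) ++ flatten (mkseq s_step (s e)) ++ s_end (s e) ++ [:: false].
pose F b (e : env) j := s_ini (Some b) j.
have ef1 : emittable f1 by exact: e_s_head.
have ef2 : emittable f2.
  apply: e_cat.
    apply: (e_for (F := fun e i => s_ini None (e 0 + i))); first exact: f_horner.
    by apply: (@e_s_ini _ (fun e => e 1 + e 0)); feas.
  apply: e_cat; first exact: e_s_iend.
  apply: e_cat.
    by apply: (e_for (F := fun _ => s_step)) => //; exact: (@e_s_step (fun e => e 0) f0).
  by apply: e_cat; [exact: e_s_end | exact: e_const].
have eF b : emittable1 (F b) by exact: (@e_s_ini _ (fun e => e 0) f0).
have [T [P h]] := transducer_exists ef1 ef2 (eF false) (eF true).
exists T, P => w; have := h w; congr outputs_in_time.
rewrite code_rta mkseqD flatten_cat; set n := size w.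
have -> : mkseq (fun j => s_ini (inp w j) j) n =
    mkseq (fun j => if nth false w j then s_ini (Some true) j else s_ini (Some false) j) n.
  apply/eq_in_map => j; rewrite mem_iota add0n => /andP[_ hj].
  by rewrite /inp hj; case: nth.
have -> : mkseq (fun i => s_ini (inp w (n + i)) (n + i)) p.[n]%R =
    mkseq (fun i => s_ini None (n + i)) p.[n]%R.
  by apply: eq_map => i; rewrite /inp ltnNge leq_addr.
by rewrite -catA.
Qed.

End Strings.

Theorem SNNI_PSPACE_hard (R : realType) : PSPACE_hard (SNNI_problem R).
Proof.
move=> L [M [p hM]]; have [T [P hT]] := rta_transducer M p.
exists T, P, (fun w => rinst M (size w + p.[size w]%R) (inp w) R) => w; split; first exact: hT.
have [sp [t [b [hb bL]]]] := hM w.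
have hs u i : cfg_head (tm_run M w u) i < size w + p.[size w]%R.
  by apply: leq_trans (sp u i) _; exact: leq_addl.
have [sn ns] := @rta_correct R M w _ hs.
(* A halted machine keeps its configuration, so verdicts at different times agree. Hence never
   rejecting, which is what SNNI expresses, amounts to accepting. *)
have uniq u b' : halts_with M w u b' -> b' = b.
  move=> hu.
  have halt v c n : halts_with M w v c -> tm_run M w (n + v) = tm_run M w v.
    by move=> hv; rewrite /tm_run iterD halted_iter // -/(tm_run M w v) hv.
  have e := halt _ _ t hu; rewrite addnC (halt _ _ u hb) in e.
  by move: hu; rewrite /halts_with -e hb => -[].
split=> [Lw|h].
  by apply: ns => -[u hu]; have := uniq _ _ hu; move/bL: Lw => /= ->.
apply/bL; case: b hb uniq {bL} => // hb _.
by case: (sn h); exists t.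
Qed.

Theorem theorem1 (R : realType) : PSPACE_complete (SNNI_problem R).
Proof. by split; [exact: SNNI_in_PSPACE | exact: SNNI_PSPACE_hard]. Qed.
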